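(* Let $p$ be an odd prime. Then $$S_{p-1}\equiv\left(\frac{-2}{p}\right)\pmod p,$$ and $$\chi'(K_{p-1})=\chi'_{\ell}(K_{p-1})=\chi'_{\mathrm P}(K_{p-1})=p-2.$$ Here $\left(\frac{\cdot}{p}\right)$ is the Legendre symbol, and $S_n$, $\chi'$, $\chi'_\ell$, $\chi'_{\mathrm P}$ are as defined in the context.
   Context: Signed count. Let $n$ be even and order the vertices of $K_n$ as $0<1<\dots<n-1$. For a perfect matching $M$ let $\operatorname{cr}(M)$ be the number of unordered pairs of edges $\{a,c\},\{b,d\}\in M$ with $a<b<c<d$ (crossing pairs), and put $\varepsilon(M)=(-1)^{\operatorname{cr}(M)}$. A one-factorization of a graph is a partition of its edge set into perfect matchings (an unordered collection, whose members are called factors). For a one-factorization $\mathcal F$ put $\varepsilon(\mathcal F)=\prod_{M\in\mathcal F}\varepsilon(M)$. Define $S_n=\sum_{\mathcal F}\varepsilon(\mathcal F)$, the sum over all one-factorizations of $K_n$. Coloring indices of a graph $G$. $\chi'(G)$ is the ordinary edge chromatic index. $\chi'_\ell(G)$ is the least integer $k$ such that whenever each edge is assigned a list of $k$ colors, the edges can be properly colored from their lists. The edge-paintability index $\chi'_{\mathrm P}(G)$ is the least $k$ for which Painter has a winning strategy in the following game: each edge starts with $k$ tokens; in each round Lister marks a nonempty set of uncolored edges and removes one token from each of them; Painter then colors a matching consisting of marked edges (these edges are then colored permanently). After Painter's move, Lister wins if some uncolored edge has no token left. Painter wins if every edge is eventually colored. *)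

(* Defs.v *)
From HB Require Import structures.
From mathcomp Require Import all_boot all_order all_algebra.

Set Implicit Arguments.
Unset Strict Implicit.
Unset Printing Implicit Defensive.

Import Order.TTheory GRing.Theory Num.Theory.

(* A simple graph on a finite vertex type T is given by its set of edges
   E : {set {set T}}, each edge being a 2-element set of vertices. *)

Definition complete_graph (n : nat) : {set {set 'I_n}} :=
  [set e : {set 'I_n} | #|e| == 2].

Section Matchings.
Variable T : finType.
Implicit Types (E M B : {set {set T}}) (F : {set {set {set T}}}).

Definition matching E B : bool := (B \subset E) && trivIset B.

Definition perfect_matching E M : bool :=
  (M \subset E) && partition M [set: T].

Definition one_factorization E F : bool :=
  partition F E && [forall M in F, perfect_matching E M].

End Matchings.

Section SignedCount.
Variable n : nat.

(* crossing e f is asymmetric: the smallest of the four endpoints is in e.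
   The pairs counted by cr are nevertheless unordered, being sets [set e; f]. *)
Definition crossing (e f : {set 'I_n}) : bool :=
  [exists a : 'I_n, exists b : 'I_n, exists c : 'I_n, exists d : 'I_n,
    [&& a < b, b < c, c < d, e == [set a; c] & f == [set b; d]]].

Definition cr (M : {set {set 'I_n}}) : nat :=
  #|[set [set e; f] | e in M, f in M & crossing e f]|.

Definition matching_sign (M : {set {set 'I_n}}) : int := ((-1) ^+ cr M)%R.

Definition factorization_sign (F : {set {set {set 'I_n}}}) : int :=
  (\prod_(M in F) matching_sign M)%R.

Definition signed_count : int :=
  (\sum_(F : {set {set {set 'I_n}}} | one_factorization (complete_graph n) F)
      factorization_sign F)%R.

End SignedCount.

Definition legendre (a : int) (p : nat) : int :=
  if (p %| a)%Z then 0%R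
  else if [exists x : 'I_p, ((x : nat)%:Z ^+ 2 == a %[mod p])%Z] then 1%R
  else (-1)%R.

Definition is_least (P : nat -> Prop) (k : nat) : Prop :=
  P k /\ forall j, P j -> k <= j.

Section ColoringIndices.
Variable T : finType.
Implicit Types (E U A B : {set {set T}}) (t : {ffun {set T} -> nat}).

(* Only the values of c on E matter. *)
Definition proper_edge_coloring (C : Type) E (c : {set T} -> C) : Prop :=
  forall e f, e \in E -> f \in E -> e != f -> ~~ [disjoint e & f] -> c e <> c f.

Definition edge_colorable E (k : nat) : Prop :=
  exists c : {set T} -> nat,
    (forall e, e \in E -> c e < k) /\ proper_edge_coloring E c.

(* Colors are natural numbers, without loss of generality: only finitely many
   of them occur in the lists of a finite graph. *)
Definition edge_choosable E (k : nat) : Prop :=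
  forall L : {set T} -> seq nat,
    (forall e, e \in E -> uniq (L e) /\ size (L e) = k) ->
    exists c : {set T} -> nat,
      (forall e, e \in E -> c e \in L e) /\ proper_edge_coloring E c.

Definition lister_move U A : bool := (A \subset U) && (A != set0).

Definition remove_tokens t A : {ffun {set T} -> nat} :=
  [ffun e => t e - (e \in A)].

(* painter_wins U t: Painter wins from the position, with Lister to move, in
   which U is the set of uncolored edges and t e the number of tokens left on
   e. The first premise says that Lister has not won yet, s is Painter's reply
   to each move of Lister. Lister has a legal move exactly when U is nonempty,
   so that, the predicate being inductive, every play compatible with the
   replies ends after finitely many rounds, with all edges colored. *)
Inductive painter_wins (U : {set {set T}}) (t : {ffun {set T} -> nat}) : Prop :=
  PainterWins (s : {set {set T}} -> {set {set T}}) of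
    (forall e, e \in U -> 0 < t e) &
    (forall A, lister_move U A -> matching A (s A)) &
    (forall A, lister_move U A ->
       painter_wins (U :\: s A) (remove_tokens t A)).

Definition edge_paintable E (k : nat) : Prop :=
  painter_wins E [ffun=> k].

Definition is_chromatic_index E : nat -> Prop := is_least (edge_colorable E).

Definition is_list_chromatic_index E : nat -> Prop :=
  is_least (edge_choosable E).

Definition is_paintability_index E : nat -> Prop :=
  is_least (edge_paintable E).

End ColoringIndices.

(* Main.v *)
Require Import Defs.
From HB Require Import structures.
From mathcomp Require Import all_boot all_fingroup all_order all_algebra.
From mathcomp Require Import cyclic finfield zify ring.

Set Implicit Arguments.
Unset Strict Implicit.
Unset Printing Implicit Defensive.

Import Order.TTheory GRing.Theory Num.Theory.

(* Let n = p - 1, let F be the field with p elements, and let W be the sum, over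
   the colorings of the edges of K_n by the colors other than a, of the product
   over the vertices v of the sign of w |-> color of vw, where v itself is sent
   to a. Grouping by factorizations, W = +-(n - 1)! S_n, and (n - 1)! = 1 in F.

   Adding to K_n the edges of the matching v ~ n - 1 - v, with free colors,
   gives a sum W' over colorings with n colors at each vertex. The invariance
   of the signed sums under infinitesimal rotations of the color space relates
   the sums with r and r + 1 free additional edges, and W' = (n/2 + 1) W.
   On the other hand W' is, up to the same sign, the sum over all weights xi of
   the edges of the enlarged graph, with values in F, of
   (prod_e xi_e ^ (p - 2)) P(X) ^ n, where X is the weighted skew adjacency
   matrix and P(X) a nonzero multiple of its Pfaffian. By Fermat, P(X) ^ n is 1
   if X is invertible and 0 otherwise, hence it is the number of v in the
   kernel of X, mod p. Expanding the indicator functions [Xv = 0]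
   and summing over xi leaves a sum over perfect matchings B of the enlarged
   graph and vectors v. Antisymmetry under the exchange of two vertices kills
   all but n/2 + 1 matchings B, whose contributions are equal and evaluated by
   the Vandermonde determinant as (-2) ^ (n/2). So S_n = (-2) ^ (n/2) in F,
   which is the Legendre symbol by Euler's criterion.

   Since W <> 0 in F, so is the sum of the line graph polynomial times
   prod_e x_e (x_e - 1) over all x in F^E, hence the monomial
   prod_e x_e ^ (n - 2) occurs in that polynomial. By the Alon-Tarsi method for
   the painting game, n - 1 = p - 2 tokens per edge suffice for Painter. *)

(** Fermat's theorem makes an indicator function of the power [p - 1] only, whereas the
    [n - 1 = p - 2] colors of [K_n] would give the power [n - 1] of the Pfaffian. This obstacle is
    the reason for adding a perfect matching: the enlarged graph is [n]-regular, each of its [n]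
    color classes contributes one Pfaffian, and the weights [xi_e ^ (p - 2)] select the terms in
    which every edge is used once. The price is the comparison of [W'] with [W]; its factor
    [n/2 + 1] is nonzero in [F] and reappears as the number of surviving matchings [B], so it
    cancels. The Pfaffian is replaced by a sum over all permutations, which avoids choosing
    representatives of matchings; the multiplicity so introduced is prime to [p] and disappears in
    the power [n]. The sign relating vertex signs to matching signs is never computed: it is the
    same constant [kappa] for [W] and [W']. *)

(** * Signs of self-maps of finite sets *)

Section FunctionSign.
Local Open Scope ring_scope.
Variable R : comNzRingType.

(** The sum has at most one term: this is the sign, extended by 0 to maps that are not injective.
    Improper colorings thus have sign 0 and need not be excluded from sums. *)
Definition fsgn (T : finType) (f : T -> T) : R :=
  \sum_(s : {perm T} | [forall x, s x == f x]) (-1) ^+ s.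

Lemma eq_fsgn (T : finType) (f g : T -> T) : f =1 g -> fsgn f = fsgn g.
Proof.
move=> fg; apply: eq_bigl => s; apply: eq_forallb => x; by rewrite fg.
Qed.

Lemma fsgn_perm (T : finType) (s : {perm T}) : fsgn s = (-1) ^+ s.
Proof.
rewrite /fsgn (big_pred1 s) // => t; apply/forallP/eqP => [ts|-> //].
by apply/permP => x; apply/eqP.
Qed.

Lemma fsgn0 (T : finType) (f : T -> T) : ~ injective f -> fsgn f = 0.
Proof.
move=> ninj; rewrite /fsgn big1 // => s /forallP sf; case: ninj => x y fxy.
by apply: (@perm_inj _ s); rewrite (eqP (sf x)) (eqP (sf y)).
Qed.

Lemma fsgn_inj (T : finType) (f : T -> T) (fI : injective f) :
  fsgn f = (-1) ^+ (perm fI).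
Proof. by rewrite -fsgn_perm; apply: eq_fsgn => x; rewrite permE. Qed.

Lemma fsgnP (T : finType) (f : T -> T) : injective f \/ fsgn f = 0.
Proof.
by have [fI|fN] := altP (@injectiveP _ _ f); [left | right; apply: fsgn0; apply/injectiveP].
Qed.

Lemma fsgn_comp (T : finType) (f g : T -> T) :
  fsgn (f \o g) = fsgn f * fsgn g.
Proof.
case: (fsgnP g) => [gI|g0]; last first.
  rewrite g0 mulr0; apply: fsgn0 => fgI.
  have gI : injective g by apply: (@inj_compr _ _ _ f).
  by move/eqP: g0; rewrite (fsgn_inj gI) signr_eq0.
case: (fsgnP f) => [fI|f0]; last first.
  rewrite f0 mul0r; apply: fsgn0 => fgI.
  have fI : injective f.
    by apply: (eq_inj (inj_comp fgI (can_inj (f_invF gI)))) => x /=; rewrite f_invF.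
  by move/eqP: f0; rewrite (fsgn_inj fI) signr_eq0.
rewrite (fsgn_inj fI) (fsgn_inj gI) mulrC -signr_addb -odd_permM -fsgn_perm.
by apply: eq_fsgn => x; rewrite permM !permE.
Qed.

Lemma fsgn_id (T : finType) : fsgn (@id T) = 1.
Proof.
have <- : fsgn (1%g : {perm T}) = 1 by rewrite fsgn_perm odd_perm1.
by apply: eq_fsgn => x; rewrite perm1.
Qed.

Lemma fsgn_sqr (T : finType) (f : T -> T) : injective f -> fsgn f ^+ 2 = 1.
Proof. by move=> fI; rewrite (fsgn_inj fI) sqrr_sign. Qed.

Lemma fsgn_det n (f : 'I_n -> 'I_n) :
  fsgn f = \det (\matrix_(i, j) (f i == j)%:R).
Proof.
rewrite /fsgn /determinant big_mkcond; apply: eq_bigr => s _.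
case: ifPn => [/forallP sf | ].
  by rewrite big1 ?mulr1 // => i _; rewrite mxE eq_sym sf.
case/forallPn => i sfi; rewrite (bigD1 i) //= mxE eq_sym (negPf sfi).
by rewrite mul0r mulr0.
Qed.

Section Fibers.
Variables V W : finType.

Definition fiber_map (f : V -> W -> W) (x : V * W) : V * W := (x.1, f x.1 x.2).

Definition fiber1 v (g : W -> W) := fiber_map (fun u => if u == v then g else id).

(** Both sides are multiplicative in [s], which reduces the claim to a transposition; acting in a
    single fiber, it is again a transposition. *)
Lemma fsgn_fiber1 v (s : {perm W}) : fsgn (fiber1 v s) = fsgn s.
Proof.
have hom (g h : W -> W) :
    fsgn (fiber1 v (g \o h)) = fsgn (fiber1 v g) * fsgn (fiber1 v h).
  rewrite -fsgn_comp; apply: eq_fsgn => -[u w]; rewrite /fiber1 /fiber_map /=.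
  by case: eqP.
have [ts -> _] := prod_tpermP s; elim: ts => [|[a b] ts IHts] /=.
  rewrite big_nil fsgn_perm odd_perm1 expr0 -[RHS](@fsgn_id (V * W)%type).
  apply: eq_fsgn => -[u w]; rewrite /fiber1 /fiber_map /=; case: eqP => //.
  by rewrite perm1.
rewrite big_cons /= !fsgn_perm odd_permM signr_addb -!fsgn_perm -IHts mulrC.
rewrite -(_ : fsgn (fiber1 v (tperm a b)) = fsgn (tperm a b)).
  rewrite -hom; apply: eq_fsgn => -[u w]; rewrite /fiber1 /fiber_map /=.
  by case: eqP => // _; rewrite permM.
rewrite fsgn_perm odd_tperm -(_ : (v, a) != (v, b) = (a != b)); last first.
  by rewrite xpair_eqE eqxx.
rewrite -odd_tperm -fsgn_perm; apply: eq_fsgn => -[u w].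
rewrite /fiber1 /fiber_map /=; case: (eqVneq u v) => [->|uv].
  by rewrite (@inj_tperm _ _ (pair v)) // => x y [].
by rewrite tpermD // xpair_eqE eq_sym (negPf uv).
Qed.

Lemma fsgn_fiber_map (f : V -> W -> W) :
  fsgn (fiber_map f) = \prod_v fsgn (f v).
Proof.
have [/forallP fI|/forallPn[v fvI]] := boolP [forall v, injectiveb (f v)]; last first.
  rewrite (bigD1 v) //= [X in X * _]fsgn0 ?mul0r; last by apply/injectiveP.
  rewrite fsgn0 // => FI; case/injectiveP: fvI => a b fab.
  suff [] // : (v, a) = (v, b) by [].
  by apply: FI; rewrite /fiber_map /= fab.
rewrite -big_enum /=.
have: uniq (enum V) by rewrite enum_uniq.
(* The list of the induction contains all fibers where [f] may differ from the identity; they are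
   split off one at a time. *)
have: forall v, v \notin enum V -> f v =1 id by move=> v; rewrite mem_enum.
elim: (enum V) f fI => [|v r IHr] f fI fid.
  rewrite big_nil -[RHS](@fsgn_id (V * W)%type) => _.
  by apply: eq_fsgn => -[u w]; rewrite /fiber_map /= fid.
rewrite big_cons /= => /andP[vr ur].
pose g u := if u == v then id else f u.
have -> : \prod_(u <- r) fsgn (f u) = \prod_(u <- r) fsgn (g u).
  rewrite big_seq [RHS]big_seq; apply: eq_bigr => u ur'; rewrite /g.
  by case: eqP => // uv; rewrite -uv ur' in vr.
rewrite -(IHr g) //; last 2 first.
- by move=> u; rewrite /g; case: eqP => [_|_]; [apply/injectiveP|].
- move=> u ur'; rewrite /g; case: eqP => // /eqP uv; apply: fid.
  by rewrite inE negb_or uv.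
have fvI : injective (f v) by apply/injectiveP.
rewrite (fsgn_inj fvI) -fsgn_perm -(fsgn_fiber1 v) -fsgn_comp.
apply: eq_fsgn => -[u w]; rewrite /fiber1 /fiber_map /g /=.
by case: eqP => [->|//]; rewrite permE.
Qed.

End Fibers.
End FunctionSign.

(** * Permutations commuting with a fixed-point-free involution *)

Section PairSign.
Local Open Scope ring_scope.
Variables (R : comNzRingType) (T : finType) (beta : T -> T) (H : {set T}).
Hypothesis betaK : involutive beta.
Hypothesis betaH : forall x, (beta x \in H) = (x \notin H).

Let odd_fun (theta : T -> R) := forall x, theta (beta x) = - theta x.

Let half_sign (s : {perm T}) := forall theta, odd_fun theta ->
  \prod_(x in H) theta (s x) = (-1) ^+ s * \prod_(x in H) theta x.

Let beta_neq x : beta x != x.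
Proof. by apply/eqP => bx; have := betaH x; rewrite bx; case: (x \in H). Qed.

Let half_sign1 : half_sign 1%g.
Proof.
move=> theta _; rewrite odd_perm1 mul1r.
by apply: eq_bigr => x _; rewrite perm1.
Qed.

Let half_signM (s t : {perm T}) : (forall x, t (beta x) = beta (t x)) ->
  half_sign s -> half_sign t -> half_sign (s * t)%g.
Proof.
move=> tb hs ht theta oddth; have := hs (fun x => theta (t x)).
under eq_bigr do rewrite -permM.
move=> -> => [|x]; last by rewrite tb oddth.
by rewrite ht // mulrA -signr_addb -odd_permM.
Qed.

Let half_sign_flip x : half_sign (tperm x (beta x)).
Proof.
move=> theta oddth; rewrite odd_tperm eq_sym beta_neq.
wlog xH : x / x \in H => [wl|].
  have [|xNH] := boolP (x \in H); first exact: wl.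
  by rewrite tpermC -{2}(betaK x); apply: wl; rewrite betaH.
rewrite (bigD1 x) //= [in RHS](bigD1 x) //= tpermL oddth mulrA expr1 mulN1r.
congr (_ * _); apply: eq_bigr => y /andP[yH yx].
have bxy : beta x != y by apply: contraTneq yH => <-; rewrite betaH xH.
by rewrite tpermD // eq_sym.
Qed.

Let half_sign_swap x y : y != x -> y != beta x ->
  half_sign (tperm x y * tperm (beta x) (beta y))%g.
Proof.
move=> yx ybx theta oddth.
have bxy : (beta x == beta y) = (x == y) by rewrite (inj_eq (can_inj betaK)).
have xby : x != beta y by apply: contraNneq ybx => ->; rewrite betaK.
rewrite odd_permM !odd_tperm bxy addbb mul1r.
wlog xH : x y yx ybx bxy xby / x \in H => [wl|].
  have [|xNH] := boolP (x \in H); first exact: wl.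
  have yxb : beta y != x by rewrite eq_sym.
  have xbx := beta_neq x; have yby := beta_neq y.
  rewrite -(wl (beta x) (beta y)) ?betaK ?betaH //; last first.
  - by rewrite eq_sym.
  - by rewrite eq_sym bxy eq_sym.
  apply: eq_bigr => z _; congr theta; rewrite !permM.
  have [->|zx] := eqVneq z x.
    by rewrite tpermL ![tperm (beta x) _ _]tpermD ?tpermL // eq_sym.
  have [->|zy] := eqVneq z y.
    by rewrite tpermR ![tperm (beta x) _ _]tpermD ?tpermR // eq_sym.
  rewrite (@tpermD _ x y z) 1?eq_sym //.
  case: (tpermP (beta x) (beta y) z) => *; first by rewrite tpermD // eq_sym.
    by rewrite tpermD // eq_sym.
  by rewrite tpermD // eq_sym.
pose y' := if y \in H then y else beta y.
have y'H : y' \in H by rewrite /y'; case: ifPn => //; rewrite betaH.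
have xy' : y' != x by rewrite /y'; case: ifP => // _; rewrite eq_sym.
rewrite (bigD1 x) //= (bigD1 y') ?y'H //= [RHS](bigD1 x) //=.
rewrite [in RHS](bigD1 y') ?y'H //= !mulrA; congr (_ * _).
  have yxb : beta y != x by rewrite eq_sym.
  have xbx := beta_neq x; have yby := beta_neq y.
  have tx : tperm (beta x) (beta y) (tperm x y x) = y.
    by rewrite tpermL tpermD // eq_sym.
  rewrite !permM tx /y'; case: ifP => _.
    by rewrite tpermR tpermD // mulrC.
  rewrite [tperm x y _]tpermD ?tpermR ?oddth ?mulrN ?[theta y * _]mulrC //.
  by rewrite eq_sym.
apply: eq_bigr => z /andP[/andP[zH zx] zy']; congr theta.
have zbx : z != beta x by apply: contraTneq zH => ->; rewrite betaH xH.
have zy : z != y.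
  by move: zy'; rewrite /y'; case: ifPn => // yH _; apply: contraNneq yH => <-.
have zby : z != beta y.
  move: zy'; rewrite /y'; case: ifPn => // yH _.
  by apply: contraTneq zH => ->; rewrite betaH yH.
by rewrite permM !tpermD // eq_sym.
Qed.

(** A permutation commuting with [beta] is a product of flips [(x, beta x)] and double swaps
    [(x, y)(beta x, beta y)]. A flip is odd and negates one factor; a double swap is even and keeps
    the product, since an exchange across [H] introduces two minus signs. *)
Lemma perm_half_sign (s : {perm T}) (theta : T -> R) :
  (forall x, s (beta x) = beta (s x)) ->
  (forall x, theta (beta x) = - theta x) ->
  \prod_(x in H) theta (s x) = (-1) ^+ s * \prod_(x in H) theta x.
Proof.
move=> sb; move: theta; rewrite -/(half_sign s).
have [k] := ubnP #|[set x | s x != x]|.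
elim: k s sb => // k IHk s sb; rewrite ltnS => le_k.
have [/existsP[x sx]|/existsPn fix_s] := boolP [exists x, s x != x]; last first.
  have -> // : s = 1%g.
  by apply/permP => x; rewrite perm1; apply/eqP; have := fix_s x; rewrite negbK.
(* As [t] sends [s x] back to [x] and fixes the fixed points of [s], the product [s * t] moves fewer
   points than [s]. *)
suff [t [tK tb ht tsx tfix]] : exists t : {perm T},
    [/\ (t * t = 1)%g, forall x, t (beta x) = beta (t x), half_sign t,
        t (s x) = x & forall z, s z = z -> t z = z].
  rewrite -[s]mulg1 -tK mulgA; apply: half_signM => //; apply: IHk.
    by move=> z; rewrite !permM sb tb.
  apply: leq_trans le_k; apply: proper_card; apply/properP; split.
    apply/subsetP => z; rewrite !inE permM; apply: contraNneq => sz.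
    by rewrite sz tfix.
  by exists x; rewrite !inE // permM tsx eqxx.
have [sxb|sxb] := eqVneq (s x) (beta x).
  exists (tperm x (beta x)); split=> //.
  - by rewrite tperm2.
  - by move=> z; rewrite -{1}(betaK x) tpermC -(inj_tperm _ _ _ (can_inj betaK)).
  - by rewrite sxb tpermR.
  - move=> z sz; rewrite tpermD //; apply: contraNneq sx => xz.
      by rewrite xz sz.
    have : s (beta x) = beta x by rewrite xz.
    by rewrite sb => /(can_inj betaK)->.
have s_moved z : s z = z -> [/\ x != z, s x != z, beta x != z & beta (s x) != z].
  move=> sz; split; apply: contraNneq sx => xz.
  - by rewrite xz sz.
  - by apply/eqP/(@perm_inj _ s); rewrite xz sz.
  - by apply/eqP/(can_inj betaK); rewrite -sb xz sz.
  - by apply/eqP/(@perm_inj _ s)/(can_inj betaK); rewrite -sb xz sz.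
exists (tperm x (s x) * tperm (beta x) (beta (s x)))%g.
have comm z : (tperm x (s x) * tperm (beta x) (beta (s x)))%g z =
    (tperm (beta x) (beta (s x)) * tperm x (s x))%g z.
  rewrite !permM.
  have xbs : x != beta (s x) by apply: contraNneq sxb => {2}->; rewrite betaK.
  case: (tpermP x (s x) z) => [->|->|/eqP zx /eqP zs].
  - by rewrite !(@tpermD _ (beta x) (beta (s x))) ?tpermL // 1?eq_sym ?beta_neq // eq_sym.
  - by rewrite !(@tpermD _ (beta x) (beta (s x))) ?tpermR // 1?eq_sym ?beta_neq // eq_sym.
  - by case: tpermP => *; rewrite tpermD // 1?eq_sym ?beta_neq // eq_sym ?beta_neq.
split.
- apply/permP => z; rewrite permM {1}comm !permM !tpermK perm1 //.
- by move=> z; rewrite [LHS]comm !permM !(inj_tperm _ _ _ (can_inj betaK)) !betaK.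
- exact: half_sign_swap.
- rewrite permM tpermR tpermD ?beta_neq // eq_sym.
  by apply: contraNneq sxb => {2}->; rewrite betaK.
- by move=> z /s_moved[*]; rewrite permM !tpermD.
Qed.

Lemma fsgn_half_sign (f : T -> T) (theta : T -> R) : injective f ->
  (forall x, f (beta x) = beta (f x)) ->
  (forall x, theta (beta x) = - theta x) ->
  \prod_(x in H) theta (f x) = fsgn R f * \prod_(x in H) theta x.
Proof.
move=> fI fb oddth; rewrite (fsgn_inj _ fI) -(perm_half_sign _ oddth).
  by apply: eq_bigr => x _; rewrite permE.
by move=> x; rewrite !permE.
Qed.

End PairSign.

(** * Signed edge colorings with dangling half-edges *)

Section SlotColorings.
Local Open Scope ring_scope.
Variable n : nat.
Local Notation V := 'I_n.
Local Notation slot := ('I_n * 'I_n)%type.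

(* Slots are half-edges of K_n plus the perfect matching v ~ rev_ord v: the
   slot (v, w) with v <> w is the half-edge at v of the edge vw of K_n, while
   (v, v) is the half-edge at v of the additional edge from v to rev_ord v. *)
Definition slot_inv (x : slot) : slot :=
  if x.1 == x.2 then (rev_ord x.1, rev_ord x.1) else (x.2, x.1).

Lemma slot_invK : involutive slot_inv.
Proof.
move=> [v w]; rewrite /slot_inv /=; case: (eqVneq v w) => [->|vw] /=.
  by rewrite eqxx rev_ordK.
by rewrite eq_sym (negPf vw).
Qed.

Lemma slot_inv_inj : injective slot_inv.
Proof. exact: can_inj slot_invK. Qed.

Hypothesis n_even : ~~ odd n.

Lemma rev_ord_neq (v : V) : rev_ord v != v.
Proof.
apply/eqP => /(congr1 val) /= h; have := ltn_ord v; move: n_even; lia.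
Qed.

Lemma slot_inv_neq x : slot_inv x != x.
Proof.
case: x => v w; rewrite /slot_inv /=; case: (eqVneq v w) => [->|vw] /=.
  by rewrite xpair_eqE (negPf (rev_ord_neq w)).
by rewrite xpair_eqE eq_sym (negPf vw).
Qed.

Variable R : comNzRingType.

(** The sum is the derivative of the determinant at the matrix [M] of [r] in the direction
    [M *m delta_mx a c], hence [\det M] times the trace of [delta_mx a c], which is 0 because
    [c != a]. *)
Lemma fsgn_deriv (r : V -> V) (a c : V) : c != a ->
  \sum_w (r w == a)%:R * fsgn R (fun j => if j == w then c else r j) = 0.
Proof.
move=> ca; pose M : 'M[R]_n := \matrix_(i, j) (r i == j)%:R.
transitivity (\tr ((M *m delta_mx a c) *m \adj M)); last first.
  rewrite -mulmxA mxtrace_mulC -mulmxA mul_adj_mx mxtrace_mulC.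
  by rewrite mul_scalar_mx mxtraceZ /mxtrace big1 ?mulr0 // => i _;
    rewrite mxE; case: eqP => [->|//]; rewrite eq_sym (negPf ca).
apply: eq_bigr => w _; rewrite fsgn_det mxE (expand_det_row _ w).
rewrite big_distrr /=; apply: eq_bigr => j _; rewrite !mxE eqxx mulrA.
congr (_ * _); last first.
  rewrite /cofactor; congr (_ * \det _); apply/matrixP => k l.
  by rewrite !mxE [lift w k == w]eq_sym (negPf (neq_lift _ _)).
rewrite (bigD1 a) //= !mxE eqxx /= big1 ?addr0 => [|k ka]; last first.
  by rewrite !mxE (negPf ka) mulr0.
by rewrite [c == j]eq_sym.
Qed.

Definition row_sign (g : slot -> V) : R := \prod_v fsgn R (fun w => g (v, w)).

Lemma eq_row_sign g h : g =1 h -> row_sign g = row_sign h.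
Proof. by move=> gh; apply: eq_bigr => v _; apply: eq_fsgn => w. Qed.

Definition upd (g : {ffun slot -> V}) (x : slot) (c : V) : {ffun slot -> V} :=
  [ffun y => if y == x then c else g y].

(** The product rule over the vertices. *)
Lemma row_sign_deriv (g : {ffun slot -> V}) (a c : V) : c != a ->
  \sum_x (g x == a)%:R * row_sign (upd g x c) = 0.
Proof.
move=> ca.
transitivity (\sum_v \sum_w (g (v, w) == a)%:R * row_sign (upd g (v, w) c)).
  by rewrite pair_bigA; apply: eq_bigr => -[].
rewrite big1 // => v _.
transitivity ((\sum_w (g (v, w) == a)%:R *
    fsgn R (fun j => if j == w then c else g (v, j))) *
    \prod_(u | u != v) fsgn R (fun w => g (u, w))); last first.
  by rewrite fsgn_deriv // mul0r.
rewrite big_distrl /=; apply: eq_bigr => w _; rewrite -mulrA; congr (_ * _).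
rewrite /row_sign (bigD1 v) //=; congr (_ * _).
  by apply: eq_fsgn => j; rewrite ffunE xpair_eqE eqxx.
apply: eq_bigr => u uv; apply: eq_fsgn => j.
by rewrite ffunE xpair_eqE (negPf uv).
Qed.

Definition bdry (N : {set V}) (x : slot) := (x.1 == x.2) && (x.1 \in N).

Definition compatible (N : {set V}) (b : {ffun V -> V}) (g : slot -> V) :=
  [forall x, g x == if bdry N x then b x.1 else g (slot_inv x)].

Lemma compatibleP (N : {set V}) (b : {ffun V -> V}) (g : slot -> V) :
  reflect (forall x, g x = if bdry N x then b x.1 else g (slot_inv x))
    (compatible N b g).
Proof. exact: 'forall_eqP. Qed.

(* The signed number of colorings of the edges of K_n and of the additional
   edges outside N, where the slots (v, v) with v in N are dangling
   half-edges with the prescribed color b v. *)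
Definition weight (N : {set V}) (b : {ffun V -> V}) : R :=
  \sum_(g : {ffun slot -> V} | compatible N b g) row_sign g.

Section Boundary.
Variable N : {set V}.
Hypothesis N_rev : forall v, (rev_ord v \in N) = (v \in N).

Lemma bdry_inv x : bdry N (slot_inv x) = bdry N x.
Proof.
case: x => v w; rewrite /bdry /slot_inv /=; case: (eqVneq v w) => [->|vw] /=.
  by rewrite eqxx N_rev.
by rewrite eq_sym (negPf vw).
Qed.

Lemma upd_same g x c : upd g x c x = c.
Proof. by rewrite ffunE eqxx. Qed.

Lemma upd_other g x c y : y != x -> upd g x c y = g y.
Proof. by move=> yx; rewrite ffunE (negPf yx). Qed.

(** The sum of [row_sign_deriv] over the compatible colorings, written in terms of the coloring [h]
    after the change from [a] to [c] at [x]: it is the coloring with the change undone that is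
    compatible. *)
Lemma sum_compatible_upd (b : {ffun V -> V}) (a c : V) : c != a ->
  \sum_(h : {ffun slot -> V}) row_sign h *
    \sum_x ((h x == c) && compatible N b (upd h x a))%:R = 0.
Proof.
move=> ca.
transitivity (\sum_(g : {ffun slot -> V} | compatible N b g)
    \sum_x (g x == a)%:R * row_sign (upd g x c)); last first.
  by rewrite big1 // => g _; apply: row_sign_deriv.
under eq_bigr do rewrite big_distrr /=.
rewrite exchange_big [RHS]exchange_big /=; apply: eq_bigr => x _.
rewrite (bigID (fun h : {ffun slot -> V} => (h x == c) && compatible N b (upd h x a))) /=.
rewrite [X in _ + X]big1 ?addr0; last by move=> h /negPf ->; rewrite mulr0.
rewrite [RHS](bigID (fun g : {ffun slot -> V} => g x == a)) /=.
rewrite [X in _ = _ + X]big1 ?addr0; last first.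
  by move=> g /andP[_ /negPf ->]; rewrite mul0r.
rewrite [RHS](reindex_onto (fun h => upd h x a) (fun g => upd g x c)) /=.
  have updK h : upd (upd h x a) x c = upd h x c.
    by apply/ffunP => y; rewrite !ffunE; case: eqP.
  apply: eq_big => [h|h /andP[/eqP hx K]].
    have -> : (upd (upd h x a) x c == h) = (h x == c).
      rewrite updK; apply/eqP/eqP => [<-|hx]; first exact: upd_same.
      by apply/ffunP => y; rewrite ffunE; case: eqP => [->|].
    by rewrite upd_same eqxx andbT andbC.
  rewrite hx K upd_same !eqxx mulr1 mul1r; apply: eq_row_sign => y.
  by rewrite updK ffunE; case: eqP => [->|].
move=> h /andP[_ /eqP hx]; apply/ffunP => y; rewrite !ffunE.
by case: eqP => [->|].
Qed.

Lemma compatible_upd_inv b a c (h : {ffun slot -> V}) x : ~~ bdry N x ->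
  h x = c -> compatible N b (upd h x a) ->
  (h (slot_inv x) == a) && compatible N b (upd h (slot_inv x) c).
Proof.
move=> xN hx /compatibleP K; have ix := slot_inv_neq x.
have hix : h (slot_inv x) = a.
  by have := K x; rewrite (negPf xN) upd_same upd_other.
rewrite hix eqxx; apply/compatibleP => y; rewrite ffunE.
case: (eqVneq y (slot_inv x)) => [->|yix].
  by rewrite bdry_inv (negPf xN) slot_invK upd_other // eq_sym.
have [->|yx] := eqVneq y x; first by rewrite (negPf xN) upd_same.
have := K y; rewrite upd_other // => ->; case: ifP => // _.
rewrite !upd_other ?(inj_eq slot_inv_inj) //.
by apply: contraNneq yix => <-; rewrite slot_invK.
Qed.

Definition updb (b : {ffun V -> V}) (v c : V) : {ffun V -> V} :=
  [ffun u => if u == v then c else b u].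

Lemma compatible_upd_bdry b a c (h : {ffun slot -> V}) v : v \in N ->
  (h (v, v) == c) && compatible N b (upd h (v, v) a) =
  (b v == a) && compatible N (updb b v c) h.
Proof.
move=> vN; have xN : bdry N (v, v) by rewrite /bdry eqxx.
have yN y : ~~ bdry N y -> slot_inv y != (v, v).
  by apply: contraNneq => yv; rewrite -bdry_inv yv.
apply/andP/andP => [[/eqP hx /compatibleP K]|[/eqP bv /compatibleP K]].
  split; first by have := K (v, v); rewrite xN upd_same => ->.
  apply/compatibleP => y; have [->|yv] := eqVneq y (v, v).
    by rewrite xN hx ffunE eqxx.
  have := K y; rewrite upd_other // => ->.
  case: ifPn => [yb|yb]; last by rewrite upd_other // yN.
  rewrite ffunE; case: eqP => // y1; case/eqP: yv; case/andP: yb.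
  by case: (y) y1 => y1 y2 /= -> /eqP ->.
split; first by have := K (v, v); rewrite xN ffunE eqxx => ->.
apply/compatibleP => y; have [->|yv] := eqVneq y (v, v).
  by rewrite xN upd_same bv.
rewrite upd_other // {1}K; case: ifPn => [yb|yb]; last by rewrite upd_other // yN.
rewrite ffunE; case: eqP => // y1; case/eqP: yv; case/andP: yb.
by case: (y) y1 => y1 y2 /= -> /eqP ->.
Qed.

(* Infinitesimal invariance of the weights under the rotation of the color
   space in the plane spanned by the colors a and c. *)
Lemma weight_rotation (b : {ffun V -> V}) (a c : V) : c != a ->
  \sum_(v in N) (b v == a)%:R * weight N (updb b v c) =
  \sum_(v in N) (b v == c)%:R * weight N (updb b v a).
Proof.
move=> ca; have ac : a != c by rewrite eq_sym.
pose S (a c : V) := \sum_(h : {ffun slot -> V}) row_sign h *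
  \sum_(x | bdry N x) ((h x == c) && compatible N b (upd h x a))%:R.
pose S' (a c : V) := \sum_(h : {ffun slot -> V}) row_sign h *
  \sum_(x | ~~ bdry N x) ((h x == c) && compatible N b (upd h x a))%:R.
have SS' a' c' : c' != a' -> S a' c' + S' a' c' = 0.
  move=> /(sum_compatible_upd b); rewrite -big_split /= => E; rewrite -[RHS]E.
  by apply: eq_bigr => h _; rewrite -mulrDr [in RHS](bigID (bdry N)).
(* An interior edge with halves colored [a] and [c] is counted in both sums, seen from its two ends,
   so the interior contributions are symmetric and only the boundary ones remain. *)
have S'sym : S' a c = S' c a.
  apply: eq_bigr => h _; congr (_ * _).
  rewrite (reindex_inj slot_inv_inj); apply: eq_big => x; rewrite bdry_inv //.
  move=> xN; congr (_%:R); congr nat_of_bool.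
  have ixN : ~~ bdry N (slot_inv x) by rewrite bdry_inv.
  apply/andP/andP => -[/eqP e K].
    by have /andP := compatible_upd_inv ixN e K; rewrite slot_invK.
  exact/andP/(compatible_upd_inv xN e K).
have SE a' c' : S a' c' = \sum_(v in N) (b v == a')%:R * weight N (updb b v c').
  transitivity (\sum_(h : {ffun slot -> V}) \sum_(v in N) row_sign h *
      ((b v == a') && compatible N (updb b v c') h)%:R).
    apply: eq_bigr => h _; rewrite big_distrr /=.
    rewrite (reindex_onto (fun v => (v, v)) fst) /=.
      apply: eq_big => v; first by rewrite /bdry /= !eqxx andbT.
      by rewrite /bdry /= eqxx andbT => vN; rewrite compatible_upd_bdry.
    by case=> v w /andP[/eqP /= ->].
  rewrite exchange_big; apply: eq_bigr => v _ /=.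
  rewrite /weight big_distrr [RHS]big_mkcond; apply: eq_bigr => h _ /=.
  by case: eqP; case: ifP; rewrite ?mul1r ?mulr1 ?mul0r ?mulr0.
rewrite -!SE; apply: (addIr (S' a c)); rewrite SS' // {}S'sym SS' //.
Qed.

(** Relabeling by [s] preserves the additional edges outside [N], whose ends are fixed. Each of the
    [n] vertex signs changes by the sign of [s], and [n] is even. *)
Lemma weight_perm (s : {perm V}) (b b' : {ffun V -> V}) :
  (forall v, v \notin N -> s v = v) -> (forall v, b' v = b (s v)) ->
  weight N b' = weight N b.
Proof.
move=> sN bs.
have sN' v : (s v \in N) = (v \in N).
  have [vN|vN] := boolP (v \in N); last by rewrite sN // (negPf vN).
  by apply: contraTT vN => svN; rewrite -(perm_inj (sN _ svN)).
pose act (t : {perm V}) (g : {ffun slot -> V}) : {ffun slot -> V} :=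
  [ffun x => g (t x.1, t x.2)].
have actK g : act s^-1%g (act s g) = g.
  by apply/ffunP => -[v w]; rewrite !ffunE /= !permKV.
have actKV g : act s (act s^-1%g g) = g.
  by apply/ffunP => -[v w]; rewrite !ffunE /= !permK.
rewrite /weight (reindex_onto (act s) (act s^-1%g)) => [|g _] /=; last exact: actKV.
have bs1 x : bdry N (s x.1, s x.2) = bdry N x.
  by rewrite /bdry /= (inj_eq perm_inj) sN'.
have invs x : ~~ bdry N x ->
    slot_inv (s x.1, s x.2) = (s (slot_inv x).1, s (slot_inv x).2).
  case: x => v w; rewrite /bdry /slot_inv /= (inj_eq perm_inj).
  by case: eqP => //= _ vN; rewrite !sN // N_rev.
apply: eq_big => g.
  rewrite actK eqxx andbT; apply/compatibleP/compatibleP => K x.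
    have := K ((s^-1)%g x.1, (s^-1)%g x.2).
    rewrite !ffunE /= -bs1 /= !permKV -surjective_pairing bs permKV => ->.
    case: ifPn => // xN; rewrite -invs /= ?permKV -?surjective_pairing //.
    by rewrite -bs1 /= !permKV -surjective_pairing.
  rewrite !ffunE K bs1 bs; case: ifPn => // xN.
  by rewrite invs.
move=> _; rewrite /row_sign.
transitivity (\prod_v (fsgn R (fun w => g (s v, w)) * fsgn R s)).
  apply: eq_bigr => v _; rewrite -fsgn_comp; apply: eq_fsgn => w.
  by rewrite ffunE.
rewrite big_split /= prodr_const card_ord fsgn_perm -signr_odd.
rewrite exprAC -signr_odd.
have -> : odd n = false by apply/negbTE.
rewrite expr1n mulr1.
by rewrite [RHS](reindex_inj (@perm_inj _ s)).
Qed.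

(** Gluing the dangling half-edges at [i] and [rev_ord i] means summing over their common color [c].
    The case [c = a] is the monochromatic boundary, and [mid] reduces each of the [n - 1] other
    colors to it. *)
Lemma weight_setD_pair (a i : V) : i \in N ->
  (#|N|.-1)%:R * weight (N :\: [set i; rev_ord i]) [ffun=> a] =
  (#|N|.-1 + n.-1)%:R * weight N [ffun=> a].
Proof.
move=> iN; pose j := rev_ord i.
have jN : j \in N by rewrite N_rev.
have ji : j != i := rev_ord_neq i.
pose b c : {ffun V -> V} := [ffun u => if (u == i) || (u == j) then c else a].
have mid c : c != a -> (#|N|.-1)%:R * weight N (b c) = weight N [ffun=> a].
  move=> ca; have ac : (a == c) = false by rewrite eq_sym (negPf ca).
  (* The rotated boundary has color [c] at [i] and [a] elsewhere. One side turns [i] back to [a];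
     the other turns a second vertex to [c], and by vertex symmetry its [#|N| - 1] terms are
     equal. *)
  have := weight_rotation (updb [ffun=> a] i c) ca.
  rewrite [RHS](bigD1 i) //= {1}ffunE eqxx eqxx mul1r [X in _ + X]big1 ?addr0.
    have -> : updb (updb [ffun=> a] i c) i a = [ffun=> a].
      by apply/ffunP => u; rewrite !ffunE; case: eqP.
    move=> <-; rewrite (bigD1 i) //= {1}ffunE eqxx (negPf ca) mul0r add0r.
    rewrite (eq_bigr (fun=> weight N (b c))) => [|v /andP[vN vi]].
      rewrite (eq_bigl (mem (N :\ i))) => [|v]; last by rewrite !inE andbC.
      by rewrite sumr_const [#|N|](cardsD1 i) iN mulr_natl.
    rewrite !ffunE (negPf vi) eqxx mul1r; apply: (weight_perm (s := tperm v j)).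
      by move=> u uN; rewrite tpermD //; apply: contraNneq uN => <-.
    move=> u; rewrite !ffunE; case: tpermP => [->|->|/eqP uv /eqP uj].
    - by rewrite !eqxx orbT.
    - rewrite (negPf ji) (negPf vi) /=.
      by case: (eqVneq j v).
    - by rewrite (negPf uv) (negPf uj) orbF.
  move=> v /andP[vN vi]; rewrite ffunE (negPf vi) ffunE ac mul0r //.
have -> : weight (N :\: [set i; j]) [ffun=> a] = \sum_c weight N (b c).
  rewrite /weight (partition_big (fun g : {ffun slot -> V} => g (i, i)) xpredT) //=.
  apply: eq_bigr => c _; apply: eq_bigl => g.
  have bdryD x : bdry (N :\: [set i; j]) x =
      bdry N x && ~~ ((x.1 == i) || (x.1 == j)).
    by rewrite /bdry !inE; case: (_ == _); rewrite //= andbC.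
  have ii : slot_inv (i, i) = (j, j) by rewrite /slot_inv /= eqxx.
  apply/andP/compatibleP => [[/compatibleP K /eqP gi] x|K].
    have gj : g (j, j) = c.
      have := K (j, j); rewrite bdryD /= eqxx orbT andbF => ->.
      by rewrite -ii slot_invK.
    rewrite K bdryD !ffunE; case: (boolP (bdry N x)) => [xN|//] /=.
    case: x xN => v w /andP[/= /eqP <- vN].
    case: (eqVneq v i) => [->|vi] /=; first by rewrite ii gj.
    by case: (eqVneq v j) => [->|vj] //=; rewrite -ii slot_invK.
  have gi : g (i, i) = c by rewrite K /bdry /= eqxx iN ffunE eqxx.
  have gj : g (j, j) = c by rewrite K /bdry /= eqxx jN ffunE eqxx orbT.
  split; last by rewrite gi.
  apply/compatibleP => x; rewrite bdryD {1}K !ffunE.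
  case: (boolP (bdry N x)) => [xN|//] /=.
  case: x xN => v w /andP[/= /eqP <- vN].
  case: (eqVneq v i) => [->|vi] /=; first by rewrite ii gj.
  by case: (eqVneq v j) => [->|vj] //=; rewrite -ii slot_invK.
rewrite (bigD1 a) //= mulrDr natrD mulrDl; congr +%R.
  by congr (_ * weight _ _); apply/ffunP => u; rewrite !ffunE; case: ifP.
rewrite big_distrr /=; rewrite (eq_bigr _ mid) sumr_const mulr_natl; congr (_ *+ _).
by rewrite cardC1 card_ord.
Qed.

End Boundary.
End SlotColorings.

(** * Products of sums over a transversal of an involution *)

Section Equivariant.
Local Open Scope ring_scope.
Variables (R : comNzRingType) (T S : finType) (beta : T -> T) (H : {set T}).
Hypothesis betaK : involutive beta.
Hypothesis betaH : forall x, (beta x \in H) = (x \notin H).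

(** An equivariant function is determined by its values on the transversal [H], and these are
    arbitrary. *)
Lemma prod_sum_equivariant (iota : S -> S) (F : T -> S -> R) :
  involutive iota ->
  \prod_(x in H) \sum_s F x s =
  \sum_(Q : {ffun T -> S} | [forall x, Q (beta x) == iota (Q x)])
    \prod_(x in H) F x (Q x).
Proof.
move=> iotaK; case: (pickP (@predT S)) => [s0 _|S0]; last first.
  case: (pickP (mem H)) => [x xH|H0].
    rewrite (bigD1 x) //= [X in X * _]big1 ?mul0r => [|s]; last first.
      by have := S0 s.
    by rewrite big1 // => Q; have := S0 (Q x).
  have T0 : @predT T =1 pred0.
    move=> x; have := betaH x; have := H0 x; have := H0 (beta x).
    by rewrite /= => -> ->.
  rewrite big_pred0 // (big_pred1 (ffun0 (eq_card0 T0))) ?big_pred0 // => Q /=.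
  rewrite (_ : Q == _ = true); last by apply/eqP/ffunP => x; have := T0 x.
  by apply/forallP => x; have := T0 x.
rewrite (big_distr_big s0) /=.
pose h (Q : {ffun T -> S}) := [ffun x => if x \in H then Q x else s0].
pose k (f : {ffun T -> S}) :=
  [ffun x => if x \in H then f x else iota (f (beta x))].
rewrite (reindex_onto h k) /= => [|f /pffun_onP[supf _]]; last first.
  apply/ffunP => x; rewrite !ffunE; case: ifPn => [->//|xH].
  by apply/esym/eqP; apply: contraNT xH => fx; apply: (subsetP supf).
apply: eq_big => [Q|Q _]; last by apply: eq_bigr => x xH; rewrite ffunE xH.
have -> : (h Q \in pffun_on s0 (mem H) predT) = true.
  apply/pffun_onP; split => //; apply/subsetP => x; rewrite inE ffunE.
  by case: ifP => //; rewrite eqxx.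
apply/eqP/'forall_eqP => [<- x|eqQ].
  by rewrite !ffunE !betaK !betaH; case: (x \in H); rewrite ?iotaK.
by apply/ffunP => x; rewrite !ffunE betaH; case: (x \in H); rewrite //= eqQ iotaK.
Qed.

End Equivariant.

Section EquivariantPair.
Local Open Scope ring_scope.
Variables (R : comNzRingType) (T S : finType) (beta : T -> T) (H : {set T}).
Hypothesis betaK : involutive beta.
Hypothesis betaH : forall x, (beta x \in H) = (x \notin H).

(** A function into [S * S] equivariant for the swap has the form [x |-> (f x, f (beta x))] for a
    unique [f]. *)
Lemma prod_sum_pair (G : T -> S -> S -> R) :
  \prod_(x in H) \sum_s \sum_t G x s t =
  \sum_(f : {ffun T -> S}) \prod_(x in H) G x (f x) (f (beta x)).
Proof.
pose swap (u : S * S) := (u.2, u.1).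
have swapK : involutive swap by case.
transitivity (\prod_(x in H) \sum_(u : S * S) G x u.1 u.2).
  by apply: eq_bigr => x _; rewrite pair_bigA.
rewrite (prod_sum_equivariant betaK betaH (fun x (u : S * S) => G x u.1 u.2) swapK) /=.
pose h (Q : {ffun T -> S * S}) : {ffun T -> S} := [ffun x => (Q x).1].
pose k (f : {ffun T -> S}) : {ffun T -> S * S} := [ffun x => (f x, f (beta x))].
rewrite [RHS](reindex_onto h k) /= => [|f _]; last first.
  by apply/ffunP => x; rewrite !ffunE.
apply: eq_big => [Q|Q /'forall_eqP eqQ].
  apply/'forall_eqP/eqP => [eqQ|<- x]; last by rewrite !ffunE betaK.
  by apply/ffunP => x; rewrite !ffunE eqQ; case: (Q x).
by apply: eq_bigr => x _; rewrite !ffunE eqQ.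
Qed.

End EquivariantPair.

(** * Pfaffians of skew-symmetric matrices *)

Section PfaffianSum.
Local Open Scope ring_scope.
Variable n : nat.
Hypothesis n_even : ~~ odd n.

Lemma half_double : n = (n./2 + n./2)%N.
Proof. by rewrite addnn even_halfK. Qed.

Definition half_set : {set 'I_n} := [set i : 'I_n | i < n./2]%N.

Lemma half_set_rev (v : 'I_n) : (rev_ord v \in half_set) = (v \notin half_set).
Proof. rewrite !inE /=; move: (n./2) (ltn_ord v) half_double; lia. Qed.

Lemma card_half_set : #|half_set| = n./2.
Proof.
have : (#|half_set| + #|~: half_set| = n)%N by rewrite cardsC card_ord.
have -> : ~: half_set = [set rev_ord v | v in half_set].
  apply/setP => v; rewrite inE -half_set_rev.
  by rewrite -{2}(rev_ordK v) mem_imset //; exact: rev_ord_inj.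
by rewrite card_imset; [move: #|half_set| (n./2) half_double; lia | exact: rev_ord_inj].
Qed.

Section Ring.
Variable R : comNzRingType.
Implicit Types X A : 'M[R]_n.

(* A nonzero multiple of the Pfaffian in characteristic 0 or greater than n/2. *)
Definition pfaffian_sum X : R :=
  \sum_(q : 'S_n) (-1) ^+ q * \prod_(i in half_set) X (q i) (q (rev_ord i)).

Lemma pfaffian_sum_ffun X : pfaffian_sum X =
  \sum_(f : {ffun 'I_n -> 'I_n})
    fsgn R f * \prod_(i in half_set) X (f i) (f (rev_ord i)).
Proof.
rewrite /fsgn; under [RHS]eq_bigr do rewrite big_distrl big_mkcond /=.
rewrite exchange_big /=; apply: eq_bigr => q _; rewrite -big_mkcond.
rewrite (big_pred1 [ffun i => q i]) => [|f] /=.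
  by congr (_ * _); apply: eq_bigr => i _; rewrite !ffunE.
apply/'forall_eqP/eqP => [qf|-> i]; last by rewrite ffunE.
by apply/ffunP => i; rewrite ffunE qf.
Qed.

(** As in the multiplicativity of determinants, expanding the entries sums over all maps [f]; for
    fixed [f] the sum over [q] is the determinant of the matrix of [f] times [A^T]. *)
Lemma pfaffian_sum_congruence A X :
  pfaffian_sum (A *m X *m A^T) = \det A * pfaffian_sum X.
Proof.
rewrite [in RHS]pfaffian_sum_ffun /pfaffian_sum.
transitivity (\sum_(q : 'S_n) \sum_(f : {ffun 'I_n -> 'I_n}) (-1) ^+ q *
   ((\prod_(i in half_set) X (f i) (f (rev_ord i))) * \prod_i A (q i) (f i))).
  apply: eq_bigr => q _; rewrite -big_distrr /=; congr (_ * _).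
  transitivity (\prod_(i in half_set) \sum_a \sum_b
      (A (q i) a * X a b * A (q (rev_ord i)) b)).
    apply: eq_bigr => i _; rewrite mxE exchange_big /=; apply: eq_bigr => b _.
    by rewrite !mxE big_distrl.
  rewrite (prod_sum_pair (@rev_ordK n) half_set_rev
    (fun i a b => A (q i) a * X a b * A (q (rev_ord i)) b)).
  apply: eq_bigr => f _; rewrite [X in _ = _ * X](bigID (mem half_set)) /=.
  rewrite [X in _ * (_ * X)](reindex_inj rev_ord_inj) /=.
  rewrite [X in _ * (_ * X)](eq_bigl (mem half_set)) => [|i]; last first.
    by rewrite -half_set_rev rev_ordK.
  rewrite -!big_split /=; apply: eq_bigr => i _; ring.
rewrite exchange_big big_distrr /=; apply: eq_bigr => f _.
rewrite mulrA [in RHS]mulrC.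
transitivity ((\prod_(i in half_set) X (f i) (f (rev_ord i))) *
   \det (\matrix_(i, j) (f i == j)%:R *m A^T)); last first.
  by rewrite det_mulmx det_tr -fsgn_det [fsgn R f * _]mulrC.
rewrite [in RHS]/determinant big_distrr /=; apply: eq_bigr => q _.
rewrite mulrCA; congr (_ * (_ * _)); apply: eq_bigr => i _; rewrite mxE.
rewrite (bigD1 (f i)) //= big1 ?addr0 ?mxE ?eqxx ?mul1r // => j ji.
by rewrite !mxE eq_sym (negPf ji) mul0r.
Qed.

End Ring.

Definition rev_perm : 'S_n := perm (@rev_ord_inj n).

Definition rev_centralizer : {set 'S_n} :=
  [set q : 'S_n | [forall v, q (rev_ord v) == rev_ord (q v)]].

(** Lagrange's theorem. It is what makes the multiplicity of the Pfaffian invertible modulo [p]. *)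
Lemma dvd_card_rev_centralizer : (#|rev_centralizer| %| n`!)%N.
Proof.
rewrite -card_Sn -cardsT (_ : rev_centralizer = 'C[rev_perm]%g).
  exact/cardSg/subsetT.
apply/setP => q; rewrite inE; apply/'forall_eqP/cent1P => [qr|qr v].
  by apply/permP => v; rewrite !permM !permE qr.
by have := congr1 (fun s : 'S_n => s v) qr; rewrite !permM !permE.
Qed.

Section Field.
Variable F : fieldType.
Hypothesis two_neq0 : 2%:R != 0 :> F.
Implicit Types X A : 'M[F]_n.

(** Row [i] of the identity is replaced by a kernel vector [u] with nonzero coordinate [i]. The
    resulting [A] is invertible, and row and column [i] of [A *m X *m A^T] are zero, which kills
    every term. *)
Lemma pfaffian_sum_singular X : X^T = - X -> X \notin unitmx ->
  pfaffian_sum X = 0.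
Proof.
move=> Xt; rewrite -row_free_unit -kermx_eq0 => /rowV0Pn[u /sub_kermxP uX u0].
have [i ui] : exists i, u 0 i != 0.
  apply/existsP; rewrite -negb_forall; apply: contra u0 => /'forall_eqP u0.
  by apply/eqP/rowP => i; rewrite u0 mxE.
pose A : 'M[F]_n := \matrix_(k, l) if k == i then u 0 l else (k == l)%:R.
have detA : \det A = u 0 i.
  rewrite (expand_det_col _ i) (bigD1 i) //= big1 ?addr0 => [|k ki]; last first.
    by rewrite mxE (negPf ki) mul0r.
  rewrite mxE eqxx /cofactor (_ : row' _ _ = 1%:M) ?det1; last first.
    apply/matrixP => k l; rewrite !mxE eq_sym (negPf (neq_lift _ _)).
    by rewrite (inj_eq lift_inj).
  by rewrite -signr_odd oddD addbb expr0 !mulr1.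
have rowA k : (A *m X *m A^T) i k = 0.
  suff -> : (A *m X *m A^T) i k = (row i A *m X *m A^T) 0 k.
    rewrite (_ : row i A = u) ?uX ?mul0mx ?mxE //.
    by apply/rowP => l; rewrite !mxE eqxx.
  by rewrite -!row_mul [RHS]mxE.
have colA k : (A *m X *m A^T) k i = 0.
  suff : (A *m X *m A^T)^T i k = 0 by rewrite mxE.
  by rewrite !trmx_mul trmxK Xt mulNmx mulmxN mulmxA mxE rowA oppr0.
apply: (mulfI ui); rewrite mulr0 -detA -pfaffian_sum_congruence.
rewrite /pfaffian_sum big1 // => q _; set j := (q^-1)%g i.
have qj : q j = i by rewrite permKV.
have [jH|jH] := boolP (j \in half_set).
  by rewrite (bigD1 j) //= qj rowA mul0r mulr0.
rewrite (bigD1 (rev_ord j)) ?half_set_rev //= rev_ordK qj colA.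
by rewrite mul0r mulr0.
Qed.

Let form X (u w : 'rV[F]_n) : F := (u *m X *m w^T) 0 0.

Let formNC X u w : X^T = - X -> form X u w = - form X w u.
Proof.
move=> Xt; rewrite /form -[in LHS](trmxK (u *m X *m w^T)) mxE.
by rewrite !trmx_mul trmxK Xt mulNmx mulmxN mxE mulmxA.
Qed.

Let form_alt X u : X^T = - X -> form X u u = 0.
Proof.
move=> Xt; apply/eqP; have /eqP := formNC u u Xt.
by rewrite -addr_eq0 -mulr2n -mulr_natl mulf_eq0 (negPf two_neq0).
Qed.

Let gramE X A i j : (A *m X *m A^T) i j = form X (row i A) (row j A).
Proof.
rewrite /form -!row_mul !mxE; apply: eq_bigr => k _; congr (_ * _).
by rewrite !mxE.
Qed.

Definition paired r : {set 'I_n} := [set i : 'I_n | (i < r) || (rev_ord i < r)]%N.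

(** For [r <= n./2], the Gram matrix of a partial symplectic basis: the vectors [i] and [rev_ord i]
    with [i < r] form hyperbolic pairs, the other vectors are 0. *)
Definition symplectic_unit r : 'M[F]_n :=
  \matrix_(i, j) if (j == rev_ord i) && (i \in paired r)
                 then (-1) ^+ (i \notin half_set) else 0.

Lemma symplectic_unit_sqr r : symplectic_unit r *m symplectic_unit r =
  \matrix_(i, j) - ((i == j) && (i \in paired r))%:R.
Proof.
apply/matrixP => i j; rewrite !mxE (bigD1 (rev_ord i)) //= big1 ?addr0.
  rewrite !mxE eqxx rev_ordK half_set_rev negbK eq_sym /=.
  have -> : (rev_ord i \in paired r) = (i \in paired r).
    by rewrite !inE rev_ordK orbC.
  case: (i \in _); last by rewrite !andbF mul0r oppr0.
  by rewrite !andbT; case: eqP; case: (i \in half_set);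
    rewrite ?mulr0 ?oppr0 ?mulr1 ?mul1r.
by move=> k ki; rewrite !mxE (negPf ki) mul0r.
Qed.

(** The symplectic Gram-Schmidt process; the rows of [A] that are not yet constructed are kept
    zero. *)
Lemma symplectic_basis X r : X^T = - X -> X \in unitmx -> (r <= n./2)%N ->
  exists A, [/\ A *m X *m A^T = symplectic_unit r &
    forall i, i \notin paired r -> row i A = 0].
Proof.
move=> Xt Xu; elim: r => [|r IHr] le_r.
  exists 0; split=> [|i _]; last by rewrite linear0.
  by rewrite !mul0mx; apply/matrixP => i j; rewrite !mxE inE !ltn0 andbF.
have [A [gramA zeroA]] := IHr (ltnW le_r).
have lt_rn : (r < n)%N by lia.
pose i0 := Ordinal lt_rn.
pose j0 := rev_ord i0.
have pairedS i : (i \in paired r.+1) = [|| i == i0, i == j0 | i \in paired r].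
  have -> : (i == j0) = (rev_ord i == i0) by rewrite -(inj_eq rev_ord_inj) rev_ordK.
  rewrite !inE !ltnS [(i <= r)%N]leq_eqVlt [(rev_ord i <= r)%N]leq_eqVlt.
  by rewrite -!val_eqE /=; case: (val i == r); rewrite //= orbCA.
have i0N : i0 \notin paired r.
  by rewrite inE /=; move: (n./2) half_double le_r; lia.
have i0H : i0 \in half_set by rewrite inE.
have j0i0 : j0 != i0 by rewrite rev_ord_neq.
(* [A] is singular, its row [i0] being still zero, so some nonzero [x] is orthogonal to all rows of
   [A]. *)
have [x [xX x0]] : exists x : 'rV_n, x *m (X *m A^T) = 0 /\ x != 0.
  have /rowV0Pn[x /sub_kermxP xK x0] : kermx (X *m A^T) != 0.
    rewrite kermx_eq0 row_free_unit unitmx_mul negb_and unitmx_tr; apply/orP; right.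
    rewrite unitmxE (expand_det_row _ i0) big1 ?unitr0 // => j _.
    have := congr1 (fun M : 'rV_n => M 0 j) (zeroA _ i0N).
    by rewrite !mxE => ->; rewrite mul0r.
  by exists x.
have [k xk] : exists k, (x *m X) 0 k != 0.
  apply/existsP; rewrite -negb_forall; apply: contra x0 => /'forall_eqP xX0.
  have xX0' : x *m X = 0 by apply/rowP => k; rewrite xX0 mxE.
  by rewrite -(mulmxK Xu x) xX0' mul0mx.
pose y0 : 'rV[F]_n := ((x *m X) 0 k)^-1 *: delta_mx 0 k.
pose J := symplectic_unit r.
(* [y0] pairs to 1 with [x]. The correction does not change this and makes [y] orthogonal to the
   rows of [A], because [J *m J] is minus the projection on the paired coordinates. *)
pose y := y0 + y0 *m X *m A^T *m J *m A.
have xA j : form X x (row j A) = 0.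
  by rewrite /form tr_row colE mulmxA -(mulmxA x) xX mul0mx mxE.
have xy0 : form X x y0 = 1.
  rewrite /form linearZ /= -scalemxAr [LHS]mxE trmx_delta.
  by rewrite -colE [X in _ * X]mxE mulVf.
have xy : form X x y = 1.
  rewrite /form linearD /= mulmxDr mxE -/(form X x y0) xy0 !trmx_mul.
  by rewrite !mulmxA -(mulmxA x) xX !mul0mx mxE addr0.
have yA j : form X y (row j A) = 0.
  suff yXA : y *m X *m A^T = 0.
    by rewrite /form tr_row colE mulmxA yXA mul0mx mxE.
  have -> : y *m X *m A^T = y0 *m X *m A^T + y0 *m X *m A^T *m (J *m J).
    rewrite /y !mulmxDl; congr (_ + _).
    by rewrite -[X in _ *m (_ *m X)]gramA !mulmxA.
  rewrite symplectic_unit_sqr; apply/rowP => l.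
  rewrite mxE [X in _ + X]mxE (bigD1 l) //= [X in _ + (_ + X)]big1 ?addr0.
    rewrite [X in _ + _ * X]mxE [RHS]mxE eqxx.
    have [lN|/zeroA lA] := boolP (l \in paired r); first by rewrite mulrN1 subrr.
    rewrite oppr0 mulr0 addr0 mxE big1 // => k' _.
    by have := congr1 (fun M : 'rV_n => M 0 k') lA; rewrite !mxE => ->; rewrite mulr0.
  by move=> k' kl; rewrite [X in _ * X]mxE (negPf kl) oppr0 mulr0.
pose A' : 'M[F]_n := \matrix_i (if i == i0 then x else if i == j0 then y else row i A).
have rowA' i : row i A' = if i == i0 then x else if i == j0 then y else row i A.
  by rewrite rowK.
exists A'; split; last first.
  move=> i; rewrite pairedS !negb_or => /and3P[/negPf ii0 /negPf ij0 iN].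
  by rewrite rowA' ii0 ij0 zeroA.
apply/matrixP => i j; rewrite gramE !rowA' mxE pairedS.
case: (eqVneq i i0) => [->|ii0] /=.
  case: (eqVneq j i0) => [->|ji0]; first by rewrite form_alt // eq_sym (negPf j0i0).
  rewrite -/j0; case: (eqVneq j j0) => [_|jj0] /=; last exact: xA.
  by rewrite xy i0H.
case: (eqVneq i j0) => [->|ij0] /=.
  rewrite rev_ordK; case: (eqVneq j i0) => [_|ji0] /=.
    by rewrite formNC // xy half_set_rev i0H.
  case: (eqVneq j j0) => [_|jj0] /=; [exact: form_alt | exact: yA].
have ri l : (l == rev_ord i) = (rev_ord l == i).
  by rewrite -[in RHS](inj_eq rev_ord_inj) rev_ordK.
case: (eqVneq j i0) => [->|ji0] /=.
  by rewrite formNC // xA oppr0 ri eq_sym (negPf ij0).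
case: (eqVneq j j0) => [jj0|jj0] /=.
  by rewrite formNC // yA oppr0 ri jj0 rev_ordK eq_sym (negPf ii0).
by rewrite -gramE gramA mxE.
Qed.

(** Only the [q] commuting with [rev_ord] give a nonzero term, and that term is 1: by
    [perm_half_sign] the product of the entries is again the sign of [q]. *)
Lemma pfaffian_sum_symplectic : pfaffian_sum (symplectic_unit n./2) =
  #|rev_centralizer|%:R.
Proof.
have paired_half i : i \in paired n./2.
  by have := half_set_rev i; rewrite !inE => ->; case: (i < _)%N.
rewrite /pfaffian_sum (bigID (mem rev_centralizer)) /= [X in _ + X]big1 ?addr0.
  rewrite -sumr_const; apply: eq_bigr => q; rewrite inE => /'forall_eqP qr.
  transitivity ((-1) ^+ q * \prod_(i in half_set)
      (-1) ^+ (q i \notin half_set) : F).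
    congr (_ * _); apply: eq_bigr => i _.
    by rewrite mxE qr eqxx paired_half.
  have revK : involutive (@rev_ord n) := @rev_ordK n.
  rewrite (perm_half_sign revK half_set_rev
    (theta := fun v => (-1) ^+ (v \notin half_set)) qr) => [|v].
    rewrite mulrA -expr2 sqrr_sign mul1r big1 // => i iH.
    by rewrite iH expr0.
  by rewrite half_set_rev; case: (v \in _); rewrite ?opprK.
move=> q qN; have [i iH qi] : exists2 i, i \in half_set & q (rev_ord i) != rev_ord (q i).
  apply/exists_inP; apply: contraR qN; rewrite negb_exists_in => /forall_inP qr.
  rewrite inE; apply/'forall_eqP => v; have [vH|vH] := boolP (v \in half_set).
    by apply/eqP; rewrite -[_ == _]negbK qr.
  have := qr (rev_ord v); rewrite half_set_rev vH => /(_ isT).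
  by rewrite negbK rev_ordK => /eqP ->; rewrite rev_ordK.
by rewrite (bigD1 i) //= mxE (negPf qi) mul0r mulr0.
Qed.

Lemma pfaffian_sum_neq0 X : X^T = - X -> #|rev_centralizer|%:R != 0 :> F ->
  (pfaffian_sum X != 0) = (X \in unitmx).
Proof.
move=> Xt Z0; apply/idP/idP => [|Xu].
  by apply: contraNT => /(pfaffian_sum_singular Xt) ->.
have [A [gramA _]] := symplectic_basis Xt Xu (leqnn _).
apply: contra_neq Z0 => X0.
by rewrite -pfaffian_sum_symplectic -gramA pfaffian_sum_congruence X0 mulr0.
Qed.

End Field.
End PfaffianSum.

(** * Conjugacy of fixed-point-free involutions *)

Section FixedPointFree.
Variable n : nat.
Hypothesis n_even : ~~ odd n.

(** The smaller elements of the pairs of [mu] are listed in the first half, their partners at the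
    mirrored positions. *)
Lemma fixed_point_free_conj (mu : 'I_n -> 'I_n) :
  involutive mu -> (forall v, mu v != v) ->
  exists q : 'S_n, (forall i, q (rev_ord i) = mu (q i)) /\
    (forall i, i \in half_set n -> q i < mu (q i)).
Proof.
move=> muK mu_neq; pose M := [set v : 'I_n | v < mu v].
have muM v : (mu v \in M) = (v \notin M).
  by rewrite !inE muK -leqNgt [RHS]leq_eqVlt val_eqE (negPf (mu_neq v)).
have cardM : #|M| = n./2.
  have : #|M| + #|~: M| = n by rewrite cardsC card_ord.
  have -> : ~: M = [set mu v | v in M].
    apply/setP => v; rewrite inE -muM.
    by rewrite -{2}(muK v) mem_imset //; exact: inv_inj.
  rewrite card_imset; last exact: inv_inj.
  by move: #|M| (n./2) (half_double n_even); lia.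
pose f i := if i \in half_set n then nth i (enum M) i
            else mu (nth i (enum M) (rev_ord i)).
have fE (i j : 'I_n) : i \in half_set n -> nth j (enum M) i \in M.
  by rewrite inE -cardM cardE => lt_i; rewrite -mem_enum mem_nth.
have fM i : (f i \in M) = (i \in half_set n).
  rewrite /f; case: ifPn => iH; first exact: fE.
  by rewrite muM fE // half_set_rev.
have nthI (i j k l : 'I_n) : i \in half_set n -> j \in half_set n ->
    nth k (enum M) i = nth l (enum M) j -> i = j.
  rewrite !inE -cardM cardE => lt_i lt_j.
  rewrite (set_nth_default l k lt_i) => /eqP.
  by rewrite nth_uniq ?enum_uniq // => /eqP/val_inj.
have fI : injective f.
  move=> i j fij; have := fM j; rewrite -fij fM.
  have [iH jH|iH jH] := boolP (i \in half_set n).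
    by move: fij; rewrite /f iH -jH; apply: nthI.
  move: fij; rewrite /f (negPf iH) -jH => /(inv_inj muK)/nthI/rev_ord_inj -> //.
    by rewrite half_set_rev.
  by rewrite half_set_rev // -jH.
exists (perm fI); split=> [i|i iH]; last by rewrite permE; have := fM i; rewrite iH inE.
rewrite !permE /f half_set_rev // if_neg; case: ifPn => iH; last first.
  by rewrite muK; apply: set_nth_default; move: iH; rewrite -half_set_rev // inE -cardM cardE.
by rewrite rev_ordK; congr mu; apply: set_nth_default; move: iH; rewrite inE -cardM cardE.
Qed.

End FixedPointFree.

(** * Power sums modulo [p], and the comparison of [W'] with [W] *)

Section PrimeField.
Local Open Scope ring_scope.
Variable p : nat.
Hypothesis p_prime : prime p.
Hypothesis p_odd : odd p.
Local Notation n := p.-1.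
Local Notation F := 'F_p.

Lemma pred_prime_even : ~~ odd n.
Proof. by have := prime_gt0 p_prime; case: (p) p_odd => //= k ->. Qed.

Lemma pred_prime_gt1 : (1 < n)%N.
Proof. by have := prime_gt1 p_prime; move: p_odd; case: (p) => [|[|[|[]]]]. Qed.

Lemma natF_eq0 k : (k%:R == 0 :> F) = (p %| k)%N.
Proof. by rewrite (dvdn_pcharf (pchar_Fp p_prime)). Qed.

Lemma natF_pred : n%:R = -1 :> F.
Proof.
apply/eqP; rewrite -addr_eq0 natr1 prednK ?prime_gt0 //.
by rewrite natF_eq0.
Qed.

Lemma small_natF_neq0 k : (0 < k < p)%N -> k%:R != 0 :> F.
Proof. by rewrite natF_eq0 => /andP[k0 kp]; rewrite gtnNdvd. Qed.

Lemma two_natF_neq0 : 2%:R != 0 :> F.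
Proof. by apply: small_natF_neq0; have := pred_prime_gt1; lia. Qed.

Lemma fermatF (x : F) : x != 0 -> x ^+ n = 1.
Proof.
move=> x0; apply: (mulIf x0); rewrite mul1r -exprSr prednK ?prime_gt0 //.
by have := expf_card x; rewrite card_Fp.
Qed.

(** The exponent 0 gives 0 rather than -1, because [0 ^+ 0 = 1]. *)
Lemma sum_exprF k :
  \sum_(x : F) x ^+ k = if (0 < k)%N && (n %| k)%N then -1 else 0.
Proof.
case: k => [|k] /=.
  by rewrite sumr_const card_Fp // (pchar_Fp_0 p_prime).
case: ifPn => [nk|nk].
  rewrite (bigD1 0) //= expr0n add0r -[RHS]natF_pred.
  rewrite (eq_bigr (fun=> 1)) => [|x x0]; first by rewrite sumr_const cardC1 card_Fp.
  by have /dvdnP[j ->] := nk; rewrite mulnC exprM fermatF // expr1n.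
(* Otherwise all [n] nonzero elements would be roots of ['X^r - 1] with [0 < r < n]. Multiplying the
   variable by [a] then shows that the sum vanishes. *)
have [a a0 ak] : exists2 a : F, a != 0 & a ^+ k.+1 != 1.
  apply/exists_inP; apply: contraR nk; rewrite negb_exists_in => /forall_inP a1.
  rewrite /dvdn; apply/eqP; set r := (k.+1 %% n)%N.
  apply/eqP; apply/negPn/negP => r0.
  have ltrn : (r < n)%N by rewrite ltn_mod; have := pred_prime_gt1; lia.
  have sz : size ('X^r - 1 : {poly F}) = r.+1.
    by rewrite size_XnsubC // lt0n.
  have := @max_poly_roots F ('X^r - 1) (enum (predC1 (0 : F))).
  rewrite -size_poly_eq0 sz -cardE cardC1 card_Fp // enum_uniq.
  suff -> : all (root ('X^r - 1)) (enum (predC1 (0 : F))).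
    by move=> /(_ isT isT isT); rewrite ltnS leqNgt ltrn.
  apply/allP => x; rewrite mem_enum inE => x0.
  have /negPn/eqP := a1 x x0.
  rewrite (divn_eq k.+1 n) exprD mulnC exprM fermatF // expr1n mul1r -/r => xr.
  by rewrite rootE !hornerE xr subrr.
apply: (mulfI (_ : a ^+ k.+1 - 1 != 0)); first by rewrite subr_eq0.
rewrite mulr0 mulrBl mul1r big_distrr /= [X in _ - X](reindex_inj (mulfI a0)) /=.
rewrite -sumrB big1 // => x _; by rewrite exprMn subrr.
Qed.

(** The mirror pairs are freed one at a time. As [n = -1] in [F], the two coefficients of
    [weight_setD_pair] at step [r] are [-2(r + 1)] and [-2(r + 2)], and the quotients
    [(r + 2)/(r + 1)] telescope. *)
Lemma weight_all_free (a : 'I_n) :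
  weight F set0 [ffun=> a] = n./2.+1%:R * weight F setT [ffun=> a].
Proof.
have n_even := pred_prime_even; have nE := half_double n_even.
have -> : set0 = ~: paired n n./2.
  apply/esym/setP => v; rewrite !inE /=.
  by move: (n./2) nE (ltn_ord v); lia.
have -> : setT = ~: paired n 0 by apply/esym/setP => v; rewrite !inE /=.
suff: forall r, (r <= n./2)%N -> #|~: paired n r| = (n - r - r)%N /\
    weight F (~: paired n r) [ffun=> a] =
    r.+1%:R * weight F (~: paired n 0) [ffun=> a].
  by case/(_ _ (leqnn _)).
elim=> [|r IHr] le_r.
  split; last by rewrite mul1r.
  rewrite !subn0 -[RHS]card_ord -cardsT; congr #|pred_of_set _|.
  by apply/setP => v; rewrite !inE.
have [cardN wN] := IHr (ltnW le_r).
have lt_rn : (r < n)%N by move: (n./2) nE le_r; lia.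
pose i := Ordinal lt_rn.
have iN : i \in ~: paired n r.
  by rewrite !inE /=; move: (n./2) nE le_r; lia.
have N_rev v : (rev_ord v \in ~: paired n r) = (v \in ~: paired n r).
  by rewrite !inE rev_ordK orbC.
have ND : ~: paired n r :\: [set i; rev_ord i] = ~: paired n r.+1.
  apply/setP => v; rewrite !inE -!val_eqE /=.
  by move: (ltn_ord v); lia.
have cardND : #|~: paired n r.+1| = (n - r.+1 - r.+1)%N.
  have := cardsD (~: paired n r) [set i; rev_ord i].
  rewrite ND (setIidPr _) ?cards2 ?cardN; last first.
    by apply/subsetP => v; rewrite in_set2 => /orP[] /eqP->; rewrite ?N_rev.
  by rewrite eq_sym rev_ord_neq // => ->; lia.
split=> //; have := weight_setD_pair n_even F N_rev a iN.
rewrite ND wN cardN.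
have r1 : (2 * r.+1)%:R != 0 :> F.
  by apply: small_natF_neq0; move: (n./2) nE le_r; lia.
have -> : (n - r - r).-1%:R = - (2 * r.+1)%:R :> F.
  apply/eqP; rewrite -addr_eq0 -natrD.
  rewrite (_ : (_ + _)%N = p) ?natF_eq0 //.
  by have := prime_gt0 p_prime; move: (n./2) nE le_r; lia.
have -> : ((n - r - r).-1 + n.-1)%:R = - (2 * r.+2)%:R :> F.
  apply/eqP; rewrite -addr_eq0 -natrD.
  rewrite (_ : (_ + _)%N = (2 * p)%N) ?natF_eq0 ?dvdn_mull //.
  by have := prime_gt0 p_prime; move: (n./2) nE le_r; lia.
move=> E; apply: (mulfI r1); apply: oppr_inj; rewrite -mulNr E !natrM.
ring.
Qed.

Lemma factF_neq0 k : (k < p)%N -> k`!%:R != 0 :> F.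
Proof.
elim: k => [|k IHk] lt_kp; first by rewrite oner_eq0.
by rewrite factS natrM; apply: mulf_neq0; [apply: small_natF_neq0 | apply/IHk/ltnW].
Qed.

Lemma fact_predF : n`!%:R = -1 :> F.
Proof.
apply/eqP; rewrite -addr_eq0 natr1 natF_eq0.
by rewrite -Wilson // prime_gt1.
Qed.

Lemma card_centralizerF_neq0 : #|rev_centralizer n|%:R != 0 :> F.
Proof.
have lt_np : (n < p)%N by rewrite prednK ?prime_gt0.
have := factF_neq0 lt_np; rewrite !natF_eq0; apply: contraNN => pZ.
exact: dvdn_trans pZ (dvd_card_rev_centralizer n).
Qed.

End PrimeField.

(** * Exchange of the signs at the vertices with the signs of the color classes *)

Section Labelings.
Local Open Scope ring_scope.
Variable n : nat.
Hypothesis n_even : ~~ odd n.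
Local Notation V := 'I_n.
Local Notation slot := ('I_n * 'I_n)%type.

Lemma slot_inv1_neq (x : slot) : (slot_inv x).1 != x.1.
Proof.
case: x => v w; rewrite /slot_inv /=; case: (eqVneq v w) => [_|vw] /=.
  exact: rev_ord_neq.
by rewrite eq_sym.
Qed.

Definition slot_half : {set slot} :=
  [set x : slot | (x.1 < x.2)%N || (x.1 == x.2) && (x.1 \in half_set n)].

Lemma slot_half_inv x : (slot_inv x \in slot_half) = (x \notin slot_half).
Proof.
case: x => v w; rewrite ![_ \in slot_half]inE /slot_inv /=.
case: (eqVneq v w) => [->|vw] /=.
  by rewrite !ltnn eqxx /= half_set_rev.
by rewrite eq_sym (negPf vw) !orbF -leqNgt [RHS]leq_eqVlt val_eqE eq_sym (negPf vw).
Qed.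

Lemma card_slot_half : #|slot_half| = (n * n./2)%N.
Proof.
have cardsH : (#|slot_half| + #|slot_half| = n * n)%N.
  rewrite -[X in (X * _)%N]card_ord -[X in (_ * X)%N]card_ord -card_prod.
  rewrite -(cardsC slot_half); congr (_ + _)%N.
  rewrite -(card_imset _ (@slot_inv_inj n)); apply: eq_card => x.
  rewrite -[x in LHS]slot_invK mem_imset; last exact: slot_inv_inj.
  by rewrite in_setC slot_half_inv.
have : (n * n = n * n./2 + n * n./2)%N by rewrite -mulnDr -(half_double n_even).
by move: #|slot_half| (n * n./2)%N cardsH; lia.
Qed.

Lemma slot_halfE x : (x \in slot_half) = (x.1 < (slot_inv x).1)%N.
Proof.
case: x => v w; rewrite inE /slot_inv /=; case: (eqVneq v w) => [->|vw] /=.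
  rewrite ltnn inE /=.
  by move: (n./2) (half_double n_even) (ltn_ord w); lia.
by rewrite orbF.
Qed.

(* A labeling Q lists, for every color c, the half-edges of color c, the two
   halves of an edge standing at positions i and rev_ord i. *)
Definition labeling (Q : {ffun V -> {ffun V -> slot}}) :=
  [forall c, forall i, Q c (rev_ord i) == slot_inv (Q c i)] &&
  injectiveb (fun u : V * V => Q u.1 u.2).

Definition labels (g : slot -> V) (Q : {ffun V -> {ffun V -> slot}}) :=
  labeling Q && [forall c, forall i, g (Q c i) == c].

Lemma labelingP (Q : {ffun V -> {ffun V -> slot}}) : reflect
  ((forall c i, Q c (rev_ord i) = slot_inv (Q c i)) /\
   injective (fun u : V * V => Q u.1 u.2)) (labeling Q).
Proof.
apply: (iffP andP) => -[eqQ /injectiveP QI]; split=> //.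
  by move=> c i; apply/eqP; move/forallP: eqQ => /(_ c)/forallP/(_ i).
by apply/forallP => c; apply/forallP => i; rewrite eqQ.
Qed.

Lemma labelsP (g : slot -> V) (Q : {ffun V -> {ffun V -> slot}}) :
  reflect (labeling Q /\ forall c i, g (Q c i) = c) (labels g Q).
Proof.
apply: (iffP andP) => -[lQ gQ]; split=> //.
  by move=> c i; apply/eqP; move/forallP: gQ => /(_ c)/forallP/(_ i).
by apply/forallP => c; apply/forallP => i; rewrite gQ.
Qed.

(** The edges of color [c] match the vertices by the involution [mu c], whose pairs
    [fixed_point_free_conj] lists with the smaller ends in the first half. *)
Lemma exists_labels (g : slot -> V) :
  (forall x, g (slot_inv x) = g x) -> (forall v, injective (fun w => g (v, w))) ->
  exists Q, labels g Q /\ forall c i, i \in half_set n -> Q c i \in slot_half.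
Proof.
move=> g_inv gI.
pose s c v : slot := (v, invF (gI v) c).
have gs c v : g (s c v) = c by rewrite /s (f_invF (gI v)).
have sE x : x = s (g x) x.1.
  by case: x => v w; rewrite /s /= (invF_f (gI v)).
pose mu c v := (slot_inv (s c v)).1.
have s_inv c v : slot_inv (s c v) = s c (mu c v).
  by rewrite [LHS]sE g_inv gs.
have muK c : involutive (mu c) by move=> v; rewrite {1}/mu -s_inv slot_invK.
have mu_neq c v : mu c v != v by apply: slot_inv1_neq.
have /fin_all_exists[q qP] c := fixed_point_free_conj n_even (muK c) (mu_neq c).
exists [ffun c => [ffun i => s c (q c i)]]; split; last first.
  move=> c i iH; rewrite !ffunE slot_halfE s_inv /=.
  by case: (qP c) => _ /(_ i iH).
apply/labelsP; split; last by move=> c i; rewrite !ffunE gs.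
apply/labelingP; split=> [c i|[c i] [c' i']].
  by rewrite !ffunE s_inv; case: (qP c) => ->.
rewrite !ffunE /= => e; have cc : c = c' by rewrite -(gs c (q c i)) e gs.
by move: e; rewrite {}cc => /(congr1 fst) /= /perm_inj ->.
Qed.

(** Two labelings of one coloring differ, color by color, by a permutation of the positions that
    commutes with [rev_ord]. *)
Lemma card_labels (g : slot -> V) :
  (forall x, g (slot_inv x) = g x) -> (forall v, injective (fun w => g (v, w))) ->
  #|[set Q | labels g Q]| = (#|rev_centralizer n| ^ n)%N.
Proof.
move=> g_inv gI; have [Q1 [/labelsP[/labelingP[eqQ1 Q1I] gQ1] _]] := exists_labels g_inv gI.
have Q1inj c : injective (Q1 c).
  by move=> i j Qij; have [] : (c, i) = (c, j) by apply: Q1I.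
pose h (f : {ffun V -> 'S_n}) := [ffun c => [ffun i => Q1 c (f c i)]].
have hI : injective h.
  move=> f f' hf; apply/ffunP => c; apply/permP => i; apply: (Q1inj c).
  by have := congr1 (fun Q : {ffun V -> {ffun V -> slot}} => Q c i) hf; rewrite !ffunE.
have -> : (#|rev_centralizer n| ^ n)%N =
    #|[set h f | f : {ffun V -> 'S_n} in ffun_on (mem (rev_centralizer n))]|.
  by rewrite (card_imset _ hI) card_ffun_on card_ord.
apply: eq_card => Q; rewrite inE; apply/labelsP/imsetP => [|[f /ffun_onP fC ->]].
  move=> [/labelingP[eqQ QI] gQ].
  have Q1on x : exists i, Q1 (g x) i = x.
    pose u := invF Q1I x; have ux : Q1 u.1 u.2 = x by rewrite (f_invF Q1I).
    by exists u.2; rewrite -ux gQ1.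
  have /fin_all_exists[f fP] c : exists s : 'S_n, forall i, Q1 c (s i) = Q c i.
    have /fin_all_exists[s sP] i : exists j, Q1 c j = Q c i.
      by have := Q1on (Q c i); rewrite gQ.
    have sI : injective s.
      move=> i j sij; have [//] : (c, i) = (c, j); apply: QI.
      by rewrite /= -!sP sij.
    by exists (perm sI) => i; rewrite permE.
  exists [ffun c => f c].
    apply/ffun_onP => c; rewrite ffunE inE; apply/'forall_eqP => v.
    by apply: (Q1inj c); rewrite eqQ1 !fP eqQ.
  by apply/ffunP => c; apply/ffunP => i; rewrite !ffunE fP.
split; last by move=> c i; rewrite !ffunE gQ1.
apply/labelingP; split=> [c i|[c i] [c' i']].
  by rewrite !ffunE -eqQ1; have := fC c; rewrite inE => /'forall_eqP ->.
rewrite !ffunE /= => e.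
have /Q1I [cc] : Q1 (c, f c i).1 (c, f c i).2 = Q1 (c', f c' i').1 (c', f c' i').2 by [].
by rewrite {}cc => /perm_inj ->.
Qed.

Section Sign.
Variable R : comNzRingType.

Definition orient (x : slot) : R := if x \in slot_half then 1 else -1.

Lemma orient_inv x : orient (slot_inv x) = - orient x.
Proof. by rewrite /orient slot_half_inv; case: (x \in _); rewrite ?opprK. Qed.

(* Listing the half-edges by color and position on the one hand, by vertex and
   color on the other hand, exchanges the signs at the vertices with the signs
   of the matchings, up to a sign that depends on n only. *)
Definition sign_exchange (kappa : R) : Prop :=
  forall (g : slot -> V) (Q : {ffun V -> {ffun V -> slot}}), labels g Q ->
  (\prod_c fsgn R (fun i => (Q c i).1)) *
  (\prod_c \prod_(i in half_set n) orient (Q c i)) = kappa * row_sign R g.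

Lemma labeling_sign : exists kappa : R, sign_exchange kappa.
Proof.
pose swap (u : V * V) := (u.2, u.1).
have swapI : injective swap by case=> ? ? [? ?] [-> ->].
pose unc (Q : {ffun V -> {ffun V -> slot}}) (u : V * V) := Q u.1 u.2.
pose beta (u : V * V) : V * V := (u.1, rev_ord u.2).
have betaK : involutive beta by case=> c i; rewrite /beta /= rev_ordK.
pose H : {set V * V} := [set u : V * V | u.2 \in half_set n].
have betaH u : (beta u \in H) = (u \notin H).
  by rewrite ![_ \in H]inE half_set_rev.
(* Both sides are the sign of [(c, i) |-> ((Q c i).1, c)], factored through the slot [Q c i] on the
   left and through [(c, (Q c i).1)] on the right. *)
have rowE g (Q : {ffun V -> {ffun V -> slot}}) : labels g Q ->
    row_sign R g * fsgn R (unc Q) = fsgn R swap * \prod_c fsgn R (fun i => (Q c i).1).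
  move=> /labelsP[_ gQ]; rewrite /row_sign -!fsgn_fiber_map -!fsgn_comp.
  apply: eq_fsgn => -[c i]; rewrite /fiber_map /swap /unc /=.
  by rewrite -surjective_pairing gQ.
have oriE (Q : {ffun V -> {ffun V -> slot}}) :
    \prod_c \prod_(i in half_set n) orient (Q c i) = \prod_(u in H) orient (unc Q u).
  by rewrite pair_big /=; apply: eq_bigl => -[c i]; rewrite !inE.
(* Two labelings differ by a permutation of [V * V] commuting with [beta], and its sign is
   compensated by the orientations. This invariant product is the source of [kappa]. *)
have relE (Q Q1 : {ffun V -> {ffun V -> slot}}) : labeling Q -> labeling Q1 ->
    fsgn R (unc Q) * \prod_(u in H) orient (unc Q u) =
    fsgn R (unc Q1) * \prod_(u in H) orient (unc Q1 u).
  move=> /labelingP[eqQ QI] /labelingP[eqQ1 Q1I].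
  pose f := invF Q1I \o unc Q.
  have fE u : unc Q1 (f u) = unc Q u by rewrite /f /unc /= (f_invF Q1I).
  have fI : injective f by apply: inj_comp QI; apply: can_inj (f_invF Q1I).
  have fb u : f (beta u) = beta (f u).
    have uncI : injective (unc Q1) := Q1I.
    by apply: uncI; rewrite fE {2}/unc /= eqQ1 -/(unc Q1 (f u)) fE /unc /= eqQ.
  have : \prod_(u in H) orient (unc Q1 (f u)) =
      fsgn R f * \prod_(u in H) orient (unc Q1 u).
    apply: (fsgn_half_sign betaK betaH (theta := fun u => orient (unc Q1 u))) => //.
    by move=> u; rewrite /unc /beta /= eqQ1 orient_inv.
  under eq_bigr do rewrite fE.
  move=> ->; rewrite mulrA -(eq_fsgn _ fE) fsgn_comp.
  by rewrite -[_ * _ * fsgn R f]mulrA -expr2 fsgn_sqr ?mulr1.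
have [Q1 lQ1|noQ] := pickP labeling; last first.
  by exists 1 => g Q /andP[]; rewrite noQ.
exists (fsgn R swap * (fsgn R (unc Q1) * \prod_(u in H) orient (unc Q1 u))).
move=> g Q lgQ; have lQ : labeling Q by case/andP: lgQ.
rewrite -(relE _ _ lQ lQ1) oriE; set O := \prod_(u in H) _.
transitivity (fsgn R swap * O * (row_sign R g * fsgn R (unc Q))); last by ring.
rewrite (rowE _ _ lgQ) -[LHS]mul1r -(fsgn_sqr R swapI); ring.
Qed.

End Sign.
End Labelings.

Lemma prod_half (R : comNzRingType) (T : finType) (beta : T -> T) (H : {set T})
    (f : T -> R) :
  involutive beta -> (forall x, (beta x \in H) = (x \notin H)) ->
  (\prod_x f x = \prod_(x in H) (f x * f (beta x)))%R.
Proof.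
move=> betaK betaH; rewrite (bigID (mem H)) big_split /=; congr (_ * _)%R.
rewrite (reindex_inj (inv_inj betaK)) /=; apply: eq_bigl => x.
by rewrite betaH negbK.
Qed.

(** * The order of the hyperoctahedral group *)

Section CentralizerCard.
Variable n : nat.
Hypothesis n_even : ~~ odd n.

(** An element amounts to a permutation of the mirror pairs, represented by the elements of [H],
    together with the set of image pairs that it reverses. *)
Lemma card_rev_centralizer : #|rev_centralizer n| = 2 ^ n./2 * n./2`!.
Proof.
pose H := half_set n; have Hrev := half_set_rev n_even.
pose r v := if v \in H then v else rev_ord v.
have rH v : r v \in H by rewrite /r; case: ifPn => // vH; rewrite Hrev.
have rid v : v \in H -> r v = v by rewrite /r => ->.
have rrev v : r (rev_ord v) = r v by rewrite /r Hrev rev_ordK; case: (v \in H).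
have r_inj v w : r v = r w -> (v \in H) = (w \in H) -> v = w.
  by rewrite /r => + vw; rewrite vw; case: ifP => // _ /rev_ord_inj.
rewrite -(card_half_set n_even) -/H -card_powerset -card_perm mulnC.
rewrite -(cardsE (perm_on H)) -cardsX.
pose f (u : {perm 'I_n} * {set 'I_n}) := [ffun v =>
  let w := u.1 (r v) in if (w \in u.2) (+) (v \notin H) then rev_ord w else w].
pose toffun (q : 'S_n) := [ffun v => q v].
have toffunI : injective toffun.
  move=> q q' qq'; apply/permP => v.
  by have := congr1 (fun g : {ffun 'I_n -> 'I_n} => g v) qq'; rewrite !ffunE.
pose D := setX [set s | perm_on H s] (powerset H).
have domP u : u \in D -> (forall v, v \in H -> u.1 v \in H) /\ u.2 \subset H.
  by rewrite inE => /andP[]; rewrite !inE => su ->; split=> // v; rewrite perm_closed.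
have fr u v : u \in D -> r (f u v) = u.1 (r v).
  by move=> /domP[uH _]; rewrite ffunE /=; case: ifP => _; rewrite ?rrev rid // uH.
have fH u v : u \in D -> (f u v \in H) = ~~ ((u.1 (r v) \in u.2) (+) (v \notin H)).
  move=> /domP[uH _]; rewrite ffunE /=; case: ifP => _; rewrite ?Hrev uH //.
have fI : {in D &, injective f}.
  move=> u u' uD u'D ff'; have [uH uA] := domP u uD; have [u'H u'A] := domP u' u'D.
  have s_eq : u.1 = u'.1.
    apply/permP => v; have [vH|vH] := boolP (v \in H).
      by rewrite -(rid v vH) -!fr // ff'.
    have su : perm_on H u.1 by move: uD; rewrite inE => /andP[]; rewrite inE.
    have su' : perm_on H u'.1 by move: u'D; rewrite inE => /andP[]; rewrite inE.
    by rewrite (out_perm su vH) (out_perm su' vH).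
  case: u u' s_eq uD u'D uH u'H uA u'A ff' => [s A] [s' A'] /= -> uD u'D uH u'H uA u'A ff'.
  congr (_, _); apply/setP => w; have [wH|wH] := boolP (w \in H); last first.
    by rewrite (contraNF (subsetP uA w) wH) (contraNF (subsetP u'A w) wH).
  pose v := (s'^-1)%g w; have vw : s' v = w by rewrite permKV.
  have vH : v \in H.
    have s'H : perm_on H s' by move: uD; rewrite in_setX inE => /andP[].
    by apply/negPn/negP => vH; rewrite -vw (out_perm s'H vH) (negPf vH) in wH.
  have := fH _ v uD; have := fH _ v u'D; rewrite ff' /= rid // vw vH !addbF => -> /negb_inj.
  by [].
rewrite -(card_in_imset fI) -(card_imset _ toffunI); apply: eq_card => g.
apply/imsetP/imsetP => [[q qC ->]|[u uD ->]].
  have {}qC v : q (rev_ord v) = rev_ord (q v) by move: qC; rewrite inE => /'forall_eqP.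
  pose s0 v := if v \in H then r (q v) else v.
  have s0I : injective s0.
    move=> v w; rewrite /s0; case: ifPn => vH; case: ifPn => wH //.
    - move=> e; have [e'|ne'] := boolP ((q v \in H) == (q w \in H)).
        exact: perm_inj (r_inj _ _ e (eqP e')).
      have : q v = q (rev_ord w).
        apply: r_inj; first by rewrite qC rrev.
        by rewrite qC Hrev; move: ne'; case: (_ \in H); case: (_ \in H).
      by move=> /perm_inj vw; rewrite vw Hrev wH in vH.
    - by move=> e; rewrite -e rH in wH.
    - by move=> e; rewrite e rH in vH.
  pose A := [set w in H | q ((perm s0I)^-1%g w) \notin H].
  have sH v : v \in H -> perm s0I v = r (q v) by rewrite permE /s0 => ->.
  have uD : (perm s0I, A) \in D.
    rewrite !inE; apply/andP; split; last by apply/subsetP => w; rewrite inE => /andP[].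
    by apply/subsetP => v; rewrite inE permE /s0; case: ifP => //; rewrite eqxx.
  exists (perm s0I, A) => //; apply/ffunP => v; rewrite ffunE; apply: r_inj.
    rewrite fr //= sH //; rewrite /r; case: (boolP (v \in H)) => // vH.
    by rewrite qC -/(r _) -/(r _) rrev.
  rewrite fH //= sH // [_ \in A]inE rH /= -(sH _ (rH v)) permK {1}/r.
  case: (boolP (v \in H)) => vH; first by rewrite addbF negbK.
  by rewrite qC Hrev negbK addbT negbK.
have gI : injective (f u).
  move=> v w e; apply: r_inj.
    by apply: (@perm_inj _ u.1); rewrite -!fr // e.
  have := fH u v uD; rewrite e fH // => /negb_inj.
  have -> : u.1 (r v) = u.1 (r w) by rewrite -!fr // e.
  by move/addbI/negb_inj.
exists (perm gI); last by apply/ffunP => v; rewrite [RHS]ffunE permE.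
rewrite inE; apply/'forall_eqP => v; rewrite !permE !ffunE /= rrev Hrev addbN.
by case: (_ (+) _); rewrite ?rev_ordK.
Qed.

End CentralizerCard.

(** * The weighted skew adjacency matrix and its Pfaffian *)

Section SkewSum.
Local Open Scope ring_scope.
Variable p : nat.
Hypothesis p_prime : prime p.
Hypothesis p_odd : odd p.
Local Notation n := p.-1.
Local Notation F := 'F_p.
Local Notation V := 'I_n.
Local Notation slot := ('I_n * 'I_n)%type.
Let n_even : ~~ odd n := pred_prime_even p_prime p_odd.
Let n_gt1 : (1 < n)%N := pred_prime_gt1 p_prime p_odd.

Definition odd_slots (xi : {ffun slot -> F}) :=
  [forall x, xi (slot_inv x) == - xi x].

(** An entry can have two terms: the additional edge from [i] to [rev_ord i] is parallel to an edge
    of [K_n]. *)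
Definition slot_mx (xi : {ffun slot -> F}) : 'M[F]_n :=
  \matrix_(i, j) \sum_(x | (x.1 == i) && ((slot_inv x).1 == j)) xi x.

Lemma pfaffian_sum_slot_mx (xi : {ffun slot -> F}) :
  pfaffian_sum (slot_mx xi) =
  \sum_(Y : {ffun V -> slot} | [forall i, Y (rev_ord i) == slot_inv (Y i)])
    fsgn F (fun i => (Y i).1) * \prod_(i in half_set n) xi (Y i).
Proof.
transitivity (\sum_(q : 'S_n)
    \sum_(Y : {ffun V -> slot} | [forall i, Y (rev_ord i) == slot_inv (Y i)])
    ((-1) ^+ q * ([forall i, q i == (Y i).1]%:R)) * \prod_(i in half_set n) xi (Y i)).
  apply: eq_bigr => q _; under [RHS]eq_bigr do rewrite -mulrA.
  rewrite -big_distrr /=; congr (_ * _).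
  transitivity (\prod_(i in half_set n) \sum_(x : slot)
      ((x.1 == q i) && ((slot_inv x).1 == q (rev_ord i)))%:R * xi x).
    apply: eq_bigr => i _; rewrite mxE big_mkcond /=; apply: eq_bigr => x _.
    by case: ifP; rewrite ?mul1r ?mul0r.
  rewrite (prod_sum_equivariant (@rev_ordK n) (half_set_rev n_even)
    (fun i (x : slot) => ((x.1 == q i) && ((slot_inv x).1 == q (rev_ord i)))%:R * xi x)
    (@slot_invK n)).
  apply: eq_bigr => Y /'forall_eqP eqY; rewrite big_split /=; congr (_ * _).
  have [/'forall_eqP qY|/forallPn[v qv]] := boolP [forall i, q i == (Y i).1].
    by rewrite big1 // => i _; rewrite -eqY !qY !eqxx.
  have [vH|vH] := boolP (v \in half_set n).
    by rewrite (bigD1 v) //= eq_sym (negPf qv) mul0r.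
  rewrite (bigD1 (rev_ord v)) ?half_set_rev //= rev_ordK -eqY rev_ordK.
  by rewrite [(Y v).1 == _]eq_sym (negPf qv) andbF mul0r.
rewrite exchange_big; apply: eq_bigr => Y _ /=; rewrite -big_distrl /=.
congr (_ * _); rewrite /fsgn [RHS]big_mkcond; apply: eq_bigr => q _.
by case: ifP; rewrite ?mulr1 ?mulr0.
Qed.

(** If the edge of [x] occurs [h x] times in the monomial, it contributes the power sum of exponent
    [n.-1 + h x], which is -1 for [h x = 1] and 0 for [h x = 0]. There are as many factors as edges,
    so if [Q] is not a labeling, some edge is missing. The number [n * n./2] of edges is even, hence
    no sign remains. *)
Lemma sum_odd_slots_monomial (Q : {ffun V -> {ffun V -> slot}}) :
  (forall c i, Q c (rev_ord i) = slot_inv (Q c i)) ->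
  \sum_(xi | odd_slots xi) (\prod_(x in slot_half n) xi x ^+ n.-1) *
     \prod_c \prod_(i in half_set n) xi (Q c i) =
  (labeling Q)%:R * \prod_c \prod_(i in half_set n) orient F (Q c i).
Proof.
move=> eqQ.
pose rep (x : slot) := if x \in slot_half n then x else slot_inv x.
have repH x : rep x \in slot_half n.
  by rewrite /rep; case: ifPn => // xH; rewrite slot_half_inv.
have rep_inv x : rep (slot_inv x) = rep x.
  by rewrite /rep slot_half_inv //; case: (x \in _) => //=; apply: slot_invK.
have repE x : x \in slot_half n -> rep x = x by rewrite /rep => ->.
pose H : {set V * V} := [set u : V * V | u.2 \in half_set n].
have prodH (f : slot -> F) :
    \prod_c \prod_(i in half_set n) f (Q c i) = \prod_(u in H) f (Q u.1 u.2).
  by rewrite pair_big /=; apply: eq_bigl => -[c i]; rewrite !inE.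
pose h x := #|[set u in H | rep (Q u.1 u.2) == x]|.
transitivity (\sum_(xi : {ffun slot -> F} | odd_slots xi)
    (\prod_(u in H) orient F (Q u.1 u.2)) *
    \prod_(x in slot_half n) xi x ^+ (n.-1 + h x)).
  apply: eq_bigr => xi /'forall_eqP oddxi; rewrite prodH.
  have -> : \prod_(u in H) xi (Q u.1 u.2) =
      (\prod_(u in H) orient F (Q u.1 u.2)) * \prod_(u in H) xi (rep (Q u.1 u.2)).
    rewrite -big_split; apply: eq_bigr => u _; rewrite /orient /rep /=.
    by case: ifP => _; rewrite ?mul1r // oddxi mulN1r opprK.
  rewrite mulrCA; congr (_ * _); under [RHS]eq_bigr do rewrite exprD.
  rewrite big_split /=; congr (_ * _).
  rewrite (partition_big (fun u => rep (Q u.1 u.2)) (mem (slot_half n))) //=.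
  apply: eq_bigr => x _; rewrite -prodr_const; apply: eq_big => [u|u /andP[_ /eqP->]//].
  by rewrite !inE.
rewrite -big_distrr /= prodH mulrC; congr (_ * _).
have sumE := prod_sum_equivariant (@slot_invK n) (slot_half_inv n_even)
    (fun x (z : F) => z ^+ (n.-1 + h x)) (@opprK F).
rewrite -{}sumE.
have [lQ|lQ] := boolP (labeling Q).
  have h1 x : x \in slot_half n -> h x = 1%N.
    move=> xH; have [_ QI] := labelingP _ lQ.
    have [u uH ux] : exists2 u, u \in H & rep (Q u.1 u.2) = x.
      pose u := invF QI x; have ux : Q u.1 u.2 = x by rewrite (f_invF QI).
      have [uH|uH] := boolP (u \in H); first by exists u => //; rewrite ux repE.
      exists (u.1, rev_ord u.2); last by rewrite eqQ rep_inv ux repE.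
      by move: uH; rewrite ![_ \in H]inE half_set_rev.
    rewrite /h (_ : [set _ in _ | _] = [set u]) ?cards1 //.
    apply/setP => w; rewrite in_set1 inE; apply/andP/eqP => [[wH /eqP wx]|->].
      have : Q w.1 w.2 = Q u.1 u.2 \/ Q w.1 w.2 = Q (u.1, rev_ord u.2).1 (u.1, rev_ord u.2).2.
        rewrite /= eqQ; move: ux; rewrite -wx /rep; do 2!case: ifP => _ => //.
        - by left.
        - by move=> ->; right; rewrite slot_invK.
        - by move=> <-; right.
        - by move=> /slot_inv_inj ->; left.
      case=> /QI // uw; move: wH uH; rewrite uw ![_ \in H]inE half_set_rev //=.
      by move=> /negPf ->.
    by rewrite uH ux eqxx.
  rewrite (eq_bigr (fun=> -1)) => [|x xH]; last first.
    by rewrite h1 // addn1 prednK ?sum_exprF ?dvdnn ?(ltnW n_gt1) //.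
  by rewrite prodr_const card_slot_half // -signr_odd oddM (negPf n_even).
have [x xH hx] : exists2 x, x \in slot_half n & h x = 0%N.
  have QnI : ~ injective (fun u : V * V => Q u.1 u.2).
    by move=> QI; move/negP: lQ; apply; apply/labelingP.
  have [y /forallP yQ] : exists y, [forall u : V * V, Q u.1 u.2 != y].
    apply/existsP; apply: contra_notT QnI; rewrite negb_exists => /forallP Qon.
    have /image_injP QI : #|image (fun u : V * V => Q u.1 u.2) predT| == #|{: V * V}|.
      apply/eqP/eq_card => y; rewrite inE; apply/imageP.
      by have /forallPn[u /negPn/eqP uy] := Qon y; exists u.
    by move=> u w; apply: QI.
  exists (rep y) => //; apply/eqP; rewrite cards_eq0; apply/eqP/setP => u.
  rewrite !inE; apply/negP => /andP[_ /eqP].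
  have := yQ u; have := yQ (u.1, rev_ord u.2); rewrite /= eqQ /rep.
  case: ifP => _; case: ifP => _ => /eqP ny /eqP ny'.
  - by move/ny'.
  - by move=> e; apply: ny; rewrite e slot_invK.
  - by move/ny.
  - by move/slot_inv_inj/ny'.
rewrite (bigD1 x) //= hx addn0 sum_exprF // gtnNdvd ?andbF ?mul0r //; lia.
Qed.

Definition skew_sum : F := \sum_(xi | odd_slots xi)
  (\prod_(x in slot_half n) xi x ^+ n.-1) * pfaffian_sum (slot_mx xi) ^+ n.

(** In the expansion of the power [n] each factor provides one color class. A proper coloring arises
    once per labeling, that is [#|rev_centralizer n| ^ n] times, which is 1 in [F]. *)
Lemma skew_sum_weight (kappa : F) (b : {ffun V -> V}) :
  sign_exchange n kappa ->
  skew_sum = kappa * weight F set0 b.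
Proof.
move=> kappaE; rewrite /skew_sum.
pose eqv (Y : {ffun V -> slot}) := [forall i, Y (rev_ord i) == slot_inv (Y i)].
transitivity (\sum_(Q : {ffun V -> {ffun V -> slot}} | Q \in ffun_on eqv)
   (\prod_c fsgn F (fun i => (Q c i).1)) * \sum_(xi | odd_slots xi)
    (\prod_(x in slot_half n) xi x ^+ n.-1) *
     \prod_c \prod_(i in half_set n) xi (Q c i)).
  under [RHS]eq_bigr do rewrite big_distrr /=.
  rewrite [RHS]exchange_big /=; apply: eq_bigr => xi _.
  rewrite -[X in _ ^+ X]card_ord -prodr_const pfaffian_sum_slot_mx bigA_distr_big /=.
  rewrite big_distrr /=; apply: eq_bigr => Q _.
  by rewrite big_split /= mulrCA.
transitivity (\sum_(Q : {ffun V -> {ffun V -> slot}} | labeling Q)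
   (\prod_c fsgn F (fun i => (Q c i).1)) *
   (\prod_c \prod_(i in half_set n) orient F (Q c i))).
  rewrite [RHS]big_mkcond [LHS]big_mkcond; apply: eq_bigr => Q _.
  case: ifP => [/ffun_onP eqQ|eqQ].
    rewrite sum_odd_slots_monomial => [|c i]; last first.
      by apply/eqP; move/forallP: (eqQ c).
    by case: ifP => _; rewrite ?mul1r ?mul0r ?mulr0.
  case: ifP => // /labelingP[eqQ' _]; case/negP: eqQ.
  by apply/ffun_onP => c; apply/'forall_eqP.
transitivity (\sum_(Q : {ffun V -> {ffun V -> slot}} | labeling Q)
   \sum_(g : {ffun slot -> V} | labels g Q) kappa * row_sign F g).
  apply: eq_bigr => Q lQ; have [_ QI] := labelingP _ lQ.
  pose g := [ffun x => (invF QI x).1].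
  have lgQ : labels g Q.
    by apply/labelsP; split=> // c i; rewrite ffunE (invF_f QI (c, i)).
  rewrite (kappaE _ _ lgQ) (big_pred1 g) // => g'.
  apply/labelsP/eqP => [[_ g'Q]|->]; last by case/labelsP: lgQ.
  apply/ffunP => x; rewrite ffunE -[x in LHS](f_invF QI).
  exact: g'Q.
rewrite (exchange_big_dep predT) //= /weight big_distrr [RHS]big_mkcond /=.
apply: eq_bigr => g _; rewrite sumr_const.
have [/compatibleP g_inv|gN] := boolP (compatible set0 b g); last first.
  rewrite (eq_card0 _) ?mulr0n // => Q; apply/negP => /andP[lQ /labelsP[_ gQ]].
  case/negP: gN; apply/compatibleP => x; rewrite /bdry inE andbF.
  have [eqQ QI] := labelingP _ lQ; rewrite -[x](f_invF QI) /= -eqQ.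
  by rewrite !gQ.
have {}g_inv x : g (slot_inv x) = g x by rewrite [RHS]g_inv /bdry inE andbF.
have [/forallP gI|/forallPn[v gI]] := boolP [forall v, injectiveb (fun w => g (v, w))].
  rewrite (eq_card (B := [set Q | labels g Q])) => [|Q]; last first.
    by rewrite !inE; apply: andb_idl => /labelsP[].
  rewrite card_labels // => [|v]; last by apply/injectiveP.
  by rewrite -mulr_natr natrX fermatF ?mulr1 // card_centralizerF_neq0.
rewrite /row_sign (bigD1 v) //= fsgn0; first by rewrite mul0r mulr0 mul0rn.
by apply/injectiveP.
Qed.

(** The multinomial theorem for divided powers, read off from a product of exponential series
    truncated below degree [p], where the factorials are invertible. *)
Lemma multinomialF (I : finType) (z : I -> F) k : (k < p)%N ->
  (\sum_i z i) ^+ k / k`!%:R =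
  \sum_(a : {ffun I -> 'I_p} | (\sum_i a i == k)%N)
    \prod_i (z i ^+ a i / (a i)`!%:R).
Proof.
move=> lt_kp; pose E (x : F) : {poly F} := \poly_(j < p) (x ^+ j / j`!%:R).
transitivity ((\prod_i E (z i))`_k).
  move: lt_kp; rewrite -!big_enum /=; elim: (enum I) k => [|i s IHs] k lt_kp.
    rewrite !big_nil coef1 expr0n; case: eqP => [->|_]; last by rewrite mul0r.
    by rewrite fact0 divr1.
  rewrite !big_cons coefM addrC exprDn big_distrl /=; apply: eq_bigr => j _.
  have le_jk : (j <= k)%N by rewrite -ltnS.
  rewrite -IHs ?(leq_ltn_trans (leq_subr _ _)) // coef_poly (leq_ltn_trans le_jk) //.
  have k0 := factF_neq0 p_prime lt_kp.
  have j0 := factF_neq0 p_prime (leq_ltn_trans le_jk lt_kp).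
  have kj0 := factF_neq0 p_prime (leq_ltn_trans (leq_subr j k) lt_kp).
  have := congr1 (fun l => l%:R : F) (bin_fact le_jk); rewrite !natrM => binE.
  by rewrite -mulr_natr; field: binE; rewrite k0 j0 kj0.
under eq_bigr => i _ do rewrite /E poly_def.
rewrite (bigA_distr_bigA (fun i (j : 'I_p) => (z i ^+ j / j`!%:R) *: 'X^j)) /=.
rewrite coef_sum [RHS]big_mkcond; apply: eq_bigr => a _.
have -> : \prod_i ((z i ^+ a i / (a i)`!%:R) *: 'X^(a i)) =
    (\prod_i (z i ^+ a i / (a i)`!%:R)) *: 'X^(\sum_i a i) :> {poly F}.
  by rewrite scaler_prod -expr_sum.
by rewrite coefZ coefXn eq_sym; case: eqP; rewrite ?mulr1 ?mulr0.
Qed.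

(** As [n! = -1] in [F], subtracting the power [n] is adding the divided power of degree [n]; both
    degrees then expand in the same form. *)
Lemma indicator0F (I : finType) (z : I -> F) :
  1 - (\sum_i z i) ^+ n =
  \sum_(a : {ffun I -> 'I_p} | (\sum_i a i \in [:: 0; n])%N)
    \prod_i (z i ^+ a i / (a i)`!%:R).
Proof.
have p_gt0 := prime_gt0 p_prime.
rewrite (bigID (fun a : {ffun I -> 'I_p} => \sum_i a i == 0)%N) /=; congr (_ + _).
  transitivity ((\sum_i z i) ^+ 0 / 0`!%:R); first by rewrite fact0 divr1.
  rewrite multinomialF //; apply: eq_bigl => a.
  by rewrite !inE; case: (\sum_i a i)%N => [|k] //=; rewrite andbF.
transitivity ((\sum_i z i) ^+ n / n`!%:R).
  by rewrite fact_predF // invrN1 mulrN1.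
rewrite multinomialF ?prednK //; apply: eq_bigl => a.
by rewrite !inE; case: (\sum_i a i)%N => [|k] /=; rewrite ?andbT //; case: (n) n_gt1.
Qed.

(** The right side counts the kernel modulo [p]. A nonzero kernel is cut by one coordinate into [p]
    slices that are translates of each other along a kernel vector [u], so its cardinality is 0 in
    [F]. *)
Lemma unitmx_kernel_sum (X : 'M[F]_n) :
  (X \in unitmx)%:R = \sum_(v : {ffun V -> F}) \prod_i (1 - (\sum_j X i j * v j) ^+ n).
Proof.
pose Xv (v : {ffun V -> F}) := [forall i, \sum_j X i j * v j == 0].
transitivity (\sum_(v | Xv v) 1 : F); last first.
  rewrite big_mkcond; apply: eq_bigr => v _; rewrite /Xv.
  case: ifPn => [/'forall_eqP Xv0|/forallPn[i Xvi]].
    by rewrite big1 // => i _; rewrite Xv0 expr0n -leqn0 leqNgt (ltnW n_gt1) subr0.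
  by rewrite (bigD1 i) //= fermatF // subrr mul0r.
have XvE v : Xv v = (X *m (\col_j v j) == 0).
  apply/'forall_eqP/eqP => [Xv0|Xv0 i].
    by apply/colP => i; rewrite !mxE -[RHS](Xv0 i); apply: eq_bigr => j _; rewrite mxE.
  have := congr1 (fun M : 'cV_n => M i 0) Xv0; rewrite !mxE => {2}<-.
  by apply: eq_bigr => j _; rewrite mxE.
have [Xu|XN] := boolP (X \in unitmx).
  rewrite (big_pred1 [ffun=> 0]) // => v; rewrite XvE.
  apply/eqP/eqP => [Xv0|->]; last first.
    by rewrite (_ : \col__ _ = 0) ?mulmx0 //; apply/colP => j; rewrite !mxE ffunE.
  apply/ffunP => j; have := mulKmx Xu (\col_j v j); rewrite Xv0 mulmx0.
  by move/(congr1 (fun M : 'cV_n => M j 0)); rewrite !mxE ffunE.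
have [u Xu0 [i ui]] : exists2 u : 'cV[F]_n, X *m u = 0 & exists i, u i 0 != 0.
  move: XN; rewrite -unitmx_tr -row_free_unit -kermx_eq0 => /rowV0Pn[u /sub_kermxP uX u0].
  exists u^T; first by rewrite -[X]trmxK -trmx_mul uX trmx0.
  apply/existsP; rewrite -negb_forall; apply: contra u0 => /'forall_eqP u0.
  by apply/eqP/rowP => i; rewrite [RHS]mxE -[RHS](u0 i) mxE.
rewrite (partition_big (fun v : {ffun V -> F} => v i / u i 0) predT) //=.
rewrite (eq_bigr (fun=> \sum_(v | Xv v && (v i / u i 0 == 0)) 1)) => [|t _].
  by rewrite sumr_const card_Fp // -[RHS]mulr_natr (pchar_Fp_0 p_prime) mulr0.
pose shift (s : F) (v : {ffun V -> F}) := [ffun j => v j + s * u j 0].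
have shiftK s v : shift (- s) (shift s v) = v.
  by apply/ffunP => j; rewrite !ffunE mulNr addrK.
rewrite (reindex_onto (shift t) (shift (- t))) /= => [|v _]; last first.
  by rewrite -{1}(opprK t) shiftK.
apply: eq_bigl => v; rewrite shiftK eqxx andbT; congr (_ && _).
  rewrite !XvE (_ : \col_j shift t v j = \col_j v j + t *: u).
    by rewrite mulmxDr -scalemxAr Xu0 scaler0 addr0.
  by apply/colP => j; rewrite !mxE ffunE.
by rewrite ffunE mulrDl mulfK // -subr_eq0 addrK.
Qed.

(** * Expansion over the perfect matchings of the enlarged graph *)

Definition perfect (B : {set slot}) :=
  [forall x, (slot_inv x \in B) == (x \in B)] &&
  [forall i, #|[set w | (i, w) \in B]| == 1%N].

(** Formally [- ((b - a) ^ p - b ^ p + a ^ p) / p!]: up to sign, what is left of the divided power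
    of degree [p] of [b - a] when both exponents stay below [p]. *)
Definition big_edge (a b : F) : F :=
  - \sum_(k < p) \sum_(l < p | (k + l == p)%N)
      (-1) ^+ l * (b ^+ k / k`!%:R * (a ^+ l / l`!%:R)).

(** The two exponents of an edge add up to 1 or to [p]. The first case yields the difference; the
    second yields [big_edge] and marks the edges of [B]. *)
Definition edge_factor (B : {set slot}) (v : V -> F) (x : slot) : F :=
  if x \in B then big_edge (v x.1) (v (slot_inv x).1)
  else v x.1 - v (slot_inv x).1.

Let rows_ok (a : {ffun slot -> 'I_p}) :=
  [forall i, (\sum_w a (i, w) \in [:: 0; n])%N].

(** For [k, l < p], the sum over [z] of [z ^+ n.-1 * z ^+ k * (- z) ^+ l]: the condition that [n]
    divides [n - 1 + k + l] leaves only the values 1 and [p] for [k + l]. *)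
Let pair_coef (k l : nat) : F :=
  (-1) ^+ l * (if (k + l \in [:: 1; p])%N then -1 else 0).

Let col_sum (a : {ffun slot -> 'I_p}) : F :=
  \sum_(v : {ffun V -> F}) \prod_x v (slot_inv x).1 ^+ a x.

Lemma slot_mx_skew (xi : {ffun slot -> F}) : odd_slots xi ->
  (slot_mx xi)^T = - slot_mx xi.
Proof.
move=> /'forall_eqP oddxi; apply/matrixP => i j; rewrite !mxE -sumrN.
rewrite (reindex_inj (@slot_inv_inj n)) /=; apply: eq_big => [x|x _].
  by rewrite slot_invK andbC.
by rewrite oddxi.
Qed.

Lemma slot_mx_mulv (xi : {ffun slot -> F}) (v : {ffun V -> F}) i :
  \sum_j slot_mx xi i j * v j = \sum_w xi (i, w) * v (slot_inv (i, w)).1.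
Proof.
under eq_bigr do rewrite mxE big_distrl /=.
rewrite (exchange_big_dep (fun x : slot => x.1 == i)) /=; last by move=> j x _ /andP[].
transitivity (\sum_(x : slot | x.1 == i) xi x * v (slot_inv x).1).
  apply: eq_bigr => x /eqP xi1; rewrite (big_pred1 (slot_inv x).1) // => j.
  by rewrite xi1 eqxx eq_sym.
rewrite (reindex_onto (fun w => (i, w)) snd) /=.
  by apply: eq_bigl => w; rewrite !eqxx.
by case=> j w /eqP /= ->.
Qed.

Lemma sum_odd_slots_exponents (a : {ffun slot -> 'I_p}) :
  \sum_(xi | odd_slots xi) (\prod_(x in slot_half n) xi x ^+ n.-1) *
    \prod_x xi x ^+ a x =
  \prod_(x in slot_half n) pair_coef (a x) (a (slot_inv x)).
Proof.
transitivity (\sum_(xi : {ffun slot -> F} | odd_slots xi)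
   \prod_(x in slot_half n) ((-1) ^+ a (slot_inv x) *
      xi x ^+ (n.-1 + (a x + a (slot_inv x))))).
  apply: eq_bigr => xi /'forall_eqP oddxi.
  rewrite (prod_half _ (@slot_invK n) (slot_half_inv n_even)) -big_split /=.
  apply: eq_bigr => x _; rewrite oddxi (exprNn (xi x)) !exprD !mulrA; congr (_ * _).
  by rewrite mulrC mulrA.
rewrite -(prod_sum_equivariant (@slot_invK n) (slot_half_inv n_even)
  (fun x (z : F) => (-1) ^+ a (slot_inv x) *
      z ^+ (n.-1 + (a x + a (slot_inv x)))) (@opprK F)).
apply: eq_bigr => x _; rewrite -big_distrr /= sum_exprF //; congr (_ * _).
have -> : (0 < n.-1 + (a x + a (slot_inv x)))%N by move: n_gt1; lia.
rewrite !inE /=; case: ifP; case: ifP => //; have := ltn_ord (a x);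
  have := ltn_ord (a (slot_inv x)); move: (val (a x)) (val (a (slot_inv x))) => k l /=.
  move=> lt_l lt_k kl /dvdnP[[|[|[|q]]]]; move: n_gt1; lia.
move=> lt_l lt_k /orP[]/eqP-> /negP[].
  by rewrite addn1 prednK // ltnW.
rewrite (_ : n.-1 + p = n + n)%N ?dvdn_addr //; move: n_gt1; lia.
Qed.

Lemma skew_sum_exponents : skew_sum =
  \sum_(a | rows_ok a) col_sum a * (\prod_x (a x)`!%:R^-1) *
    \prod_(x in slot_half n) pair_coef (a x) (a (slot_inv x)).
Proof.
transitivity (\sum_(xi : {ffun slot -> F} | odd_slots xi)
   (\prod_(x in slot_half n) xi x ^+ n.-1) *
   \sum_(v : {ffun V -> F}) \sum_(a | rows_ok a)
     \prod_x ((xi x * v (slot_inv x).1) ^+ a x / (a x)`!%:R)).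
  apply: eq_bigr => xi oddxi; congr (_ * _).
  transitivity ((slot_mx xi \in unitmx)%:R : F).
    rewrite -(pfaffian_sum_neq0 n_even (two_natF_neq0 p_prime p_odd)).
    - case: eqP => [->|/eqP P0] /=; last by rewrite fermatF.
      by rewrite expr0n; move: n_gt1; case: (n).
    - exact: slot_mx_skew.
    - exact: card_centralizerF_neq0.
  rewrite unitmx_kernel_sum //; apply: eq_bigr => v _.
  under eq_bigr => i _ do rewrite slot_mx_mulv indicator0F //.
  rewrite bigA_distr_big /=.
  pose cur (a : {ffun slot -> 'I_p}) := [ffun i => [ffun w => a (i, w)]].
  pose unc (f : {ffun V -> {ffun V -> 'I_p}}) := [ffun x : slot => f x.1 x.2].
  rewrite (reindex_onto cur unc) /= => [|f _]; last first.
    by apply/ffunP => i; apply/ffunP => w; rewrite !ffunE.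
  apply: eq_big => [a|a _].
    rewrite (_ : unc (cur a) == a) ?andbT; last first.
      by apply/eqP/ffunP => -[i w]; rewrite !ffunE.
    have curE i : (\sum_w cur a i w = \sum_w a (i, w))%N.
      by apply: eq_bigr => w _; rewrite !ffunE.
    by apply/ffun_onP/forallP => ra i; have := ra i; rewrite unfold_in /= curE.
  rewrite pair_big /=; apply: eq_bigr => -[i w] _.
  by rewrite !ffunE.
under eq_bigr do rewrite exchange_big big_distrr /=.
rewrite exchange_big /=; apply: eq_bigr => a _.
rewrite -sum_odd_slots_exponents /col_sum big_distrr /=.
apply: eq_bigr => xi _; rewrite !big_distrl big_distrr /=; apply: eq_bigr => v _.
rewrite mulrCA; congr (_ * _); rewrite -!big_split /=; apply: eq_bigr => x _.
by rewrite exprMn; ring.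
Qed.

Let big_slots (a : {ffun slot -> 'I_p}) := [set x | (a x + a (slot_inv x) == p)%N].

(** Row and column sums at [i] add up to [n + n * b i], where [b i] counts the big slots at [i]. As
    [col_sum] is nonzero, every column sum is a positive multiple of [n]. If the rows are at most
    [n], equality of the totals forces all sums to be [n], so [b i = 1]. Conversely [b i = 1] leaves
    0 or [n] for the row. *)
Lemma rows_ok_perfect (a : {ffun slot -> 'I_p}) :
  col_sum a != 0 ->
  (forall x, a x + a (slot_inv x) \in [:: 1; p])%N ->
  rows_ok a = perfect (big_slots a).
Proof.
move=> col0 pairs.
pose row i := (\sum_w a (i, w))%N; pose col i := (\sum_w a (slot_inv (i, w)))%N.
pose b i := #|[set w | (i, w) \in big_slots a]|.
have rowcol i : (row i + col i = n + n * b i)%N.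
  rewrite /row /col -big_split /=.
  transitivity (\sum_(w < n) (1 + n * ((i, w) \in big_slots a)))%N.
    apply: eq_bigr => w _; have := pairs (i, w); rewrite !inE.
    case: eqP => [->|_] /=; first by have := n_gt1; case: eqP; lia.
    by move=> /eqP->; rewrite eqxx muln1; move: n_gt1; lia.
  rewrite big_split sum1_card card_ord -big_distrr /=; congr (_ + _ * _)%N.
  rewrite /b -sum1_card [RHS]big_mkcond /=; apply: eq_bigr => w _.
  by rewrite [in RHS]inE; case: (_ \in _).
have colP i : (0 < col i)%N && (n %| col i)%N.
  apply: contraR col0 => coli; apply/eqP.
  transitivity (\prod_j \sum_(t : F) t ^+ col j).
    rewrite bigA_distr_bigA; apply: eq_bigr => v _ /=.
    rewrite (reindex_inj (@slot_inv_inj n)) /=.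
    transitivity (\prod_(j < n) \prod_(w < n) v j ^+ a (slot_inv (j, w))).
      by rewrite pair_big; apply: eq_bigr => -[j w] _; rewrite slot_invK.
    by apply: eq_bigr => j _; rewrite prodrXr.
  by rewrite (bigD1 i) //= sum_exprF // (negPf coli) mul0r.
have big_inv : [forall x, (slot_inv x \in big_slots a) == (x \in big_slots a)].
  by apply/forallP => x; rewrite !inE slot_invK addnC.
rewrite /perfect big_inv /= /rows_ok.
have rowE i : row i = (\sum_w a (i, w))%N by [].
apply/forallP/forallP => ok i; last first.
  rewrite -rowE !inE; have /eqP := ok i; rewrite -/(b i) => bi.
  have := rowcol i; have /andP[c0 /dvdnP[q cE]] := colP i.
  rewrite bi muln1; move: c0; rewrite {}cE; case: q => [|[|[|q]]]; move: n_gt1; nia.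
have le_row j : (row j <= n)%N.
  by have := ok j; rewrite -rowE !inE => /orP[]/eqP->.
have le_col j : (n <= col j)%N by have /andP[c0] := colP j; apply: dvdn_leq.
have sum_eq : (\sum_j row j = \sum_j col j)%N.
  rewrite /row /col !pair_big /= [RHS](reindex_inj (@slot_inv_inj n)) /=.
  by apply: eq_bigr => -[j w] _; rewrite /= -surjective_pairing slot_invK.
have rowE' : row i = n.
  apply/eqP; rewrite eqn_leq le_row /= leqNgt; apply/negP => lt_row.
  suff : (\sum_j row j < \sum_j col j)%N by rewrite sum_eq ltnn.
  rewrite (bigD1 i) // [X in (_ < X)%N](bigD1 i) //= -addSn leq_add //.
    exact: leq_trans (le_col i).
  by apply: leq_sum => j _; apply: leq_trans (le_col j).
have colE' : col i = n.
  apply/eqP; rewrite eqn_leq le_col andbT leqNgt; apply/negP => lt_col.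
  suff : (\sum_j row j < \sum_j col j)%N by rewrite sum_eq ltnn.
  rewrite (bigD1 i) // [X in (_ < X)%N](bigD1 i) //= -addSn leq_add //.
    exact: leq_ltn_trans (le_row i) _.
  by apply: leq_sum => j _; apply: leq_trans (le_col j).
have := rowcol i; rewrite rowE' colE' => /addnI/eqP.
by rewrite -[X in X == _]muln1 eqn_pmul2l 1?ltnW // eq_sym.
Qed.

(** Once the row conditions are a condition on the set of edges of exponent [p], the exponents of
    different edges are independent, and the sum over them factors over the edges. *)
Lemma skew_sum_perfect : skew_sum =
  \sum_(B | perfect B) \sum_(v : {ffun V -> F})
    \prod_(x in slot_half n) edge_factor B v x.
Proof.
pose T (v : V -> F) (x : slot) (k l : nat) := v (slot_inv x).1 ^+ k / k`!%:R *
   (v x.1 ^+ l / l`!%:R) * pair_coef k l.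
transitivity (\sum_(a | perfect (big_slots a)) \sum_(v : {ffun V -> F})
   \prod_(x in slot_half n) T v x (a x) (a (slot_inv x))).
  rewrite skew_sum_exponents big_mkcond [RHS]big_mkcond; apply: eq_bigr => a _ /=.
  have -> : \sum_(v : {ffun V -> F})
      \prod_(x in slot_half n) T v x (a x) (a (slot_inv x)) =
      col_sum a * (\prod_x (a x)`!%:R^-1) *
      \prod_(x in slot_half n) pair_coef (a x) (a (slot_inv x)).
    rewrite /col_sum !big_distrl /=; apply: eq_bigr => v _.
    rewrite !(prod_half _ (@slot_invK n) (slot_half_inv n_even)) -!big_split /=.
    by apply: eq_bigr => x _; rewrite /T slot_invK; ring.
  have [->|col0] := eqVneq (col_sum a) 0; first by rewrite !mul0r !if_same.
  have [/forallP pairs|/forallPn[x xpairs]] :=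
      boolP [forall x, (a x + a (slot_inv x) \in [:: 1; p])%N].
    by rewrite rows_ok_perfect.
  suff -> : \prod_(x in slot_half n) pair_coef (a x) (a (slot_inv x)) = 0.
    by rewrite mulr0 !if_same.
  have [xH|xH] := boolP (x \in slot_half n).
    by rewrite (bigD1 x) //= /pair_coef (negPf xpairs) mulr0 mul0r.
  rewrite (bigD1 (slot_inv x)) ?slot_half_inv //= /pair_coef slot_invK addnC.
  by rewrite (negPf xpairs) mulr0 mul0r.
rewrite (partition_big big_slots perfect) //=; apply: eq_bigr => B Bperf.
rewrite exchange_big; apply: eq_bigr => v _ /=.
transitivity (\sum_(a : {ffun slot -> 'I_p}) \prod_(x in slot_half n)
   (T v x (a x) (a (slot_inv x)) *
    ((x \in B) == (a x + a (slot_inv x) == p)%N)%:R)).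
  rewrite big_mkcond; apply: eq_bigr => a _ /=; rewrite [RHS]big_split /=.
  have [/andP[_ /eqP BE]|aN] := ifP.
    by rewrite [X in _ * X]big1 ?mulr1 // => x _; rewrite -BE inE eqxx.
  have [x xB] : exists x, (x \in B) != (a x + a (slot_inv x) == p)%N.
    apply/existsP; apply: contraFT aN; rewrite negb_exists => /forallP BE.
    suff -> : big_slots a = B by rewrite Bperf eqxx.
    by apply/setP => x; rewrite inE; have /negPn/eqP -> := BE x.
  have [xH|xH] := boolP (x \in slot_half n).
    by rewrite [X in _ * X](bigD1 x) //= (negPf xB) mul0r mulr0.
  rewrite [X in _ * X](bigD1 (slot_inv x)) ?slot_half_inv //= slot_invK addnC.
  have /andP[/'forall_eqP Binv _] := Bperf.
  by rewrite Binv (negPf xB) mul0r mulr0.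
rewrite -(prod_sum_pair (@slot_invK n) (slot_half_inv n_even)
  (fun x (k l : 'I_p) => T v x k l * ((x \in B) == (k + l == p)%N)%:R)).
apply: eq_bigr => x xH; rewrite /edge_factor; case: ifP => xB.
  rewrite /big_edge -sumrN; apply: eq_bigr => k _; rewrite -sumrN [RHS]big_mkcond.
  apply: eq_bigr => l _; rewrite /T /pair_coef !inE.
  case: (eqVneq (k + l)%N p) => [_|_]; last by rewrite mulr0.
  by rewrite orbT mulr1; ring.
have p_gt1 := prime_gt1 p_prime.
pose o0 := Ordinal (prime_gt0 p_prime); pose o1 := Ordinal p_gt1.
have zero (k l : 'I_p) : (k + l != 1)%N ->
    T v x k l * (false == (k + l == p)%N)%:R = 0.
  move=> kl; rewrite /T /pair_coef !inE (negPf kl) /=.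
  by case: eqP => _; rewrite !mulr0 ?mul0r.
rewrite (bigD1 o0) //= (bigD1 o1) //= [X in _ + X + _]big1; last first.
  by move=> l lo1; apply: (zero o0 l); rewrite add0n; apply: contraNneq lo1 => l1; apply/eqP/val_inj.
rewrite (bigD1 o1) //= (bigD1 o0) //= [X in _ + (_ + X + _)]big1; last first.
  by move=> l lo0; apply: (zero o1 l); apply: contraNneq lo0; rewrite add1n => -[l0]; apply/eqP/val_inj.
rewrite [X in _ + (_ + X)]big1; last first.
  move=> k /andP[ko0 ko1]; rewrite big1 // => l _; apply: zero.
  by case: k ko0 ko1 => -[|[|k]] lt_k; rewrite -!val_eqE /=; lia.
rewrite /T /pair_coef /= !fact0 (_ : 1`! = 1%N) // addn0 add0n (ltn_eqF p_gt1).
rewrite eqxx !divr1 mulr1n; ring.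
Qed.

Lemma big_edgeNC (a b : F) : big_edge b a = - big_edge a b.
Proof.
rewrite /big_edge; congr (- _).
under eq_bigr do rewrite big_mkcond; under [in RHS]eq_bigr do rewrite big_mkcond.
rewrite exchange_big -sumrN /=; apply: eq_bigr => k _; rewrite -sumrN.
apply: eq_bigr => l _; rewrite addnC; case: eqP => kl; last by rewrite oppr0.
have : odd (k + l) by rewrite kl.
rewrite oddD => klodd.
rewrite -(signr_odd _ k) -(signr_odd _ l) (_ : odd k = ~~ odd l); last first.
  by move: klodd; case: (odd k); case: (odd l).
by rewrite signrN; ring.
Qed.

Lemma edge_factor_inv (B : {set slot}) (v : V -> F) x :
  (forall x, (slot_inv x \in B) = (x \in B)) ->
  edge_factor B v (slot_inv x) = - edge_factor B v x.
Proof.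
move=> Binv; rewrite /edge_factor Binv slot_invK; case: ifP => _.
  exact: big_edgeNC.
by rewrite opprB.
Qed.

Lemma perfect_inv (B : {set slot}) : perfect B ->
  forall x, (slot_inv x \in B) = (x \in B).
Proof. by move=> /andP[/'forall_eqP]. Qed.

Definition off_diag (B : {set slot}) : {set V} := [set i | (i, i) \notin B].

(** The diagonal slots of [slot_half] get the factor 1. Taking [orient] on the diagonal makes the
    function odd under [slot_inv], as needed for [fsgn_half_sign]. *)
Let off_factor (B : {set slot}) (v : V -> F) (x : slot) : F :=
  if x.1 == x.2 then orient F x else edge_factor B v x.

Let off_prod (B : {set slot}) (v : V -> F) : F :=
  \prod_(x in slot_half n) off_factor B v x.

Let diag_prod (W : {set V}) (v : V -> F) : F :=
  \prod_(i in half_set n)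
    (if i \in W then v i - v (rev_ord i) else big_edge (v i) (v (rev_ord i))).

Lemma edge_prod_split B v : \prod_(x in slot_half n) edge_factor B v x =
  off_prod B v * diag_prod (off_diag B) v.
Proof.
rewrite /off_prod (bigID (fun x : slot => x.1 == x.2)) /= mulrC.
rewrite [X in _ = X * _](bigID (fun x : slot => x.1 == x.2)) /=.
rewrite [X in _ = (X * _) * _]big1 ?mul1r; last first.
  by move=> x /andP[xH xd]; rewrite /off_factor xd /orient xH.
congr (_ * _).
  by apply: eq_bigr => x /andP[_ /negPf xd]; rewrite /off_factor xd.
rewrite (reindex_onto (fun i => (i, i)) fst) /=; last first.
  by case=> i j /andP[_ /eqP /= ->].
apply: eq_big => i; first by rewrite inE /= ltnn !eqxx /= !andbT.
move=> _; rewrite /edge_factor !inE /slot_inv /= eqxx.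
by case: ifP.
Qed.

(** * Antisymmetry under the exchange of two vertices *)

Section Swap.
Variables a b : V.
Hypothesis ab : a != b.
Let t := tperm a b.
(** Only the edges of [K_n] are moved. The additional edges stay in place, so that the map commutes
    with [slot_inv]. *)
Let swap_slot (x : slot) : slot := if x.1 == x.2 then x else (t x.1, t x.2).
Let swap_set (B : {set slot}) : {set slot} := [set x | (t x.1, t x.2) \in B].

Let swap_slotK : involutive swap_slot.
Proof.
case=> i j; rewrite /swap_slot /=; case: (eqVneq i j) => [->|ij] /=.
  by rewrite eqxx.
by rewrite (inj_eq perm_inj) (negPf ij) /t !tpermK.
Qed.

Let swap_slot_inv x : swap_slot (slot_inv x) = slot_inv (swap_slot x).
Proof.
case: x => i j; rewrite /swap_slot /slot_inv /=; case: (eqVneq i j) => [->|ij] /=.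
  by rewrite !eqxx.
by rewrite eq_sym (negPf ij) /= (inj_eq perm_inj) (negPf ij).
Qed.

(** Exchanging [a] and [b] in both components is the square of [f \o S], hence even. What remains is
    the transposition of [(a, a)] and [(b, b)] that undoes it on the diagonal. *)
Let fsgn_swap_slot : fsgn F swap_slot = -1.
Proof.
pose S (x : slot) : slot := (x.2, x.1).
have SI : injective S by case=> ? ? [? ?] [-> ->].
pose f := fiber_map (fun _ : V => t : V -> V).
have fE : fsgn F f = 1.
  rewrite fsgn_fiber_map prodr_const card_ord fsgn_perm -signr_odd.
  by rewrite exprAC -signr_odd (negPf n_even) expr1n.
rewrite (@eq_fsgn _ _ _ ((f \o S) \o ((f \o S) \o tperm (a, a) (b, b)))).
  have fSE : fsgn F (f \o S) = fsgn F S by rewrite (fsgn_comp F f S) fE mul1r.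
  rewrite (fsgn_comp F (f \o S)) (fsgn_comp F (f \o S) (tperm _ _)) fSE mulrA.
  rewrite -expr2 (fsgn_sqr F SI) mul1r fsgn_perm.
  have neq : (a, a) != (b, b) by rewrite xpair_eqE (negPf ab).
  by rewrite odd_tperm neq.
case=> i j; rewrite /swap_slot /f /S /fiber_map /=.
case: (eqVneq i j) => [<-|ij] /=.
  case: (eqVneq i a) => [->|ia]; first by rewrite tpermL /= /t tpermR.
  case: (eqVneq i b) => [->|ib]; first by rewrite tpermR /= /t tpermL.
  by rewrite !tpermD ?xpair_eqE ?[_ == i]eq_sym ?(negPf ia) ?(negPf ib) //= /t tpermD // eq_sym.
rewrite tpermD //; apply: contra ij; rewrite xpair_eqE => /andP[/eqP <- /eqP <-] //.
Qed.

Let swap_setP B : a \in off_diag B -> b \in off_diag B -> forall i,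
  ((t i, t i) \in B) = ((i, i) \in B).
Proof.
rewrite !inE => aB bB i; rewrite /t; case: tpermP => [->|->|//].
  by rewrite (negPf aB) (negPf bB).
by rewrite (negPf aB) (negPf bB).
Qed.

Let off_prod_swap B v : perfect B -> a \in off_diag B -> b \in off_diag B ->
  off_prod B (fun i => v (t i)) = - off_prod (swap_set B) v.
Proof.
move=> Bperf aB bB; have Binv := perfect_inv Bperf.
have Sinv x : (slot_inv x \in swap_set B) = (x \in swap_set B).
  rewrite !inE; case: x => i j; rewrite /slot_inv /=.
  case: (eqVneq i j) => [->|ij] /=.
    by rewrite !swap_setP // -Binv /slot_inv /= eqxx rev_ordK.
  by rewrite -Binv /slot_inv /= (inj_eq perm_inj) eq_sym (negPf ij).
transitivity (\prod_(x in slot_half n) off_factor (swap_set B) v (swap_slot x)).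
  apply: eq_bigr => x _; rewrite /off_factor.
  have -> : ((swap_slot x).1 == (swap_slot x).2) = (x.1 == x.2).
    rewrite /swap_slot; case: ifP => //= xd; by rewrite (inj_eq perm_inj).
  case: ifP => xd; first by rewrite /swap_slot xd.
  rewrite /edge_factor -swap_slot_inv inE.
  have x1 : (swap_slot x).1 = t x.1 by rewrite /swap_slot xd.
  have x2 : (swap_slot x).2 = t x.2 by rewrite /swap_slot xd.
  have ix1 : (swap_slot (slot_inv x)).1 = t (slot_inv x).1.
    by rewrite /swap_slot /slot_inv xd /= eq_sym xd.
  by rewrite ix1 x1 x2 /t !tpermK -surjective_pairing.
rewrite (fsgn_half_sign (@slot_invK n) (slot_half_inv n_even)); last 3 first.
- exact: inv_inj swap_slotK.
- exact: swap_slot_inv.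
- move=> x; rewrite /off_factor edge_factor_inv // orient_inv //.
  have -> : ((slot_inv x).1 == (slot_inv x).2) = (x.1 == x.2).
    case: x => i j; rewrite /slot_inv /=; case: (eqVneq i j) => [->|ij] /=.
      by rewrite eqxx.
    by rewrite eq_sym (negPf ij).
  by case: ifP.
by rewrite fsgn_swap_slot mulN1r.
Qed.

Let swap_set_perfect B : perfect B -> a \in off_diag B -> b \in off_diag B ->
  perfect (swap_set B) && (off_diag (swap_set B) == off_diag B).
Proof.
move=> Bperf aB bB; have Binv := perfect_inv Bperf.
have -> : off_diag (swap_set B) == off_diag B.
  by apply/eqP/setP => i; rewrite !inE /= swap_setP.
rewrite andbT; apply/andP; split.
  apply/forallP => x; apply/eqP; rewrite !inE; case: x => i j; rewrite /slot_inv /=.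
  case: (eqVneq i j) => [->|ij] /=.
    by rewrite !swap_setP // -Binv /slot_inv /= eqxx rev_ordK.
  by rewrite -Binv /slot_inv /= (inj_eq perm_inj) eq_sym (negPf ij).
apply/forallP => i; have /andP[_ /forallP/(_ (t i))] := Bperf.
rewrite -(card_preimset _ (@perm_inj _ t)); congr (_ == _).
by apply: eq_card => w; rewrite !inE.
Qed.

Let swap_setK : involutive swap_set.
Proof. by move=> B; apply/setP => -[i j]; rewrite !inE /t !tpermK. Qed.

Lemma off_sum_swap (W : {set V}) (v : {ffun V -> F}) : a \in W -> b \in W ->
  \sum_(B | perfect B && (off_diag B == W)) off_prod B [ffun i => v (tperm a b i)] =
  - \sum_(B | perfect B && (off_diag B == W)) off_prod B v.
Proof.
move=> aW bW; rewrite -sumrN [RHS](reindex_inj (inv_inj swap_setK)) /=.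
apply: eq_big => [B|B /andP[Bperf /eqP BW]]; last first.
  rewrite -off_prod_swap ?BW //; apply: eq_bigr => x _.
  by rewrite /off_factor /edge_factor !ffunE.
have imp C : perfect C && (off_diag C == W) ->
    perfect (swap_set C) && (off_diag (swap_set C) == W).
  case/andP=> Cp /eqP CW; rewrite -CW; apply: swap_set_perfect => //; by rewrite CW.
by apply/idP/idP => /imp //; rewrite swap_setK.
Qed.

End Swap.

Lemma vanishing_sum (W : {set V}) (c d : V) (f : {ffun V -> F} -> F) :
  c \in W -> d \in W -> c != d ->
  (forall v : {ffun V -> F}, f [ffun i => v (tperm c d i)] = f v) ->
  \sum_(v : {ffun V -> F})
    (\sum_(B | perfect B && (off_diag B == W)) off_prod B v) * f v = 0.
Proof.
move=> cW dW cd fE; set S := \sum_(v : {ffun _}) _.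
have SN : S = - S.
  pose h (v : {ffun V -> F}) := [ffun i => v (tperm c d i)].
  have hK : involutive h by move=> v; apply/ffunP => i; rewrite !ffunE tpermK.
  rewrite {1}/S (reindex_inj (inv_inj hK)) /= -sumrN; apply: eq_bigr => v _.
  by rewrite off_sum_swap // fE mulNr.
apply/eqP; have /eqP := SN; rewrite -addr_eq0 -mulr2n -mulr_natl mulf_eq0.
by rewrite (negPf (two_natF_neq0 p_prime p_odd)).
Qed.

(** A monomial [v c * v d] of [(v a - v (rev_ord a)) * (v b - v (rev_ord b))] involves neither
    [rev_ord c] nor [rev_ord d]. It is therefore symmetric under their exchange, while the sum over
    [B] is antisymmetric. *)
Lemma bad_sum (W : {set V}) (a b : V) :
  (forall i, (rev_ord i \in W) = (i \in W)) -> a \in W -> b \in W ->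
  b != a -> b != rev_ord a ->
  \sum_(v : {ffun V -> F})
    (\sum_(B | perfect B && (off_diag B == W)) off_prod B v) * diag_prod W v = 0.
Proof.
move=> Wrev.
wlog aH : a / a \in half_set n => [wl aW bW ba bra|].
  have [aH|aH] := boolP (a \in half_set n); first exact: (wl a).
  by apply: (wl (rev_ord a)); rewrite ?half_set_rev ?Wrev ?rev_ordK.
wlog bH : b / b \in half_set n => [wl aW bW ba bra|aW bW ba bra].
  have [bH|bH] := boolP (b \in half_set n); first exact: (wl b).
  apply: (wl (rev_ord b)); rewrite ?half_set_rev ?Wrev //.
    by rewrite -(inj_eq rev_ord_inj) rev_ordK.
  by rewrite (inj_eq rev_ord_inj).
pose rest (v : {ffun V -> F}) := \prod_(i in half_set n | (i != a) && (i != b))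
    (if i \in W then v i - v (rev_ord i) else big_edge (v i) (v (rev_ord i))).
pose h (v : {ffun V -> F}) := \sum_(B | perfect B && (off_diag B == W)) off_prod B v.
have zero c d : (c == a) || (c == rev_ord a) -> (d == b) || (d == rev_ord b) ->
    \sum_(v : {ffun V -> F}) h v * (v c * v d * rest v) = 0.
  move=> ca db.
  have cW : rev_ord c \in W by rewrite Wrev; case/orP: ca => /eqP->; rewrite ?Wrev.
  have dW : rev_ord d \in W by rewrite Wrev; case/orP: db => /eqP->; rewrite ?Wrev.
  have rba : rev_ord b != a by rewrite -(inj_eq rev_ord_inj) rev_ordK.
  have rbra : rev_ord b != rev_ord a by rewrite (inj_eq rev_ord_inj).
  have cd : c != d.
    by case/orP: ca => /eqP->; case/orP: db => /eqP->; rewrite eq_sym.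
  have crd : rev_ord c != d.
    by case/orP: ca => /eqP->; case/orP: db => /eqP->; rewrite ?rev_ordK eq_sym.
  apply: (vanishing_sum (f := fun v => v c * v d * rest v) cW dW).
    by rewrite (inj_eq rev_ord_inj).
  move=> v; rewrite !ffunE; congr (_ * _ * _).
  - by rewrite tpermD ?rev_ord_neq // -(inj_eq rev_ord_inj) rev_ordK eq_sym.
  - by rewrite tpermD ?rev_ord_neq.
  apply: eq_bigr => i /and3P[iH ia ib].
  have ira : i != rev_ord a by apply: contraTneq iH => ->; rewrite half_set_rev // aH.
  have irb : i != rev_ord b by apply: contraTneq iH => ->; rewrite half_set_rev // bH.
  have fix_i j : j \in [:: a; rev_ord a; b; rev_ord b] -> (j != i) && (j != rev_ord i).
    have ria : rev_ord i != a by rewrite -(inj_eq rev_ord_inj) rev_ordK.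
    have rib : rev_ord i != b by rewrite -(inj_eq rev_ord_inj) rev_ordK.
    rewrite !inE => /or4P[] /eqP->; rewrite 1?[_ == i]eq_sym 1?[_ == rev_ord i]eq_sym
      ?(inj_eq rev_ord_inj); exact/andP.
  have /andP[ci cri] : (rev_ord c != i) && (rev_ord c != rev_ord i).
    by apply: fix_i; case/orP: ca => /eqP->; rewrite ?rev_ordK !inE eqxx ?orbT.
  have /andP[di dri] : (rev_ord d != i) && (rev_ord d != rev_ord i).
    by apply: fix_i; case/orP: db => /eqP->; rewrite ?rev_ordK !inE eqxx ?orbT.
  by rewrite !ffunE !tpermD.
transitivity (\sum_(v : {ffun V -> F}) (h v * (v a * v b * rest v)
   - h v * (v a * v (rev_ord b) * rest v) - h v * (v (rev_ord a) * v b * rest v)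
   + h v * (v (rev_ord a) * v (rev_ord b) * rest v))).
  apply: eq_bigr => v _; rewrite -/(h v).
  have -> : diag_prod W v = (v a - v (rev_ord a)) * ((v b - v (rev_ord b)) * rest v).
    rewrite /diag_prod (bigD1 a) //= aW (bigD1 b) /= ?bH // bW; congr (_ * (_ * _)).
    by apply: eq_bigl => i; rewrite andbA.
  move: (h v) (rest v) (v a) (v b) (v (rev_ord a)) (v (rev_ord b)) => *; ring.
by rewrite big_split !sumrB /= !zero ?eqxx ?orbT ?subrr ?addr0.
Qed.

Definition diag_set : {set slot} := [set x | x.1 == x.2].

(** The additional edges, except that the one at [a] is replaced by the parallel edge of [K_n]. *)
Let diag_swap (a : V) : {set slot} :=
  [set x | if (x.1 == a) || (x.1 == rev_ord a) then x.2 == rev_ord x.1 else x.1 == x.2].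

Let no_bad (W : {set V}) :=
  [forall a in W, forall b in W, (b == a) || (b == rev_ord a)].

Let perfect_diag_set : perfect diag_set.
Proof.
apply/andP; split; [apply/forallP => -[i j]|apply/forallP => i].
  rewrite !inE /slot_inv /=; case: (eqVneq i j) => [->|ij] /=; first by rewrite eqxx.
  by rewrite [j == i]eq_sym (negPf ij).
apply/eqP; rewrite -(cards1 i); apply: eq_card => w.
by rewrite !inE eq_sym.
Qed.

Let perfect_diag_swap a : perfect (diag_swap a).
Proof.
apply/andP; split; [apply/forallP => -[i j]|apply/forallP => i]; last first.
  apply/eqP; have [ia|ia] := boolP ((i == a) || (i == rev_ord a)).
    rewrite -(cards1 (rev_ord i)); apply: eq_card => w.
    by rewrite !inE /= ia.
  rewrite -(cards1 i); apply: eq_card => w.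
  by rewrite !inE /= (negPf ia) eq_sym.
have ra k : (rev_ord k == a) = (k == rev_ord a).
  by rewrite -(inj_eq rev_ord_inj) rev_ordK.
rewrite !inE /slot_inv /=; case: (eqVneq i j) => [->|ij] /=.
  by rewrite ra (inj_eq rev_ord_inj) orbC eqxx (inj_eq rev_ord_inj) eqxx.
rewrite [j == i]eq_sym (negPf ij); apply/eqP.
have [->|jri] := eqVneq j (rev_ord i).
  by rewrite rev_ordK eqxx ra (inj_eq rev_ord_inj) orbC; case: ifP.
rewrite if_same (_ : (i == rev_ord j) = false) ?if_same //.
by apply: contraNF jri => /eqP->; rewrite rev_ordK.
Qed.

(** If [off_diag B] lies in one mirror pair, all other vertices are matched by additional edges, so
    the vertices of this pair can only be matched to each other. *)
Lemma no_bad_perfect B : perfect B && no_bad (off_diag B) =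
  (B \in diag_set |: [set diag_swap a | a in half_set n]).
Proof.
rewrite in_setU1; apply/andP/orP => [[Bp nb]|]; last first.
  case=> [/eqP->|/imsetP[a aH ->]].
    split=> //; apply/forall_inP => a; by rewrite !inE eqxx.
  split=> //; have offE i : i \in off_diag (diag_swap a) -> (i == a) || (i == rev_ord a).
    by rewrite !inE /=; case: ((i == a) || _); rewrite ?eqxx.
  apply/forall_inP => i /offE ia; apply/forall_inP => j /offE ja.
  by case/orP: ia => /eqP->; case/orP: ja => /eqP->; rewrite ?rev_ordK eqxx ?orbT.
have Binv := perfect_inv Bp; have /andP[_ /forallP Buniq] := Bp.
have uniqB i w w' : (i, w) \in B -> (i, w') \in B -> w = w'.
  move=> wB w'B; have /cards1P[u uE] := Buniq i.
  have : w \in [set w | (i, w) \in B] by rewrite inE.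
  have : w' \in [set w | (i, w) \in B] by rewrite inE.
  by rewrite uE !in_set1 => /eqP-> /eqP->.
have exB i : exists w, (i, w) \in B.
  have /cards1P[u uE] := Buniq i; exists u.
  by have := set11 u; rewrite -uE inE.
have eqB C : perfect C -> (forall x, x \in C -> x \in B) -> B = C.
  move=> Cp CB; apply/setP => -[i j]; apply/idP/idP => [ijB|]; last exact: CB.
  have /andP[_ /forallP/(_ i)/cards1P[u uE]] := Cp.
  have iuC : (i, u) \in C by have := set11 u; rewrite -uE inE.
  by rewrite (uniqB i j u) // CB.
have [W0|[a aW]] := set_0Vmem (off_diag B).
  left; apply/eqP/eqB => // -[i j]; rewrite inE /= => /eqP <-.
  by apply/negPn; have := in_set0 i; rewrite -W0 inE => ->.
right.
have Wrev i : (rev_ord i \in off_diag B) = (i \in off_diag B).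
  by rewrite !inE -Binv /slot_inv /= eqxx rev_ordK.
wlog aH : a aW / a \in half_set n => [wl|].
  have [aH|aH] := boolP (a \in half_set n); first exact: (wl a).
  by apply: (wl (rev_ord a)); rewrite ?Wrev ?half_set_rev.
apply/imsetP; exists a => //; apply: eqB => // -[i j]; rewrite inE /=.
have inW k : k \in off_diag B -> (k == a) || (k == rev_ord a).
  by move/forall_inP: nb => /(_ a aW)/forall_inP/(_ k).
have pair k : k \in off_diag B -> (k, rev_ord k) \in B.
  move=> kW; have [w kwB] := exB k.
  have wk : w != k.
    by apply/eqP => wEk; move: kW; rewrite inE -{2}wEk kwB.
  have wW : w \in off_diag B.
    rewrite inE; apply: contra (wk) => wwB.
    have : (w, k) \in B by rewrite -Binv /slot_inv /= (negPf wk).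
    by move/(uniqB _ _ _ wwB) => ->.
  have := inW _ kW; have := inW _ wW; case/orP=> /eqP wE; case/orP=> /eqP kE.
  - by rewrite wE kE eqxx in wk.
  - by rewrite (_ : rev_ord k = w) // kE rev_ordK wE.
  - by rewrite (_ : rev_ord k = w) // kE wE.
  - by rewrite wE kE eqxx in wk.
case: ifP => [ia /eqP->|iN /eqP<-].
  by apply: pair; case/orP: ia => /eqP->; rewrite ?Wrev.
by apply/negPn; apply: contraFN iN => iW; apply: inW; rewrite inE.
Qed.

Lemma card_no_bad : #|diag_set |: [set diag_swap a | a in half_set n]| = n./2.+1.
Proof.
rewrite cardsU1 card_in_imset ?card_half_set //; last first.
  move=> a b aH bH eab.
  have : (a, rev_ord a) \in diag_swap b by rewrite -eab inE /= !eqxx.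
  rewrite inE /=; case: ifP => [/orP[/eqP //|/eqP ab _]|_ /eqP/esym/eqP].
    by move: aH; rewrite ab half_set_rev // bH.
  by rewrite (negPf (rev_ord_neq n_even a)).
rewrite (_ : diag_set \notin _) //; apply/imsetP => -[a _ eD].
have : (a, a) \in diag_swap a by rewrite -eD inE.
by rewrite inE /= eqxx eq_sym (negPf (rev_ord_neq n_even a)).
Qed.

(** The two parallel edges between [a] and [rev_ord a] exchange their factors. *)
Lemma edge_prod_diag_swap a (v : V -> F) : a \in half_set n ->
  \prod_(x in slot_half n) edge_factor (diag_swap a) v x =
  \prod_(x in slot_half n) edge_factor diag_set v x.
Proof.
move=> aH; have ra := rev_ord_neq n_even a.
have d1 : (a, a) \in slot_half n by rewrite inE /= eqxx aH orbT.
have d2 : (a, rev_ord a) \in slot_half n.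
  by rewrite slot_halfE // /slot_inv /= eq_sym (negPf ra); move: d1;
    rewrite slot_halfE // /slot_inv /= eqxx.
have d12 : (a, rev_ord a) != (a, a) by rewrite xpair_eqE (negPf ra) andbF.
rewrite (bigD1 (a, a)) //= (bigD1 (a, rev_ord a)) ?d2 //=.
rewrite [RHS](bigD1 (a, a)) //= [in RHS](bigD1 (a, rev_ord a)) ?d2 //= !mulrA.
congr (_ * _).
  rewrite /edge_factor !inE /slot_inv /= !eqxx /= [a == rev_ord a]eq_sym (negPf ra) /=.
  by rewrite mulrC.
apply: eq_bigr => -[i j] /andP[/andP[ijH n1] n2].
rewrite /edge_factor !inE /=.
suff -> : (if (i == a) || (i == rev_ord a) then j == rev_ord i else i == j) = (i == j) by [].
case: (eqVneq i a) n1 n2 ijH => [->|ia] /=.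
  by rewrite !xpair_eqE eqxx /= => n1 n2 _; rewrite (negPf n2) eq_sym (negPf n1).
case: (eqVneq i (rev_ord a)) => [->|//] _ _; rewrite rev_ordK => ijH.
have [ja|ja] := eqVneq j a.
  move: ijH; rewrite ja inE /= (negPf ra) orbF; move: d2; rewrite inE /= eq_sym (negPf ra) orbF.
  by move=> lt1 /(ltn_trans lt1); rewrite ltnn.
apply/esym/negbTE/eqP => ji; move: ijH; rewrite -ji inE /= ltnn eqxx /=.
by rewrite half_set_rev // aH.
Qed.

Lemma skew_sum_diag : skew_sum =
  n./2.+1%:R * \sum_(v : {ffun V -> F}) \prod_(x in slot_half n) edge_factor diag_set v x.
Proof.
rewrite skew_sum_perfect // (bigID (fun B => no_bad (off_diag B))) /=.
rewrite [X in _ + X](_ : _ = 0) ?addr0.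
  rewrite (eq_bigl _ _ no_bad_perfect) -card_no_bad mulr_natl -sumr_const.
  apply: eq_bigr => B; rewrite in_setU1 => /orP[/eqP->//|/imsetP[a aH ->]].
  by apply: eq_bigr => v _; apply: edge_prod_diag_swap.
rewrite (partition_big off_diag (fun W => ~~ no_bad W)) => [|B /andP[]//].
rewrite big1 // => W bad.
transitivity (\sum_(v : {ffun V -> F})
    (\sum_(B | perfect B && (off_diag B == W)) off_prod B v) * diag_prod W v).
  rewrite (eq_bigl (fun B => perfect B && (off_diag B == W))) => [|B]; last first.
    by case: eqP => [->|_]; rewrite ?andbF // bad !andbT.
  rewrite exchange_big; apply: eq_bigr => v _; rewrite big_distrl /=.
  by apply: eq_bigr => B /andP[_ /eqP <-]; apply: edge_prod_split.
have [Wrev|WN] := boolP [forall i, (rev_ord i \in W) == (i \in W)]; last first.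
  rewrite big1 // => v _; rewrite big_pred0 ?mul0r // => B.
  apply: contraNF WN => /andP[Bp /eqP <-]; apply/forallP => i.
  by rewrite !inE -(perfect_inv Bp) /slot_inv /= eqxx rev_ordK.
move: bad => /forall_inPn[a aW /forall_inPn[b bW]]; rewrite negb_or => /andP[ba bra].
by apply: (@bad_sum W a b) => // i; apply/eqP; move/forallP: Wrev.
Qed.

(** * Evaluation of the surviving term *)

Lemma fact_mul_factF s : (s <= n)%N ->
  s`!%:R * (n - s)`!%:R = (-1) ^+ s.+1 :> F.
Proof.
elim: s => [_|s IHs lt_sn]; first by rewrite subn0 mul1r fact_predF.
have nsE : ((n - s) = (n - s.+1).+1)%N by lia.
have := IHs (ltnW lt_sn); rewrite nsE !factS !natrM -nsE => E.
have nsF : (n - s)%:R = - s.+1%:R :> F.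
  by rewrite natrB 1?ltnW // natF_pred // -natr1 opprD addrC.
rewrite [in RHS]exprS -E nsF; ring.
Qed.

Definition mixed_moment (s t : nat) : F :=
  \sum_(a : F) \sum_(b : F) a ^+ s * b ^+ t * big_edge a b.

(** Summing over [a] and [b] extracts the monomial with [l = n - i] and [k = n - j]. The condition
    [k + l = p] then says that [j = n - 1 - i], which is [rev_ord i]. *)
Lemma mixed_momentE (i j : V) :
  mixed_moment i j = if j == rev_ord i then i.+1%:R^-1 else 0.
Proof.
have p_gt0 := prime_gt0 p_prime; have pE : p = n.+1 by rewrite prednK.
pose c (k l : nat) : F := - ((-1) ^+ l / (k`!%:R * l`!%:R)).
pose m i l : F := if (i + l == n)%N then -1 else 0.
transitivity (\sum_(k < p) \sum_(l < p | (k + l == p)%N) c k l * (m i l * m j k)).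
  transitivity (\sum_(u : F * F) \sum_(k < p) \sum_(l < p | (k + l == p)%N)
      c k l * (u.1 ^+ (i + l) * u.2 ^+ (j + k))).
    rewrite /mixed_moment pair_bigA; apply: eq_bigr => -[a b] _ /=.
    rewrite mulrN big_distrr -sumrN; apply: eq_bigr => k _ /=.
    rewrite big_distrr -sumrN; apply: eq_bigr => l _ /=.
    by rewrite /c !exprD invfM; ring.
  rewrite exchange_big; apply: eq_bigr => k _ /=.
  rewrite exchange_big; apply: eq_bigr => l /eqP kl /=.
  rewrite -big_distrr; congr (_ * _).
  transitivity ((\sum_(a : F) a ^+ (i + l)) * \sum_(b : F) b ^+ (j + k)).
    by rewrite big_distrlr pair_bigA.
  have mE (i0 : V) (k0 l0 : 'I_p) : (k0 + l0 = p)%N ->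
      (\sum_(a : F) a ^+ (i0 + l0)) = m i0 l0.
    move=> kl0; rewrite sum_exprF // /m; have := ltn_ord i0; have := ltn_ord k0.
    move=> lt_k lt_i; have l_gt0 : (0 < l0)%N by lia.
    rewrite addn_gt0 l_gt0 orbT /=; have lt_l := ltn_ord l0.
    case: eqP => [->|ne]; first by rewrite dvdnn.
    case: ifP => // /dvdnP[q qE]; case: q qE => [|[|q]] qE.
    - by move: l_gt0; rewrite mul0n in qE; move/eqP: qE; rewrite addn_eq0 => /andP[_ /eqP->].
    - by case: ne; rewrite qE mul1n.
    have := leq_mul (isT : (2 <= q.+2)%N) (leqnn n); rewrite -qE; lia.
  by rewrite (mE i k l) // (mE j l k) // addnC.
case: eqP => [jE|jN]; last first.
  rewrite big1 // => k _; rewrite big1 // => l /eqP kl; rewrite /m.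
  case: eqP => [il|_]; last by rewrite mul0r mulr0.
  case: eqP => [jk|_]; last by rewrite !mulr0.
  by case: jN; apply/val_inj => /=; have := ltn_ord i; lia.
have ltk : (i.+1 < p)%N by have := ltn_ord i; lia.
have ltl : (n - i < p)%N by lia.
have lt_in := ltn_ord i.
have jv : (j = n - i.+1 :> nat)%N by rewrite jE.
rewrite (bigD1 (Ordinal ltk)) //= [X in _ + X]big1 ?addr0; last first.
  move=> k kN; rewrite big1 // => l _; rewrite /m [in X in _ * (_ * X)]ifF ?mulr0 //.
  apply: contraNF kN => /eqP jk; apply/eqP/val_inj => /=; lia.
rewrite (big_pred1 (Ordinal ltl)) => [|l]; last first.
  by rewrite /= -val_eqE /=; apply/eqP/eqP; lia.
rewrite /m /= subnKC ?(ltnW lt_in) // eqxx (_ : (j + i.+1 == n)%N); last by apply/eqP; lia.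
rewrite mulrNN !mulr1 /c factS natrM -mulrA fact_mul_factF ?(ltnW lt_in) //.
have -> : (-1) ^+ (n - i) = (-1) ^+ i :> F.
  rewrite -signr_odd oddB ?(ltnW lt_in) // (negPf n_even) addFb signr_odd //.
have i0 : i.+1%:R != 0 :> F by apply: small_natF_neq0 => //; rewrite ltk.
have s0 : (-1) ^+ i != 0 :> F by rewrite signr_eq0.
rewrite exprS; move: i.+1%:R i0 ((-1) ^+ i) s0 => x x0 y y0.
by field; rewrite x0 y0 oppr_eq0 oner_eq0.
Qed.

Lemma vandermonde_diff (v : V -> F) :
  \prod_(x in slot_half n | x.1 != x.2) (v x.1 - v x.2) =
  (-1) ^+ n./2 * \det (Vandermonde n (\row_i v i)).
Proof.
pose D : {set slot} := [set x in slot_half n | x.1 == x.2].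
have cardD : #|D| = n./2.
  rewrite -(card_half_set n_even) -(card_imset _ (_ : injective (fun i : V => (i, i)))).
    apply: eq_card => -[i j]; rewrite !inE /=; apply/andP/imsetP.
      move=> [+ /eqP ij]; rewrite -ij ltnn eqxx /= => iH.
      by exists i => //; rewrite inE.
    by move=> [k]; rewrite inE => kH [-> ->]; rewrite ltnn eqxx.
  by move=> i j [].
have cardN : #|[set x in slot_half n | x.1 != x.2]| = (n * n./2 - n./2)%N.
  have := cardsID [set x : slot | x.1 == x.2] (slot_half n).
  rewrite (card_slot_half n_even) (_ : _ :&: _ = D); last by apply/setP => x; rewrite !inE.
  rewrite cardD => <-; rewrite addKn; apply: eq_card => x.
  by rewrite !inE andbC.
transitivity (\prod_(x in slot_half n | x.1 != x.2) (-1 * (v x.2 - v x.1))).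
  by apply: eq_bigr => x _; rewrite mulN1r opprB.
rewrite big_split /=; congr (_ * _).
  rewrite (eq_bigl (mem [set x in slot_half n | x.1 != x.2])) => [|x]; last first.
    by rewrite !inE.
  rewrite prodr_const cardN.
  have le_h : (n./2 <= n * n./2)%N by rewrite leq_pmull // ltnW.
  by rewrite -[LHS]signr_odd oddB // oddM (negPf n_even) addFb signr_odd.
rewrite det_Vandermonde pair_big_dep /=; apply: eq_big => [[i j]|x _].
  rewrite inE /=; case: (ltngtP i j) => [lt|lt|/val_inj->]; rewrite ?eqxx ?andbF //=.
  - by rewrite -val_eqE ltn_eqF.
  - by rewrite -val_eqE gtn_eqF.
by rewrite !mxE.
Qed.

Lemma prod_half_inv_succ :
  \prod_(i in half_set n) (i.+1%:R)^-1 = (n./2)`!%:R^-1 :> F.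
Proof.
transitivity (\prod_(i < n | (i < n./2)%N) (i.+1%:R)^-1 : F).
  by apply: eq_bigl => i; rewrite inE.
have le_h : (n./2 <= n)%N by move: (n./2) (half_double n_even); lia.
rewrite -(big_ord_widen n (fun i => (i.+1%:R)^-1 : F) le_h).
elim: (n./2) => [|m IHm]; first by rewrite big_ord0 fact0 invr1.
by rewrite big_ord_recr /= IHm factS natrM invfM mulrC.
Qed.

(** The edges of [K_n] give a Vandermonde determinant, and the additional edges couple [v i] with
    [v (rev_ord i)], so only the permutations [s] commuting with [rev_ord] survive. They contribute
    equally, because [1 / (v + 1)] is odd under [rev_ord] in [F]: [n - v = - (v + 1)]. The factor
    [(n/2)!] in their number cancels. *)
Lemma diag_term :
  \sum_(v : {ffun V -> F}) \prod_(x in slot_half n) edge_factor (diag_set) v x =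
  (- 2%:R) ^+ n./2.
Proof.
transitivity (\sum_(v : {ffun V -> F}) (-1) ^+ n./2 * \sum_(s : 'S_n)
    (-1) ^+ s * \prod_(i in half_set n)
     (v i ^+ s i * v (rev_ord i) ^+ s (rev_ord i) * big_edge (v i) (v (rev_ord i)))).
  apply: eq_bigr => v _; rewrite (bigID (fun x : slot => x.1 != x.2)) /=.
  transitivity ((\prod_(x in slot_half n | x.1 != x.2) (v x.1 - v x.2)) *
     \prod_(i in half_set n) big_edge (v i) (v (rev_ord i))).
    congr (_ * _).
      apply: eq_bigr => x /andP[_ /negPf xd].
      by rewrite /edge_factor inE xd /slot_inv xd.
    rewrite (reindex_onto (fun i => (i, i)) fst) /=; last first.
      by case=> i j /andP[_]; rewrite negbK => /eqP /= ->.
    apply: eq_big => i; first by rewrite inE /= ltnn !eqxx /= !andbT.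
    by move=> _; rewrite /edge_factor inE /slot_inv /= eqxx.
  rewrite vandermonde_diff -mulrA; congr (_ * _).
  rewrite -det_tr /determinant big_distrl /=; apply: eq_bigr => s _.
  rewrite -mulrA; congr (_ * _).
  rewrite (prod_half _ (@rev_ordK n) (half_set_rev n_even)) -big_split /=.
  by apply: eq_bigr => i _; rewrite !mxE.
rewrite -big_distrr /= exchange_big /=.
transitivity ((-1) ^+ n./2 * \sum_(s in rev_centralizer n) (n./2)`!%:R^-1 : F).
  congr (_ * _); rewrite [RHS]big_mkcond; apply: eq_bigr => s _.
  rewrite -big_distrr /=.
  transitivity ((-1) ^+ s * \prod_(i in half_set n)
      mixed_moment (s i) (s (rev_ord i))).
    congr (_ * _).
    by rewrite -(prod_sum_pair (@rev_ordK n) (half_set_rev n_even)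
      (fun i (a b : F) => a ^+ s i * b ^+ s (rev_ord i) * big_edge a b)).
  case: ifPn => [|sN].
    rewrite inE => /'forall_eqP sC.
    transitivity ((-1) ^+ s * \prod_(i in half_set n) ((s i).+1%:R^-1 : F)).
      by congr (_ * _); apply: eq_bigr => i _; rewrite mixed_momentE sC eqxx.
    have revK : involutive (@rev_ord n) := @rev_ordK n.
    rewrite (perm_half_sign revK (half_set_rev n_even)
      (theta := fun v : V => (v.+1%:R)^-1 : F) sC) => [|v].
      by rewrite mulrA -expr2 sqrr_sign mul1r prod_half_inv_succ.
    rewrite /= subnSK // natrB 1?ltnW // natF_pred // -invrN -opprD.
    by rewrite -natr1 addrC.
  have [i iH si] : exists2 i, i \in half_set n & s (rev_ord i) != rev_ord (s i).
    apply/exists_inP; apply: contraR sN; rewrite negb_exists_in => /forall_inP sr.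
    rewrite inE; apply/'forall_eqP => v; have [vH|vH] := boolP (v \in half_set n).
      by apply/eqP; rewrite -[_ == _]negbK sr.
    have := sr (rev_ord v); rewrite half_set_rev // vH => /(_ isT).
    by rewrite negbK rev_ordK => /eqP ->; rewrite rev_ordK.
  by rewrite (bigD1 i) //= mixed_momentE (negPf si) mul0r mulr0.
rewrite sumr_const card_rev_centralizer // -[_ *+ (2 ^ _ * _)]mulr_natr natrM natrX.
have f0 : (n./2)`!%:R != 0 :> F.
  by apply: factF_neq0 => //; have := prime_gt0 p_prime; move: (n./2) (half_double n_even); lia.
by rewrite [X in _ * X]mulrC mulfK // -exprMn mulN1r.
Qed.

End SkewSum.

(** * Crossings of a matching and the sign of a permutation listing it *)

Section CrossingSign.
Local Open Scope ring_scope.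
Variable n : nat.
Hypothesis n_even : ~~ odd n.
Local Notation V := 'I_n.

Let order_sign (q : 'S_n) (i j : V) : int := if (q i < q j)%N then 1 else -1.

(** Two integer Vandermonde determinants whose columns differ by [q] are compared through the signs
    of their factors. *)
Lemma perm_sign_inversions (q : 'S_n) :
  (-1) ^+ q = \prod_(x : V * V | (x.1 < x.2)%N) order_sign q x.1 x.2.
Proof.
pose d (s : 'S_n) : int := \prod_(x : V * V | (x.1 < x.2)%N) ((s x.2)%:Z - (s x.1)%:Z).
have dE s : d s = \det (Vandermonde n (\row_i (s i)%:Z)).
  rewrite det_Vandermonde /d pair_big_dep /=; apply: eq_bigr => x _.
  by rewrite !mxE.
have dq : d q = (-1) ^+ q * d 1%g.
  rewrite !dE -[RHS]mulrC.
  have -> : Vandermonde n (\row_i (q i)%:Z) =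
      Vandermonde n (\row_i ((1%g : 'S_n) i)%:Z) *m perm_mx q^-1.
    rewrite -[_ *m _]col_permE; apply/matrixP => i j; rewrite !mxE.
    by rewrite perm1.
  by rewrite det_mulmx det_perm odd_permV.
have := congr1 Num.sg dq; rewrite sgrM /d !(big_morph _ (@sgrM int) (@sgr1 int)).
rewrite [X in _ * X]big1 ?mulr1 => [|x lt_x]; last first.
  by rewrite !perm1 gtr0_sg // subr_gt0 ltz_nat.
rewrite sgrX sgrN1 => <-.
apply: eq_bigr => x lt_x; rewrite /order_sign; case: (ltngtP (q x.1) (q x.2)) => h.
- by rewrite gtr0_sg // subr_gt0 ltz_nat.
- by rewrite ltr0_sg // subr_lt0 ltz_nat.
- by move/val_inj/perm_inj: h => h; rewrite h ltnn in lt_x.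
Qed.

Let cross (q : 'S_n) (i j : V) : bool :=
  [&& (q i < q j)%N, (q j < q (rev_ord i))%N & (q (rev_ord i) < q (rev_ord j))%N].

(** For [i < j] in the first half, the four order relations between the ends of the two edges are
    taken together: disjoint or nested edges give an even number of inversions, crossing edges
    exactly one. The pair [(i, rev_ord i)] is not inverted, by hypothesis. *)
Lemma perm_sign_crossings (q : 'S_n) :
  (forall i, i \in half_set n -> (q i < q (rev_ord i))%N) ->
  (-1) ^+ q = (-1) ^+ #|[set x : V * V | [&& x.1 \in half_set n, x.2 \in half_set n,
     (x.1 < x.2)%N & cross q x.1 x.2 || cross q x.2 x.1]]| :> int.
Proof.
move=> q_lt; have Hrev := half_set_rev n_even.
have nE := half_double n_even.
pose H := half_set n; pose F := order_sign q.
pose PH (x : V * V) := [&& x.1 \in H, x.2 \in H & (x.1 < x.2)%N].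
have FN i j : i != j -> F j i = - F i j.
  move=> ij; rewrite /F /order_sign; case: ltngtP; rewrite ?opprK //.
  by move=> /val_inj/perm_inj/eqP; rewrite eq_sym (negPf ij).
rewrite perm_sign_inversions -/F.
transitivity (\prod_(x | PH x) (F x.1 x.2 * F (rev_ord x.2) (rev_ord x.1) *
    (F x.1 (rev_ord x.2) * F x.2 (rev_ord x.1)))).
  rewrite (bigID (fun x : V * V => x.1 \in H)) /=.
  rewrite [X in X * _](bigID (fun x : V * V => x.2 \in H)) /=.
  rewrite mulrAC big_split /=; congr (_ * _).
    rewrite big_split /=; congr (_ * _).
      by apply: eq_bigl => x; rewrite /PH; case: (_ \in H); case: (_ \in H); rewrite ?andbF ?andbT.
    pose h (x : V * V) := (rev_ord x.2, rev_ord x.1).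
    have hK : involutive h by case=> i j; rewrite /h /= !rev_ordK.
    rewrite (reindex_inj (inv_inj hK)) /=; apply: eq_bigl => -[i j] /=.
    rewrite /PH /= Hrev negbK !inE; have := ltn_ord i; have := ltn_ord j.
    by move: (n./2) nE; lia.
  transitivity (\prod_(x : V * V | (x.1 \in H) && (x.2 \in H)) F x.1 (rev_ord x.2)).
    pose h (x : V * V) := (x.1, rev_ord x.2).
    have hK : involutive h by case=> i j; rewrite /h /= !rev_ordK.
    rewrite (reindex_inj (inv_inj hK)) /=; apply: eq_bigl => -[i j] /=.
    rewrite Hrev negbK !inE; have := ltn_ord i; have := ltn_ord j.
    by move: (n./2) nE; lia.
  rewrite (bigID (fun x : V * V => (x.1 < x.2)%N)) /=.
  rewrite big_split /=; congr (_ * _); first by apply: eq_bigl => x; rewrite /PH andbA.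
  rewrite (bigID (fun x : V * V => x.1 == x.2)) /= big1 ?mul1r => [|[i j]]; last first.
    by move=> /andP[/andP[/andP[/= iH _] _] /eqP /= <-]; rewrite /F /order_sign q_lt.
  pose h (x : V * V) := (x.2, x.1).
  have hK : involutive h by case=> i j.
  rewrite (reindex_inj (inv_inj hK)) /=; apply: eq_bigl => -[i j] /=.
  rewrite /PH /= -leqNgt; case: (i \in H); case: (j \in H); rewrite ?andbF //=.
  by rewrite ltn_neqAle andbC eq_sym.
rewrite -prodr_const big_mkcond [RHS]big_mkcond; apply: eq_bigr => -[i j] _.
rewrite inE /PH /=; case: (boolP (i \in H)) => iH //; case: (boolP (j \in H)) => jH //=.
case: (ltnP i j) => // lt_ij.
have := q_lt i iH; have := q_lt j jH; rewrite /F /order_sign /cross.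
have neq k l : k != l -> (q k != q l :> nat) by rewrite val_eqE (inj_eq perm_inj).
have ne1 : i != j by rewrite -val_eqE ltn_eqF.
have ne2 : i != rev_ord j by apply: contraTneq iH => ->; rewrite Hrev jH.
have ne3 : j != rev_ord i by apply: contraTneq jH => ->; rewrite Hrev iH.
have ne4 : rev_ord i != rev_ord j by rewrite (inj_eq rev_ord_inj).
move: (neq _ _ ne1) (neq _ _ ne2) (neq _ _ ne3) (neq _ _ ne4).
move: (q i : nat) (q j : nat) (q (rev_ord i) : nat) (q (rev_ord j) : nat) => a b c d.
move=> ab ad bc cd lt_bd lt_ac.
case: (ltngtP a b) ab => // ab _; case: (ltngtP a d) ad => // ad _;
case: (ltngtP b c) bc => // bc _; case: (ltngtP c d) cd => // cd _;
rewrite /= ?(ltn_geF ab) ?(ltn_geF cd) //=; exfalso; lia.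
Qed.

End CrossingSign.

Section MatchingSign.
Variable n : nat.
Hypothesis n_even : ~~ odd n.
Local Notation V := 'I_n.

Lemma set2_ordered_inj (a b c d : V) : a < b -> c < d ->
  [set a; b] = [set c; d] -> a = c /\ b = d.
Proof.
move=> lt_ab lt_cd e.
have : a \in [set c; d] by rewrite -e set21.
have : b \in [set c; d] by rewrite -e set22.
rewrite !inE => /orP[]/eqP bE /orP[]/eqP aE; subst => //.
- by rewrite ltnn in lt_ab.
- by have := ltn_trans lt_ab lt_cd; rewrite ltnn.
- by rewrite ltnn in lt_ab.
Qed.

Lemma crossing_set2 (a b c d : V) : a < b -> c < d ->
  crossing [set a; b] [set c; d] = [&& a < c, c < b & b < d].
Proof.
move=> lt_ab lt_cd; apply/existsP/and3P => [[w /existsP[x /existsP[y /existsP[z]]]]|[ac cb bd]].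
  case/and5P => wx xy yz /eqP e /eqP e'.
  have [-> ->] := set2_ordered_inj lt_ab (ltn_trans wx xy) e.
  by have [-> ->] := set2_ordered_inj lt_cd (ltn_trans xy yz) e'.
exists a; apply/existsP; exists c; apply/existsP; exists b; apply/existsP; exists d.
by rewrite ac cb bd !eqxx.
Qed.

Definition pairing (q : 'S_n) : {set {set V}} :=
  [set [set q i; q (rev_ord i)] | i in half_set n].

Lemma matching_sign_pairing (q : 'S_n) :
  (forall i, i \in half_set n -> q i < q (rev_ord i)) ->
  matching_sign (pairing q) = ((-1) ^+ q)%R.
Proof.
move=> q_lt; rewrite perm_sign_crossings // /matching_sign; congr (_ ^+ _)%R.
set X := [set x | _]; pose e i := [set q i; q (rev_ord i)].
have e_inj i j : i \in half_set n -> j \in half_set n -> e i = e j -> i = j.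
  by move=> iH jH /(set2_ordered_inj (q_lt i iH) (q_lt j jH))[/perm_inj].
have XP x : x \in X -> [/\ x.1 \in half_set n, x.2 \in half_set n, x.1 < x.2 &
    crossing (e x.1) (e x.2) || crossing (e x.2) (e x.1)].
  by rewrite inE => /and4P[H1 H2 lt_x]; rewrite !crossing_set2 ?q_lt.
rewrite /cr -(card_in_imset (f := fun x : V * V => [set e x.1; e x.2]) (D := mem X)).
  apply: eq_card => c; apply/imset2P/imsetP => [[f g /imsetP[i iH ->]]|[x /XP[H1 H2 lt_x cr_x] ->]].
    rewrite inE => /andP[/imsetP[j jH ->]]; rewrite -/(e i) -/(e j) => crij ->.
    have := crij; rewrite crossing_set2 ?q_lt // => /and3P[lt_q _ _].
    case: (ltngtP i j) => [lt|lt|/val_inj ij].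
    - exists (i, j) => //; rewrite inE /= iH jH lt; move: crij.
      by rewrite crossing_set2 ?q_lt // => ->.
    - exists (j, i); last by rewrite setUC.
      rewrite inE /= iH jH lt; move: crij.
      by rewrite crossing_set2 ?q_lt // => ->; rewrite orbT.
    - by rewrite ij ltnn in lt_q.
  case/orP: cr_x => cr_x.
    by exists (e x.1) (e x.2) => //; rewrite ?inE ?cr_x ?andbT; apply: imset_f.
  exists (e x.2) (e x.1); rewrite 1?setUC //; first exact: imset_f.
  by rewrite inE cr_x andbT; apply: imset_f.
move=> x y /XP[x1 x2 lt_x _] /XP[y1 y2 lt_y _] exy.
have : e x.1 \in [set e y.1; e y.2] by rewrite -exy set21.
have : e x.2 \in [set e y.1; e y.2] by rewrite -exy set22.
rewrite !in_set2 => /orP[]/eqP/e_inj E2 /orP[]/eqP/e_inj E1.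
- by move: lt_x; rewrite E1 // E2 // ltnn.
- by move: lt_x; rewrite E1 // E2 // => /(ltn_trans lt_y); rewrite ltnn.
- by rewrite [x]surjective_pairing E1 // E2 // -surjective_pairing.
- by move: lt_x; rewrite E1 // E2 // ltnn.
Qed.

End MatchingSign.

(** * From colorings to one-factorizations *)

Section Factorizations.
Local Open Scope ring_scope.
Variable n : nat.
Hypothesis n_even : ~~ odd n.
Local Notation V := 'I_n.
Local Notation slot := ('I_n * 'I_n)%type.
Variable a : V.

(* The proper edge colorings of K_n with the colors other than a, which stands
   on the slots (v, v). *)
Let proper_slots (g : {ffun slot -> V}) :=
  [forall x, g x == if x.1 == x.2 then a else g (slot_inv x)] &&
  [forall v, injectiveb (fun w => g (v, w))].

Let slot_edge (x : slot) : {set V} := [set x.1; x.2].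

Let color_class (g : {ffun slot -> V}) (c : V) : {set {set V}} :=
  [set slot_edge x | x in [pred x : slot | (x.1 != x.2) && (g x == c)]].

Let classes_of (g : {ffun slot -> V}) := [set color_class g c | c in [set~ a]].

Lemma proper_slotsP (g : {ffun slot -> V}) : proper_slots g ->
  [/\ forall v, g (v, v) = a, forall v w, g (v, w) = g (w, v),
      forall v, injective (fun w => g (v, w)) & forall v w, v != w -> g (v, w) != a].
Proof.
case/andP=> /'forall_eqP gE /forallP gI.
have gvv v : g (v, v) = a by rewrite gE eqxx.
have {}gI v : injective (fun w => g (v, w)) by apply/injectiveP.
split=> // v w; last by apply: contraNneq; rewrite -(gvv v) => /gI ->.
by rewrite gE /= /slot_inv /=; case: (eqVneq v w) => [->|]; rewrite ?gvv.
Qed.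

Lemma slot_edge_inj (x y : slot) : slot_edge x = slot_edge y ->
  x = y \/ x = (y.2, y.1).
Proof.
case: x y => i j [k l] e; have : i \in slot_edge (k, l) by rewrite -e set21.
have : j \in slot_edge (k, l) by rewrite -e set22.
have : k \in slot_edge (i, j) by rewrite e set21.
have : l \in slot_edge (i, j) by rewrite e set22.
rewrite !in_set2 /= => h1 h2 /orP[]/eqP jE /orP[]/eqP iE; subst; auto.
  by left; move: h1; rewrite orbb => /eqP->.
by right; move: h2; rewrite orbb => /eqP->.
Qed.

Lemma mem_color_class (g : {ffun slot -> V}) (c : V) x : proper_slots g ->
  x.1 != x.2 -> (slot_edge x \in color_class g c) = (g x == c).
Proof.
move=> /proper_slotsP[_ gC _ _] x12; apply/imsetP/eqP => [[y]|gx].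
  rewrite inE => /andP[_ /eqP gy] /slot_edge_inj[->//|->].
  by rewrite -gC -surjective_pairing.
by exists x => //; rewrite inE x12 gx eqxx.
Qed.

Lemma edgeP (e : {set V}) : reflect (exists2 x : slot, x.1 != x.2 & e = slot_edge x)
  (e \in complete_graph n).
Proof.
rewrite inE; apply/(iffP (cards2P e)) => [[v [w [vw ->]]]|[[v w] /= vw ->]].
  by exists (v, w).
by exists v, w.
Qed.

Let slot_edge_inv (x : slot) : x.1 != x.2 -> slot_edge (slot_inv x) = slot_edge x.
Proof. by rewrite /slot_inv /slot_edge => /negPf-> /=; rewrite setUC. Qed.

Lemma color_class_inj (g : {ffun slot -> V}) : proper_slots g ->
  {in [set~ a] &, injective (color_class g)}.
Proof.
move=> gP c c'; have [gvv gC gI _] := proper_slotsP gP; rewrite !in_setC1 => ca _ cc'.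
have gw := f_invF (gI a) c; set w := invF _ _ in gw.
have aw : a != w by apply: contraNneq ca => aE; rewrite -gw -aE gvv.
have : slot_edge (a, w) \in color_class g c by rewrite mem_color_class // gw eqxx.
by rewrite cc' mem_color_class // gw => /eqP.
Qed.

Lemma classes_of_factorization g : proper_slots g ->
  one_factorization (complete_graph n) (classes_of g).
Proof.
move=> gP; have [gvv gC gI gN] := proper_slotsP gP.
have classP c e : e \in color_class g c -> exists2 x : slot, x.1 != x.2 & e = slot_edge x.
  by case/imsetP=> x; rewrite inE => /andP[x12 _] ->; exists x.
have disj c c' e : e \in color_class g c -> e \in color_class g c' -> c = c'.
  move=> ec; have [x x12 eE] := classP c e ec; move: ec.
  by rewrite eE !mem_color_class // => /eqP-> /eqP.
have ex c v : c != a -> exists2 w, v != w & g (v, w) = c.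
  move=> ca; exists (invF (gI v) c); last by have := f_invF (gI v) c.
  apply: contraNneq ca => vE; have := f_invF (gI v) c.
  by rewrite -vE gvv => ->.
apply/andP; split; last first.
  apply/forall_inP => M /imsetP[c ca ->]; rewrite in_setC1 in ca.
  apply/andP; split; first by apply/subsetP => e /classP/edgeP.
  apply/and3P; split.
  - apply/eqP/setP => v; rewrite inE; apply/bigcupP.
    have [w vw gvw] := ex c v ca; exists (slot_edge (v, w)); last exact: set21.
    by rewrite mem_color_class // gvw eqxx.
  - apply/trivIsetP => e e' eM e'M ee'; rewrite -setI_eq0.
    apply: contraNT ee' => /set0Pn[v]; rewrite inE => /andP[ve ve'].
    have slotv f : f \in color_class g c -> v \in f ->
        exists2 w, v != w & f = slot_edge (v, w).
      move=> fM; have [[i j] /= ij ->] := classP c f fM.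
      rewrite in_set2 /= => /orP[]/eqP->; first by exists j.
      by exists i; rewrite 1?eq_sym // /slot_edge setUC.
    have [w vw eE] := slotv e eM ve; have [w' vw' eE'] := slotv e' e'M ve'.
    move: eM e'M; rewrite eE eE' !mem_color_class // => /eqP gw /eqP gw'.
    by rewrite (gI v w w') // gw gw'.
  - by apply/negP => /classP[x x12] /setP/(_ x.1); rewrite set21 in_set0.
apply/and3P; split.
- apply/eqP/setP => e; apply/bigcupP/edgeP => [[M /imsetP[c ca ->]]|[x x12 ->]].
    exact: classP.
  exists (color_class g (g x)); last by rewrite mem_color_class.
  by apply: imset_f; rewrite in_setC1 [x]surjective_pairing gN.
- apply/trivIsetP => M M' /imsetP[c ca ->] /imsetP[c' c'a ->] MM'.
  rewrite -setI_eq0; apply: contraNT MM' => /set0Pn[e]; rewrite inE => /andP[ec ec'].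
  by rewrite (disj c c' e).
- apply/negP => /imsetP[c]; rewrite in_setC1 => ca /esym/setP M0.
  have [w vw gvw] := ex c a ca.
  by have := M0 (slot_edge (a, w)); rewrite mem_color_class // gvw eqxx in_set0.
Qed.

(** For the labeling of [exists_labels] all orientations are 1, and a color [c != a] yields a
    permutation listing its matching with smaller ends in the first half. The color [a] lists the
    additional edges, which are pairwise nested and so have sign 1. *)
Lemma row_sign_factorization (R : comNzRingType) (kappa : R) g :
  sign_exchange n kappa ->
  proper_slots g ->
  kappa * row_sign R g = (factorization_sign (classes_of g))%:~R.
Proof.
move=> kappaE gP; have [gvv gC gI gN] := proper_slotsP gP.
have g_inv x : g (slot_inv x) = g x.
  case: x => v w; rewrite /slot_inv /=; case: (eqVneq v w) => [->|vw] /=; last exact: gC.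
  by rewrite !gvv.
have [Q [lgQ Qhalf]] := exists_labels n_even g_inv gI.
have /labelsP[/labelingP[Qinv QI] gQ] := lgQ.
rewrite -(kappaE g Q lgQ) [X in _ * X]big1 ?mulr1 => [|c _]; last first.
  by rewrite big1 // => i iH; rewrite /orient Qhalf.
have qI c : injective (fun i => (Q c i).1).
  move=> i j /= e; suff [] : (c, i) = (c, j) by [].
  apply: QI; move: (gQ c i) (gQ c j) e => /=.
  case: (Q c i) (Q c j) => [v w] [v' w'] /= gw gw' vv'; rewrite -vv' in gw' *.
  by rewrite (gI v w w') // gw gw'.
have q_rev c i : perm (@qI c) (rev_ord i) = (slot_inv (Q c i)).1.
  by rewrite permE Qinv.
have q_lt c i : i \in half_set n -> (perm (@qI c) i < perm (@qI c) (rev_ord i))%N.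
  by move=> iH; rewrite q_rev permE -slot_halfE // Qhalf.
have pairE c : c != a -> pairing (perm (@qI c)) = color_class g c.
  move=> ca.
  have Q12 i : (Q c i).1 != (Q c i).2.
    apply: contraNneq ca => Q12; rewrite -(gQ c i) [Q c i]surjective_pairing -Q12.
    by rewrite gvv.
  have edgeE i : [set perm (@qI c) i; perm (@qI c) (rev_ord i)] = slot_edge (Q c i).
    by rewrite q_rev permE /slot_inv (negPf (Q12 i)).
  apply/setP => e; apply/imsetP/imsetP => [[i iH ->]|[x]].
    by exists (Q c i); rewrite ?edgeE // inE Q12 gQ eqxx.
  rewrite inE => /andP[x12 /eqP gx] ->.
  have := f_invF QI x; set u := invF QI x => ux.
  have u1 : u.1 = c by rewrite -gx -ux gQ.
  have [uH|uH] := boolP (u.2 \in half_set n).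
    by exists u.2 => //; rewrite edgeE -u1 ux.
  exists (rev_ord u.2); rewrite ?half_set_rev // edgeE Qinv -u1 ux.
  by rewrite slot_edge_inv.
rewrite (bigD1 a) //= [X in X * _](_ : _ = 1) ?mul1r; last first.
  have diagQ i : exists v, Q a i = (v, v).
    case Qai : (Q a i) => [v w]; have [<-|/gN] := eqVneq v w; first by exists v.
    by rewrite -Qai gQ eqxx.
  have q_rev' i : perm (@qI a) (rev_ord i) = rev_ord (perm (@qI a) i).
    by rewrite q_rev permE; have [v ->] := diagQ i; rewrite /slot_inv /= eqxx.
  rewrite (fsgn_inj R (@qI a)) -(rmorph_sign (intr : int -> R)) perm_sign_crossings //; last exact: q_lt.
  rewrite (_ : [set x | _] = set0) ?cards0 //.
  apply/setP => x; rewrite !inE; apply/negP => /and4P[_ _ _].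
  rewrite !q_rev' /=; set k := perm _ _; set l := perm _ _.
  have := ltn_ord k; have := ltn_ord l.
  by move=> lt_l lt_k /orP[] /and3P[]; lia.
rewrite /factorization_sign /classes_of big_imset /=; last exact: color_class_inj.
rewrite rmorph_prod /=; apply: eq_big => [c|c ca]; first by rewrite in_setC1.
rewrite (fsgn_inj R (@qI c)) -pairE // matching_sign_pairing //; last exact: q_lt.
by rewrite rmorph_sign.
Qed.

Lemma card_factorization_members (P : {set {set {set V}}}) :
  one_factorization (complete_graph n) P -> #|P| = n.-1.
Proof.
case/andP=> part /forall_inP PM; have n_gt0 : (0 < n)%N by have := ltn_ord a; lia.
have cardM M : M \in P -> #|M| = n./2.
  move=> /PM /andP[/subsetP ME partM].
  have := card_uniform_partition (n := 2) _ partM; rewrite cardsT card_ord => E.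
  have : (n = #|M| * 2)%N by apply: E => e /ME; rewrite inE => /eqP.
  by move: #|M| (n./2) (half_double n_even); lia.
have := card_uniform_partition cardM part.
rewrite card_draws card_ord bin2 => E.
have h0 : (0 < n./2)%N by move: (n./2) n_gt0 (half_double n_even); lia.
apply/eqP; rewrite -(eqn_pmul2r h0) -E; apply/eqP.
rewrite {1}(half_double n_even) addnn -doubleMl doubleK mulnC //.
Qed.

Lemma exists_classes_of (P : {set {set {set V}}}) :
  one_factorization (complete_graph n) P ->
  exists2 g, proper_slots g & classes_of g = P.
Proof.
move=> PF; have cardP := card_factorization_members PF.
have /andP[/and3P[/eqP coverP trivP P0] /forall_inP PM] := PF.
have cardC : #|[set~ a]| = #|P| by rewrite cardP cardsC1 card_ord.
pose col M := nth a (enum [set~ a]) (index M (enum P)).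
have col_lt M : M \in P -> (index M (enum P) < size (enum [set~ a]))%N.
  by move=> MP; rewrite -cardE cardC cardE index_mem mem_enum.
have colN M : M \in P -> col M != a.
  by move=> MP; rewrite -in_setC1 -mem_enum mem_nth // col_lt.
have colI : {in P &, injective col}.
  move=> M M' MP M'P /eqP; rewrite nth_uniq ?enum_uniq ?col_lt // => /eqP.
  by apply: (index_inj M); rewrite mem_enum.
have colS c : c != a -> exists2 M, M \in P & col M = c.
  rewrite -in_setC1 -mem_enum => ce; pose k := index c (enum [set~ a]).
  have lt_k : (k < size (enum P))%N by rewrite -cardE -cardC cardE index_mem.
  exists (nth set0 (enum P) k); first by rewrite -mem_enum mem_nth.
  by rewrite /col index_uniq ?enum_uniq // nth_index.
pose g := [ffun x : slot => if x.1 == x.2 then a else col (pblock P (slot_edge x))].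
have edge_cover x : x.1 != x.2 -> slot_edge x \in cover P.
  by move=> x12; rewrite coverP; apply/edgeP; exists x.
have blockP x : x.1 != x.2 -> pblock P (slot_edge x) \in P.
  by move=> x12; rewrite pblock_mem // edge_cover.
have gP : proper_slots g.
  apply/andP; split.
    apply/'forall_eqP => x; rewrite !ffunE; case: eqP => //= /eqP x12.
    rewrite slot_edge_inv // /slot_inv (negPf x12) /= eq_sym.
    by rewrite (negPf x12).
  apply/forallP => v; apply/injectiveP => w w'; rewrite !ffunE /=.
  case: eqP => [<-|/eqP vw]; case: eqP => [<-|/eqP vw'] // e.
  - by have := colN _ (blockP (v, w') vw'); rewrite -e eqxx.
  - by have := colN _ (blockP (v, w) vw); rewrite e eqxx.
  have BE : pblock P (slot_edge (v, w)) = pblock P (slot_edge (v, w')).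
    by apply: colI => //; apply: blockP.
  have MP := blockP (v, w) vw.
  have /andP[_ /and3P[_ /trivIsetP trivM _]] := PM _ MP.
  have e1 : slot_edge (v, w) \in pblock P (slot_edge (v, w)).
    by rewrite mem_pblock edge_cover.
  have e2 : slot_edge (v, w') \in pblock P (slot_edge (v, w)).
    by rewrite BE mem_pblock edge_cover.
  have [/slot_edge_inj[[]//|[vw2]]|ne] := eqVneq (slot_edge (v, w)) (slot_edge (v, w')).
    by move: vw'; rewrite -vw2 eqxx.
  have := trivM _ _ e1 e2 ne; rewrite -setI_eq0 => /eqP/setP/(_ v).
  by rewrite inE !set21 in_set0.
have classE M : M \in P -> color_class g (col M) = M.
  move=> MP; have /andP[/subsetP ME _] := PM _ MP.
  apply/setP => e; have [/edgeP[x x12 ->]|eN] := boolP (e \in complete_graph n).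
    rewrite mem_color_class // ffunE (negPf x12) (inj_in_eq colI) ?blockP //.
    apply/eqP/idP => [<-|xM]; first by rewrite mem_pblock edge_cover.
    exact: def_pblock xM.
  transitivity false; last by apply/esym; apply: contraNF eN => /ME.
  apply: contraNF eN => /imsetP[x]; rewrite inE => /andP[x12 _] ->.
  by apply/edgeP; exists x.
exists g => //; apply/setP => M; apply/imsetP/idP => [[c]|MP].
  by rewrite in_setC1 => /colS[M' M'P <-] ->; rewrite classE.
by exists (col M); rewrite ?classE // in_setC1 colN.
Qed.

(** The colorings with given classes form one free orbit under the permutations of the colors that
    fix [a]. *)
Lemma card_classes_of (P : {set {set {set V}}}) :
  one_factorization (complete_graph n) P ->
  #|[set g | proper_slots g && (classes_of g == P)]| = (n.-1)`!.
Proof.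
move=> PF; have [g0 g0P g0E] := exists_classes_of PF.
have [g0vv g0C g0I g0N] := proper_slotsP g0P.
have <- : #|[set~ a]| = n.-1 by rewrite cardsC1 card_ord.
rewrite -card_perm -(cardsE (perm_on [set~ a])).
pose h (s : {perm V}) := [ffun x => s (g0 x)].
have hI : injective h.
  move=> s s' hs; apply/permP => c; rewrite -(f_invF (g0I a) c).
  by have := congr1 (fun g : {ffun slot -> V} => g (a, invF (g0I a) c)) hs; rewrite !ffunE.
rewrite -(card_imset _ hI); apply: eq_card => g; rewrite inE.
apply/andP/imsetP => [[gP /eqP gE]|[s]].
  have [gvv gC gI gN] := proper_slotsP gP.
  pose s0 c := g (a, invF (g0I a) c).
  have s0I : injective s0 by move=> c c' /gI; apply: (can_inj (f_invF (g0I a))).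
  have g0E' c : g0 (a, invF (g0I a) c) = c by have := f_invF (g0I a) c.
  exists (perm s0I).
    rewrite inE; apply/subsetP => c; rewrite inE permE in_setC1; apply: contraNneq => ->.
    have wa : invF (g0I a) a = a by apply: (g0I a); rewrite g0E' g0vv.
    by rewrite /s0 wa gvv.
  apply/ffunP => x; rewrite ffunE permE /s0; set w := invF _ _.
  have gw : g0 (a, w) = g0 x by apply: g0E'.
  have [x12|x12] := eqVneq x.1 x.2.
    have xa : g0 x = a by rewrite [x]surjective_pairing x12 g0vv.
    have -> : w = a by apply: (g0I a); rewrite gw xa g0vv.
    by rewrite gvv [x]surjective_pairing x12 gvv.
  have aw : a != w.
    apply: contraNneq (g0N _ _ x12) => aE.
    by rewrite -surjective_pairing -gw -aE g0vv.
  have /imsetP[c _ cE] : color_class g0 (g0 x) \in classes_of g.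
    rewrite gE -g0E; apply: imset_f; rewrite in_setC1 [x]surjective_pairing; exact: g0N.
  have : slot_edge x \in color_class g0 (g0 x) by rewrite mem_color_class.
  have : slot_edge (a, w) \in color_class g0 (g0 x) by rewrite mem_color_class // gw.
  by rewrite cE !mem_color_class // => /eqP -> /eqP.
rewrite inE => sP ->.
have sa : s a = a by apply: (out_perm sP); rewrite in_setC1 eqxx.
split.
  apply/andP; split.
    apply/'forall_eqP => x; rewrite !ffunE; case: eqP => [x12|/eqP x12].
      by rewrite [x]surjective_pairing x12 g0vv sa.
    by rewrite /slot_inv (negPf x12) [x in LHS]surjective_pairing g0C.
  apply/forallP => v; apply/injectiveP => w w'; rewrite !ffunE => /perm_inj.
  exact: g0I.
rewrite -g0E; apply/eqP.
have classE c : color_class (h s) (s c) = color_class g0 c.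
  apply/setP => e; apply/imsetP/imsetP => -[x]; rewrite inE => /andP[x12 gx] ->;
    exists x => //; move: gx; rewrite inE x12 ffunE (inj_eq perm_inj) //.
apply/setP => M; apply/imsetP/imsetP => -[c]; rewrite in_setC1 => ca ->.
  exists ((s^-1)%g c); last by rewrite -classE permKV.
  by rewrite in_setC1 -(inj_eq (@perm_inj _ s)) permKV sa.
exists (s c); last by rewrite classE.
by rewrite in_setC1 -sa (inj_eq perm_inj).
Qed.

Lemma weight_setT_signed_count (R : comNzRingType) (kappa : R) :
  sign_exchange n kappa ->
  kappa * weight R setT [ffun=> a] = (n.-1)`!%:R * (signed_count n)%:~R.
Proof.
move=> kappaE.
have -> : weight R setT [ffun=> a] = \sum_(g | proper_slots g) row_sign R g.
  rewrite /weight big_mkcond [RHS]big_mkcond; apply: eq_bigr => g _.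
  rewrite /proper_slots; have -> : compatible setT [ffun=> a] g =
      [forall x, g x == if x.1 == x.2 then a else g (slot_inv x)].
    apply: eq_forallb => x; rewrite /bdry in_setT andbT.
    by case: ifP => //; rewrite ffunE.
  case: ifP => //= _; case: ifPn => // /forallPn[v gv].
  by rewrite /row_sign (bigD1 v) //= fsgn0 ?mul0r //; apply/injectiveP.
rewrite big_distrr (partition_big classes_of (one_factorization (complete_graph n))) /=;
  last exact: classes_of_factorization.
rewrite /signed_count rmorph_sum big_distrr; apply: eq_bigr => P PF /=.
transitivity (\sum_(g | proper_slots g && (classes_of g == P))
    (factorization_sign P)%:~R : R).
  apply: eq_bigr => g /andP[gP /eqP <-]; exact: row_sign_factorization.
rewrite -(card_classes_of PF) mulr_natl -sumr_const.
by apply: eq_bigl => g; rewrite inE.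
Qed.

End Factorizations.

(** * The Alon-Tarsi method for the painting game *)

Section AlonTarsi.
Local Open Scope ring_scope.
Variables (F : fieldType) (E I : finType) (src tgt : I -> E).
Hypothesis two_neq0 : 2%:R != 0 :> F.
Implicit Types (D A B : {set E}) (P o : {set I}) (lambda : E -> nat -> F).

Definition arc_end o i := if i \in o then tgt i else src i.

Definition outdeg P o e := #|[set i in P | arc_end o i == e]|.

Definition arcs D : {set I} := [set i | (src i \in D) && (tgt i \in D)].

(* The functional sending the monomial prod_e x_e ^ k_e to the product of the
   lambda e k_e, applied to prod_(i in P) (x_(src i) - x_(tgt i)). *)
Definition graph_functional P D lambda : F :=
  \sum_(o : {set I} | o \subset P) (-1) ^+ #|o| * \prod_(e in D) lambda e (outdeg P o e).

Definition exponent_is (alpha : E -> nat) e k : F := (k == alpha e)%:R.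

(** Some monomial of the graph polynomial of [D] has a nonzero coefficient and all its exponents
    below the numbers of tokens. *)
Definition alon_tarsi D (t : E -> nat) :=
  exists2 alpha, (forall e, e \in D -> alpha e < t e)%N &
    graph_functional (arcs D) D (exponent_is alpha) != 0.

(** The graph polynomial is homogeneous. *)
Lemma sum_outdeg D o : (\sum_(e in D) outdeg (arcs D) o e = #|arcs D|)%N.
Proof.
rewrite -sum1_card (partition_big (arc_end o) (mem D)) /= => [|i]; last first.
  by rewrite inE /arc_end => /andP[sD tD]; case: ifP.
by apply: eq_bigr => e _; rewrite /outdeg -sum1_card; apply: eq_bigl => i; rewrite inE.
Qed.

(** The values 1 on [B] amount to setting the variables of [B] to 1, which kills the factor of the
    arc [i]; in terms of orientations, reversing this arc pairs opposite terms. *)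
Lemma functional_arc P D B lambda i :
  i \in P -> src i \in B -> tgt i \in B -> (forall e k, e \in B -> lambda e k = 1) ->
  graph_functional P D lambda = 0.
Proof.
move=> iP sB tB lam1; set S := graph_functional _ _ _.
pose flip o := if i \in o then o :\ i else i |: o.
have flipE o j : j \in flip o = (j \in o) (+) (j == i).
  rewrite /flip; case: ifP => io; rewrite !inE; case: eqP => [->|_];
    by rewrite ?io ?addbF ?andbT.
have flipK : involutive flip.
  by move=> o; apply/setP => j; rewrite !flipE -addbA addbb addbF.
have flipS o : (flip o \subset P) = (o \subset P).
  suff imp o' : o' \subset P -> flip o' \subset P.
    by apply/idP/idP => /imp //; rewrite flipK.
  move=> /subsetP oP; apply/subsetP => j; rewrite flipE.
  by case: eqP => [->|_]; rewrite ?addbF //; apply: oP.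
have SN : S = - S.
  rewrite {1}/S /graph_functional (reindex_inj (inv_inj flipK)) -sumrN /=.
  apply: eq_big => o; first exact: flipS.
  move=> _; rewrite -mulNr; congr (_ * _).
    have -> : (-1) ^+ #|flip o| = (-1) ^+ (#|o|.+1) :> F.
      rewrite /flip; case: (boolP (i \in o)) => io.
        by rewrite [#|o|](cardsD1 i) io !exprS !mulrA mulrNN mulr1 mul1r.
      by rewrite cardsU1 io.
    by rewrite exprS mulN1r.
  apply: eq_bigr => e _; have [eB|eB] := boolP (e \in B); first by rewrite !lam1.
  congr (lambda e _); apply: eq_card => j; rewrite !inE; congr (_ && _).
  rewrite /arc_end flipE; have [->|_] := eqVneq j i; last by rewrite addbF.
  have [se te] : (src i == e) = false /\ (tgt i == e) = false.
    by split; apply: contraNF eB => /eqP <-.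
  by do 2!case: ifP; rewrite ?se ?te.
apply/eqP; have /eqP := SN; rewrite -addr_eq0 -mulr2n -mulr_natl mulf_eq0.
by rewrite (negPf two_neq0).
Qed.

(** The terms are grouped by the orientation [o2] of the arcs that are lost. Some group is nonzero,
    and within it these arcs only shift the out-degrees by the fixed amounts [gamma]. *)
Lemma functional_restrict D B lambda : B \subset D ->
  (forall e k, e \in B -> lambda e k = 1) ->
  graph_functional (arcs D) D lambda != 0 ->
  exists gamma : E -> nat, graph_functional (arcs (D :\: B)) (D :\: B)
    (fun e k => lambda e (k + gamma e)%N) != 0.
Proof.
move=> BD lam1; set P := arcs D; set P1 := arcs (D :\: B).
have P1P : P1 \subset P.
  by apply/subsetP => i; rewrite !inE => /andP[/andP[_ ->] /andP[_ ->]].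
pose P2 := P :\: P1; rewrite /graph_functional.
have P2P : P2 \subset P by apply: subsetDl.
rewrite (partition_big (fun o : {set I} => o :&: P2) (fun o2 : {set I} => o2 \subset P2)) /=; last first.
  by move=> o _; apply: subsetIr.
move=> S0; have [o2 o2P2 S2] : exists2 o2 : {set I}, o2 \subset P2 &
    \sum_(o : {set I} | (o \subset P) && (o :&: P2 == o2))
      (-1) ^+ #|o| * \prod_(e in D) lambda e (outdeg P o e) != 0.
  apply/exists_inP; apply: contraR S0; rewrite negb_exists_in => /forall_inP S0.
  by rewrite big1 // => o2 o2P2; apply/eqP; have := S0 o2 o2P2; rewrite negbK.
exists (outdeg P2 o2); apply: contra_neq S2 => S1.
rewrite (reindex_onto (fun o1 => o1 :|: o2) (fun o => o :&: P1)) /=; last first.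
  move=> o /andP[/subsetP oP /eqP <-]; apply/setP => i; rewrite !inE -andb_orr.
  case: (boolP (i \in o)) => //= io; have := oP i io; rewrite inE => ->.
  by rewrite andbT orbN.
transitivity ((-1) ^+ #|o2| * \sum_(o1 : {set I} | o1 \subset P1) (-1) ^+ #|o1| *
   \prod_(e in D :\: B) lambda e (outdeg P1 o1 e + outdeg P2 o2 e)%N); last first.
  by rewrite S1 mulr0.
have disj i : i \in P1 -> i \in P2 = false by move=> iP1; rewrite inE iP1.
rewrite big_distrr /=; apply: eq_big => [o1|o1 /andP[_ /eqP o1E]].
  apply/andP/idP => [[_ /eqP <-]|o1P1]; first exact: subsetIr.
  have o1P2 : o1 :&: P2 = set0.
    apply/setP => i; rewrite in_setI in_set0; apply/negP => /andP[io1].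
    by rewrite (disj _ (subsetP o1P1 i io1)).
  have o2P1 : o2 :&: P1 = set0.
    apply/setP => i; rewrite in_setI in_set0; apply/negP => /andP[io2 iP1].
    by have := subsetP o2P2 i io2; rewrite disj.
  rewrite subUset (subset_trans o1P1 P1P) (subset_trans o2P2 P2P) !setIUl.
  by rewrite o1P2 o2P1 set0U setU0 (setIidPl o2P2) (setIidPl o1P1) !eqxx.
have o1P1 : o1 \subset P1 by rewrite -o1E subsetIr.
have o12 : o1 :&: o2 = set0.
  apply/setP => i; rewrite in_setI in_set0; apply/negP => /andP[io1 io2].
  by have := subsetP o2P2 i io2; rewrite disj // (subsetP o1P1).
rewrite cardsU o12 cards0 subn0 addnC exprD -mulrA.
congr (_ * (_ * _)).
rewrite (bigID (mem B)) /= big1 ?mul1r => [|e /andP[_ eB]]; last exact: lam1.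
apply: eq_big => e; first by rewrite inE andbC.
move=> _; congr (lambda e _); rewrite /outdeg.
rewrite -(cardsID P1 [set i in P | _]); congr (_ + _)%N; apply: eq_card => i.
  rewrite in_setI in_set [in RHS]in_set andbC; case: (boolP (i \in P1)) => //= iP1.
  rewrite (subsetP P1P) //= /arc_end in_setU (contraNF (subsetP o2P2 i)) ?orbF //.
  by rewrite disj.
rewrite in_setD in_set [in RHS]in_set in_setD; case: (boolP (i \in P1)) => //= iP1.
congr (_ && _); rewrite /arc_end in_setU.
by rewrite (contraNF (subsetP o1P1 i)).
Qed.

(** By homogeneity the condition [k = alpha e] can be relaxed on [A] to [alpha e <= k], that is [1 -
    [k < alpha e]]. In the expansion over the subsets [B] of [A] some term is nonzero. This [B] is
    independent by [functional_arc], and on [A :\: B] the strict inequality pays for the lost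
    token. *)
Lemma alon_tarsi_step D A (t : E -> nat) : A \subset D -> alon_tarsi D t ->
  exists B : {set E}, [/\ B \subset A,
    forall i, ~~ ((src i \in B) && (tgt i \in B)) &
    alon_tarsi (D :\: B) (fun e => t e - (e \in A))%N].
Proof.
move=> AD [alpha alpha_t c_alpha].
have sum_alpha : (\sum_(e in D) alpha e = #|arcs D|)%N.
  have [o oP] : exists o : {set I}, [forall e in D, outdeg (arcs D) o e == alpha e].
    apply/existsP; apply: contraR c_alpha; rewrite negb_exists => /forallP no.
    rewrite /graph_functional big1 // => o _.
    have /forall_inPn[e eD /negPf ne] := no o.
    by rewrite (bigD1 e) //= /exponent_is ne mul0r mulr0.
  rewrite -(sum_outdeg D o); apply: eq_bigr => e eD; apply/esym/eqP.
  by move/forall_inP: oP; apply.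
pose lam e k : F := if e \in A then (alpha e <= k)%N%:R else (k == alpha e)%:R.
have lamE : graph_functional (arcs D) D lam =
    graph_functional (arcs D) D (exponent_is alpha).
  apply: eq_bigr => o _; congr (_ * _).
  have [/forall_inP oP|/forall_inPn[e eD ne]] :=
      boolP [forall e in D, outdeg (arcs D) o e == alpha e].
    apply: eq_bigr => e eD; rewrite /lam /exponent_is (eqP (oP e eD)) leqnn eqxx.
    by case: ifP.
  rewrite [RHS](bigD1 e) //= /exponent_is (negPf ne) mul0r.
  (* A monomial of the same degree other than [alpha] has some exponent below that of [alpha], where
     [lam] vanishes. *)
  have [f fD lt_f] : exists2 f, f \in D & (outdeg (arcs D) o f < alpha f)%N.
    apply/exists_inP; apply: contraR ne; rewrite negb_exists_in => /forall_inP ge.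
    have {}ge f : f \in D -> (alpha f <= outdeg (arcs D) o f)%N.
      by move=> fD; rewrite leqNgt ge.
    have := sum_outdeg D o; rewrite -sum_alpha (bigD1 e) //= [in RHS](bigD1 e) //=.
    have : (\sum_(f in D | f != e) alpha f <=
        \sum_(f in D | f != e) outdeg (arcs D) o f)%N.
      by apply: leq_sum => f /andP[fD _]; apply: ge.
    by have := ge e eD; rewrite eqn_leq => ->; lia.
  rewrite (bigD1 f) //= /lam; case: ifP => _; first by rewrite leqNgt lt_f mul0r.
  by rewrite ltn_eqF // mul0r.
pose G e k : F := if e \in A then - (k < alpha e)%N%:R else (k == alpha e)%:R.
pose lamB B e k : F := if e \in B then 1 else G e k.
have [B BA B0] : exists2 B : {set E}, B \subset A & graph_functional (arcs D) D (lamB B) != 0.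
  apply/exists_inP; apply: contraR c_alpha; rewrite negb_exists_in => /forall_inP B0.
  rewrite -lamE; apply/eqP.
  transitivity (\sum_(B : {set E} | B \subset A) graph_functional (arcs D) D (lamB B)).
    rewrite exchange_big /=; apply: eq_bigr => o _; rewrite -big_distrr /=.
    congr (_ * _); pose k e := outdeg (arcs D) o e.
    transitivity (\prod_e ((e \in A)%:R + (if e \in D then G e (k e) else 1)) : F).
      rewrite big_mkcond; apply: eq_bigr => e _; rewrite /lam /G -/(k e).
      case: (boolP (e \in A)) => eA.
        by rewrite (subsetP AD) //= leqNgt; case: (_ < _)%N; rewrite ?subrr ?subr0.
      by rewrite add0r.
    rewrite bigA_distr (bigID (fun B : {set E} => B \subset A)) /= [X in _ + X]big1 ?addr0.
      apply: eq_big => [B|B BA] //.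
      rewrite [RHS]big_mkcond; apply: eq_bigr => e _; rewrite /lamB -/(k e).
      case: ifP => eB; last by [].
      by rewrite (subsetP BA) // (subsetP AD) // (subsetP BA).
    move=> B /subsetPn[e eB eA].
    by rewrite (bigD1 e) //= eB (negPf eA) mul0r.
  by rewrite big1 // => B /B0; rewrite negbK => /eqP.
have BD := subset_trans BA AD.
have lam1 e k : e \in B -> lamB B e k = 1 by rewrite /lamB => ->.
exists B; split=> //.
  move=> i; apply: contraNN B0 => /andP[sB tB]; apply/eqP.
  have iD : i \in arcs D by rewrite inE !(subsetP BD).
  exact: functional_arc iD sB tB lam1.
have [gamma] := functional_restrict BD lam1 B0.
set P1 := arcs _; set lam2 := fun e k => _ => S0.
(* The functional is a combination of coefficients of monomials, so one of them enters with nonzero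
   coefficient and nonzero weight. Exponents are at most [#|I|], and [beta] is set to 0 outside
   [D :\: B] to make it unique. *)
have [beta beta0 lam_beta] : exists2 beta : {ffun E -> 'I_(#|I|.+1)},
    graph_functional P1 (D :\: B) (exponent_is (fun e => beta e)) != 0 &
    [forall e in D :\: B, lam2 e (beta e) != 0].
  pose b o : {ffun E -> 'I_(#|I|.+1)} :=
    [ffun e => if e \in D :\: B then inord (outdeg P1 o e) else ord0].
  have bE o e : e \in D :\: B -> b o e = outdeg P1 o e :> nat.
    by move=> eDB; rewrite ffunE eDB inordK // ltnS max_card.
  have key : graph_functional P1 (D :\: B) lam2 = \sum_(beta : {ffun E -> 'I_(#|I|.+1)})
     if [forall e in ~: (D :\: B), beta e == ord0]
     then (\prod_(e in D :\: B) lam2 e (beta e)) *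
       graph_functional P1 (D :\: B) (exponent_is (fun e => beta e)) else 0.
    rewrite /graph_functional (partition_big b predT) //=; apply: eq_bigr => beta _.
    case: ifPn => [/forall_inP supp|nsupp].
      rewrite big_distrr [LHS]big_mkcond [RHS]big_mkcond; apply: eq_bigr => o _ /=.
      case: (boolP (o \subset P1)) => //= _; case: eqP => [<-|ne].
        rewrite mulrCA; congr (_ * _); rewrite [X in _ * X]big1 ?mulr1 => [|e eDB].
          by apply: eq_bigr => e eDB; rewrite bE.
        by rewrite /exponent_is bE // eqxx.
      have [e eDB nee] : exists2 e, e \in D :\: B & (outdeg P1 o e != beta e :> nat).
        apply/exists_inP; apply: contra_notT ne; rewrite negb_exists_in => /forall_inP ee.
        apply/ffunP => e; have [eDB|eDB] := boolP (e \in D :\: B).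
          by apply/val_inj; rewrite /= bE //; apply/eqP; have := ee e eDB; rewrite negbK.
        by rewrite ffunE (negPf eDB); apply/esym/eqP/supp; rewrite inE.
      by rewrite [X in _ * (_ * X)](bigD1 e) //= /exponent_is (negPf nee) mul0r !mulr0.
    rewrite big1 // => o /andP[_ /eqP be]; case/negP: nsupp; apply/forall_inP => e.
    by rewrite inE => eDB; rewrite -be ffunE (negPf eDB).
  have /existsP[beta /andP[b0 lb]] : [exists beta : {ffun E -> 'I_(#|I|.+1)},
      (graph_functional P1 (D :\: B) (exponent_is (fun e => beta e)) != 0) &&
      [forall e in D :\: B, lam2 e (beta e) != 0]]; last by exists beta.
  apply: contraR S0; rewrite negb_exists => /forallP no; rewrite key; apply/eqP/big1 => beta _.
  case: ifP => // _; have := no beta; rewrite negb_and negbK => /orP[/eqP->|].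
    by rewrite mulr0.
  by move=> /forall_inPn[e eDB]; rewrite negbK => /eqP l0; rewrite (bigD1 e) //= l0 !mul0r.
exists (fun e => beta e); last exact: beta0.
move=> e eDB; move/forall_inP: lam_beta => /(_ e eDB).
have [eD eB] : e \in D /\ e \notin B by move: eDB; rewrite inE => /andP[].
have lt_t := alpha_t e eD.
rewrite /lam2 /lamB (negPf eB) /G.
move: (beta e : nat) (gamma e) (alpha e) (t e) lt_t => b c k s lt_ks.
case: (e \in A) => /=; rewrite ltn_subRL.
  case: ltnP => [lt_b _|_]; last by rewrite oppr0 eqxx.
  exact: leq_ltn_trans (leq_ltn_trans (leq_addr c b) lt_b) lt_ks.
case: ((b + c)%N =P k) => [e_b _|_]; last by rewrite eqxx.
by apply: leq_ltn_trans lt_ks; rewrite -e_b leq_addr.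
Qed.

End AlonTarsi.

Section Painter.
Variables (T : finType) (F : fieldType) (I : finType) (src tgt : I -> {set T}).
Hypothesis two_neq0 : (2%:R != 0 :> F)%R.
Variable E : {set {set T}}.
Hypothesis arc_adj : forall e f, e \in E -> f \in E -> e != f ->
  ~~ [disjoint e & f] -> exists i, [set src i; tgt i] = [set e; f].

(** The condition forces every uncolored edge to have a token, and the replies of [alon_tarsi_step]
    preserve it; the tokens left on uncolored edges decrease in number. *)
Lemma alon_tarsi_painter_wins (U : {set {set T}}) (t : {ffun {set T} -> nat}) :
  U \subset E -> alon_tarsi F src tgt U t -> painter_wins U t.
Proof.
have [k] := ubnP (\sum_(e in U) t e); elim: k U t => // k IHk U t; rewrite ltnS => le_k UE AT.
have t_gt0 e : e \in U -> 0 < t e.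
  by case: AT => alpha lt_alpha _ eU; apply: leq_ltn_trans (lt_alpha e eU).
have /fin_all_exists[s sP] A : exists B : {set {set T}}, lister_move U A ->
    matching A B /\ alon_tarsi F src tgt (U :\: B) (remove_tokens t A).
  have [/andP[AU A0]|] := boolP (lister_move U A); last by exists set0.
  have [B [BA indep ATB]] := alon_tarsi_step two_neq0 AU AT.
  exists B => _; split; last first.
    case: ATB => alpha lt_alpha c_alpha; exists alpha => // e eUB.
    by rewrite ffunE; apply: lt_alpha.
  apply/andP; split=> //; apply/trivIsetP => e f eB fB ef; apply/negPn/negP => nd.
  have inE' g : g \in B -> g \in E by move=> gB; apply/(subsetP UE)/(subsetP AU)/(subsetP BA).
  have [i iE] := arc_adj (inE' e eB) (inE' f fB) ef nd.
  case/negP: (indep i); apply/andP.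
  have sI : src i \in [set e; f] by rewrite -iE set21.
  have tI : tgt i \in [set e; f] by rewrite -iE set22.
  by split; [move: sI | move: tI]; rewrite in_set2 => /orP[]/eqP->.
apply: (@PainterWins _ _ _ s) => // A mA; have [mB ATB] := sP A mA; first by [].
apply: IHk => //; last by apply: subset_trans UE; apply: subsetDl.
have /andP[AU /set0Pn[e eA]] := mA; have eU := subsetP AU e eA.
apply: leq_trans le_k.
apply: (@leq_ltn_trans (\sum_(e in U) remove_tokens t A e)).
  rewrite [X in _ <= X](bigID (mem (s A))) /= addnC.
  apply: leq_trans (leq_addr _ _); apply: eq_leq; apply: eq_bigl => f.
  by rewrite inE andbC.
rewrite (bigD1 e) //= [X in _ < X](bigD1 e) //= -addSn leq_add //.
  by rewrite ffunE eA subn1 prednK ?t_gt0.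
by apply: leq_sum => f _; rewrite ffunE leq_subr.
Qed.

End Painter.

Lemma prod_sub_expand (R : comNzRingType) (I : finType) (P : {set I}) (a b : I -> R) :
  (\prod_(i in P) (a i - b i) = \sum_(o : {set I} | o \subset P)
    (-1) ^+ #|o| * \prod_(i in P) (if i \in o then b i else a i))%R.
Proof.
transitivity (\prod_i ((if i \in P then - b i else 0) + (if i \in P then a i else 1)))%R.
  rewrite big_mkcond; apply: eq_bigr => i _; case: ifP => _; last by rewrite add0r.
  by rewrite addrC.
rewrite bigA_distr (bigID (fun o : {set I} => o \subset P)) /= [X in (_ + X)%R]big1 ?addr0.
  apply: eq_big => [o|o oP] //; rewrite -prodr_const.
  rewrite [X in (X * _)%R]big_mkcond [X in (_ * X)%R]big_mkcond -big_split /=.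
  apply: eq_bigr => i _; case: (boolP (i \in o)) => io; last by rewrite mul1r.
  by rewrite (subsetP oP) // mulN1r.
move=> o /subsetPn[i io iP]; by rewrite (bigD1 i) //= io (negPf iP) mul0r.
Qed.

(** * A nonzero coefficient of the line graph polynomial of [K_n] *)

Section InitialPosition.
Local Open Scope ring_scope.
Variable p : nat.
Hypothesis p_prime : prime p.
Hypothesis p_odd : odd p.
Local Notation n := p.-1.
Local Notation F := 'F_p.
Local Notation V := 'I_n.
Local Notation slot := ('I_n * 'I_n)%type.
Local Notation triple := ('I_n * ('I_n * 'I_n))%type.
Let n_even : ~~ odd n := pred_prime_even p_prime p_odd.
Let n_gt1 : (1 < n)%N := pred_prime_gt1 p_prime p_odd.
Local Notation K := (complete_graph n).

(* The arcs join the edges at a vertex v; set0, which is not an edge, stands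
   for the degenerate triples. *)
Definition arc_src (i : triple) : {set V} :=
  if (i.2.1 < i.2.2)%N then [set i.1; i.2.2] else set0.
Definition arc_tgt (i : triple) : {set V} := [set i.1; i.2.1].

Let P : {set triple} := arcs arc_src arc_tgt K.

Let in_P v w w' : ((v, (w, w')) \in P) = [&& (w < w')%N, w != v & w' != v].
Proof.
rewrite !inE /arc_src /arc_tgt /=; case: ifP => _; last by rewrite cards0.
by rewrite !cards2 ![v == _]eq_sym; do 2!case: (_ == v).
Qed.

Lemma arc_adjacent e f : e \in K -> f \in K -> e != f -> ~~ [disjoint e & f] ->
  exists i, [set arc_src i; arc_tgt i] = [set e; f].
Proof.
move=> eK fK ef; rewrite -setI_eq0 => /set0Pn[v]; rewrite inE => /andP[ve vf].
have edge g : g \in K -> v \in g -> exists w, g = [set v; w].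
  rewrite inE => /cards2P[x [y [_ ->]]]; rewrite in_set2 => /orP[]/eqP->.
    by exists y.
  by exists x; rewrite setUC.
have [w eE] := edge e eK ve; have [w' fE] := edge f fK vf.
have ww : w != w' by apply: contraNneq ef => ww; rewrite eE fE ww.
case: (ltngtP w w') => [lt|lt|/val_inj ww']; last by rewrite ww' eqxx in ww.
  by exists (v, (w, w')); rewrite /arc_src /arc_tgt /= lt -eE -fE setUC.
by exists (v, (w', w)); rewrite /arc_src /arc_tgt /= lt -eE -fE.
Qed.

(** The monomial with all exponents [n.-2] thus has the degree of the line graph polynomial. *)
Let card_P : #|P| = (#|K| * n.-2)%N.
Proof.
transitivity (\sum_(i : slot * V | (i.1.1 < i.1.2) && ((i.2 != i.1.1) && (i.2 != i.1.2))) 1)%N.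
  rewrite -sum1_card (reindex (fun i : slot * V => (i.2, i.1))) /=; last first.
    by exists (fun i : triple => (i.2, i.1)) => -[].
  by apply: eq_bigl => -[[w w'] v]; rewrite in_P ![v == _]eq_sym.
rewrite -(pair_big_dep (fun u : slot => (u.1 < u.2)%N)
  (fun u v => (v != u.1) && (v != u.2)) (fun _ _ => 1%N)) /=.
rewrite (eq_bigr (fun=> n.-2)) => [|u lt_u]; last first.
  rewrite sum1_card (eq_card (B := ~: [set u.1; u.2])) => [|v]; last by rewrite !inE negb_or.
  have := cardsC [set u.1; u.2]; rewrite cards2 card_ord -(val_eqE u.1) ltn_eqF //.
  by move/(congr1 (fun k => k.-2)) => <-.
rewrite sum_nat_const card_draws card_ord -bin2_sum big_mkord -sum1_card; congr (_ * _)%N.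
rewrite -(pair_big_dep predT (fun w w' : V => (w < w')%N) (fun _ _ => 1%N)) /=.
rewrite (exchange_big_dep predT) //=; apply: eq_bigr => w' _.
by rewrite -(big_ord_widen n (fun=> 1%N)) ?sum1_card ?card_ord // ltnW.
Qed.

(** It vanishes at 0, which encodes no color, and at 1, which encodes the excluded color [a0]. Its
    moments of order below [n - 2] are 0, and the one of order [n - 2] is -1. *)
Let f (z : F) : F := z * (z - 1).

Let moment (k : nat) : F := \sum_(z : F) z ^+ k * f z.

Let momentE k : moment k =
  (if (n %| k.+2)%N then -1 else 0) - (if (n %| k.+1)%N then -1 else 0).
Proof.
transitivity (\sum_(z : F) z ^+ k.+2 - \sum_(z : F) z ^+ k.+1).
  by rewrite -sumrB; apply: eq_bigr => z _; rewrite /f !exprSr -!mulrA -mulrBr (mulrBr z) mulr1.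
by rewrite !sum_exprF.
Qed.

Let color_sum : F := \sum_(x : {ffun {set V} -> F} | x \in pffun_on 0 (mem K) predT)
  (\prod_(i in P) (x (arc_src i) - x (arc_tgt i))) * \prod_(e in K) f (x e).

Let color_sum_functional :
  color_sum = graph_functional arc_src arc_tgt P K (fun=> moment).
Proof.
transitivity (\sum_(x : {ffun {set V} -> F} | x \in pffun_on 0 (mem K) predT)
    \sum_(o : {set triple} | o \subset P) (-1) ^+ #|o| *
      \prod_(e in K) (x e ^+ outdeg arc_src arc_tgt P o e * f (x e))).
  apply: eq_bigr => x _; rewrite prod_sub_expand big_distrl /=; apply: eq_bigr => o _.
  rewrite [X in _ = _ * X]big_split mulrA /=; congr (_ * _ * _).
  transitivity (\prod_(i in P) x (arc_end arc_src arc_tgt o i)).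
    by apply: eq_bigr => i _; rewrite /arc_end; case: ifP.
  rewrite (partition_big (arc_end arc_src arc_tgt o) (mem K)) /= => [|i]; last first.
    by rewrite inE /arc_end => /andP[sK tK]; case: ifP.
  apply: eq_bigr => e _; rewrite -prodr_const; apply: eq_big => [i|i /andP[_ /eqP->]//].
  by rewrite !inE.
rewrite exchange_big; apply: eq_bigr => o _ /=; rewrite -big_distrr /=; congr (_ * _).
rewrite /moment (big_distr_big 0) /=.
by apply: eq_bigl => x.
Qed.

(** A monomial of the right degree other than the uniform one has an exponent below [n - 2], whose
    moment vanishes. So [color_sum] is, up to sign, the coefficient of the uniform monomial. *)
Lemma alon_tarsi_of_color_sum : color_sum != 0 ->
  alon_tarsi F arc_src arc_tgt K (fun=> n.-1).
Proof.
rewrite color_sum_functional => S0; exists (fun=> n.-2).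
  by move=> e _; move: n_gt1; case: (n) => [|[]].
rewrite -/P; apply: contra_neq S0 => G0.
transitivity ((-1) ^+ #|K| *
    graph_functional arc_src arc_tgt P K (exponent_is F (fun=> n.-2))).
  rewrite /graph_functional big_distrr /=; apply: eq_bigr => o _.
  rewrite mulrCA; congr (_ * _).
  have moment_neq0 k : moment k != 0 -> (n.-2 <= k)%N.
    rewrite momentE; apply: contraNT; rewrite -ltnNge => lt_k.
    by rewrite !gtnNdvd ?subrr //; move: n_gt1 lt_k; lia.
  have moment_min : moment n.-2 = -1.
    have nE : n.-2.+2 = n by move: n_gt1; case: (n) => [|[]].
    rewrite momentE nE dvdnn gtnNdvd ?subr0 //; move: n_gt1; lia.
  have [/forall_inP deg|/forall_inPn[e eK ne]] :=
      boolP [forall e in K, outdeg arc_src arc_tgt P o e == n.-2].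
    rewrite -prodr_const -big_split /=; apply: eq_bigr => e eK.
    by rewrite (eqP (deg e eK)) moment_min /exponent_is eqxx mulr1.
  rewrite [X in _ = _ * X](bigD1 e) //= /exponent_is (negPf ne) mul0r mulr0.
  have [g gK lt_g] : exists2 g, g \in K & (outdeg arc_src arc_tgt P o g < n.-2)%N.
    apply/exists_inP; apply: contraR ne; rewrite negb_exists_in => /forall_inP ge.
    have {}ge g : g \in K -> (n.-2 <= outdeg arc_src arc_tgt P o g)%N.
      by move=> gK; rewrite leqNgt ge.
    have := sum_outdeg arc_src arc_tgt K o; rewrite -/P card_P -sum_nat_const.
    rewrite (bigD1 e) //= [in RHS](bigD1 e) //=.
    have : (\sum_(g in K | g != e) n.-2 <=
        \sum_(g in K | g != e) outdeg arc_src arc_tgt P o g)%N.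
      by apply: leq_sum => g /andP[gK _]; apply: ge.
    have := ge e eK; rewrite eqn_leq => -> /=.
    rewrite andbT => le_sum sumE.
    by rewrite -(leq_add2r (\sum_(g in K | g != e) n.-2)) -sumE leq_add2l.
  rewrite (bigD1 g) //= (_ : moment _ = 0) ?mul0r //.
  by apply/eqP; apply: contraTT lt_g => /moment_neq0; rewrite leqNgt.
by rewrite G0 mulr0.
Qed.

Let phi (c : V) : F := c.+1%:R.

Let phiE (c : V) : (phi c : nat) = c.+1.
Proof.
rewrite /phi val_Fp_nat // modn_small //.
by have := ltn_ord c; have := prime_gt0 p_prime; lia.
Qed.

Let phi_inj : injective phi.
Proof. by move=> c d /(congr1 (fun z : F => nat_of_ord z)); rewrite !phiE => -[/val_inj]. Qed.

Let phi_neq0 c : phi c != 0.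
Proof. by apply/eqP => /(congr1 (fun z : F => nat_of_ord z)); rewrite phiE. Qed.

Let a0 : V := Ordinal (ltnW n_gt1).

Let phi_a0 : phi a0 = 1.
Proof. by []. Qed.

Let psi (z : F) : V := odflt a0 [pick c | phi c == z].

Let psiK c : psi (phi c) = c.
Proof.
by rewrite /psi; case: pickP => [d /eqP/phi_inj//|/(_ c)]; rewrite eqxx.
Qed.

Let phiK z : z != 0 -> phi (psi z) = z.
Proof.
move=> z0; have lt_z : (z.-1 < n)%N.
  have z_gt0 : (0 < z)%N by rewrite lt0n; apply: contra z0 => /eqP z0; apply/eqP/val_inj.
  have := ltn_ord z; rewrite [X in (_ < X)%N]Fp_cast // => lt_zp.
  by move: z_gt0 lt_zp; move: (z : nat) => k; lia.
have zE : phi (Ordinal lt_z) = z.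
  apply/val_inj; rewrite [LHS]phiE /= prednK // lt0n.
  by apply: contra z0 => /eqP z0; apply/eqP/val_inj.
by rewrite -zE psiK.
Qed.

Let sub_row (r : V -> V) (v : V) : F :=
  \prod_(w | w != v) \prod_(w' : V | (w < w')%N && (w' != v)) (phi (r w') - phi (r w)).

Let vandermonde_row (r : V -> V) :
  \prod_(w : V) \prod_(w' : V | (w < w')%N) (phi (r w') - phi (r w)) =
  fsgn F r * \prod_(w : V) \prod_(w' : V | (w < w')%N) (phi w' - phi w).
Proof.
have vdm (s : V -> V) : \det (Vandermonde n (\row_i phi (s i))) =
    \prod_(w : V) \prod_(w' : V | (w < w')%N) (phi (s w') - phi (s w)).
  rewrite det_Vandermonde; apply: eq_bigr => w _; apply: eq_bigr => w' _.
  by rewrite !mxE.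
rewrite -vdm -(vdm id) fsgn_det mulrC -[X in _ * X]det_tr -det_mulmx.
congr (\det _); apply/matrixP => i j; rewrite !mxE (bigD1 (r j)) //= !mxE eqxx.
by rewrite mulr1 big1 ?addr0 // => k ki; rewrite !mxE eq_sym (negPf ki) mulr0.
Qed.

Let row_const (v : V) : F := \prod_(w | w != v) (if (w < v)%N then -1 else 1) *
  \prod_(c | c != a0) (phi c - 1).

(** Adding the diagonal slot, of color [a0], completes the product to a Vandermonde product of all
    colors. The new factors [phi c - 1] run over all [c != a0], hence depend on [r] in no way. *)
Let sub_row_fsgn (r : V -> V) (v : V) : injective r -> r v = a0 ->
  sub_row r v * row_const v =
  fsgn F r * \prod_(w : V) \prod_(w' : V | (w < w')%N) (phi w' - phi w).
Proof.
move=> rI rv; rewrite -vandermonde_row [RHS](bigD1 v) //=.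
have -> : \prod_(w : V | w != v) \prod_(w' : V | (w < w')%N) (phi (r w') - phi (r w)) =
    \prod_(w : V | w != v) (if (w < v)%N then 1 - phi (r w) else 1) * sub_row r v.
  rewrite -big_split; apply: eq_bigr => w wv /=; case: ltnP => [lt_wv|le_vw].
    by rewrite (bigD1 v) //= rv phi_a0.
  rewrite mul1r; apply: eq_bigl => w'; case: eqP => [->|_]; last by rewrite andbT.
  by rewrite andbF ltnNge le_vw.
rewrite [RHS]mulrA [LHS]mulrC; congr (_ * _); rewrite /row_const.
have -> : \prod_(c | c != a0) (phi c - 1) = \prod_(w | w != v) (phi (r w) - 1).
  rewrite (reindex r) /=; last by exists (invF rI) => c _; rewrite ?invF_f ?f_invF.
  by apply: eq_bigl => w; rewrite -rv (inj_eq rI).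
have -> : \prod_(w' : V | (v < w')%N) (phi (r w') - phi (r v)) =
    \prod_(w | w != v) (if (v < w)%N then phi (r w) - 1 else 1).
  rewrite -big_mkcondr; apply: eq_big => w; last by rewrite rv phi_a0.
  by case: eqP => [->|//]; rewrite ltnn.
rewrite -big_split -[RHS]big_split; apply: eq_bigr => w wv /=.
case: ltngtP => [lt|gt|/val_inj e]; rewrite ?mulr1 ?mul1r //.
  by rewrite mulN1r opprB.
by rewrite e eqxx in wv.
Qed.

Let row_const_neq0 v : row_const v != 0.
Proof.
rewrite mulf_neq0 //; apply/prodf_neq0 => w; first by case: ifP; rewrite ?oppr_eq0 oner_eq0.
by move=> wa; rewrite subr_eq0 -phi_a0 (inj_eq phi_inj).
Qed.

Let edge_ends (e : {set V}) : slot :=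
  odflt (a0, a0) [pick x : slot | (x.1 < x.2)%N && (e == [set x.1; x.2])].

Let edge_colors (g : {ffun slot -> V}) : {ffun {set V} -> F} :=
  [ffun e => if e \in K then phi (g (edge_ends e)) else 0].

Let slot_colors (x : {ffun {set V} -> F}) : {ffun slot -> V} :=
  [ffun y => if y.1 == y.2 then a0 else psi (x [set y.1; y.2])].

Let symmetric (g : {ffun slot -> V}) :=
  [forall x, g x == if x.1 == x.2 then a0 else g (x.2, x.1)].

Let symmetricP (g : {ffun slot -> V}) : symmetric g ->
  (forall v, g (v, v) = a0) /\ forall v w, g (v, w) = g (w, v).
Proof.
move=> /forallP sg; split=> [v|v w]; first by rewrite (eqP (sg (v, v))) /= eqxx.
have [->//|vw] := eqVneq v w; by rewrite (eqP (sg (v, w))) /= (negPf vw).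
Qed.

Let compatible_symmetric (g : {ffun slot -> V}) : compatible setT [ffun=> a0] g = symmetric g.
Proof.
apply: eq_forallb => x; rewrite /bdry in_setT andbT ffunE /slot_inv.
by case: (x.1 == x.2).
Qed.

Let edge_in_K v w : ([set v; w] \in K) = (v != w).
Proof. by rewrite inE cards2; case: (v == w). Qed.

Let edge_endsE (v w : V) : (v < w)%N -> edge_ends [set v; w] = (v, w).
Proof.
move=> vw; rewrite /edge_ends; case: pickP => [[v' w'] /= /andP[vw' /eqP E]|].
  by have [-> ->] := set2_ordered_inj vw vw' E.
by move/(_ (v, w)); rewrite /= vw eqxx.
Qed.

Let edge_colorsE g v w : symmetric g -> v != w ->
  edge_colors g [set v; w] = phi (g (v, w)).
Proof.
move=> /symmetricP[_ sg] vw; rewrite ffunE edge_in_K vw; congr phi.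
case: (ltngtP v w) => [lt|gt|/val_inj e]; last by rewrite e eqxx in vw.
  by rewrite edge_endsE.
by rewrite setUC edge_endsE.
Qed.

Let slot_colorsK g : (slot_colors (edge_colors g) == g) = symmetric g.
Proof.
apply/eqP/idP => [gE|sg].
  apply/forallP => -[v w] /=; rewrite -gE !ffunE /=.
  rewrite [w == v]eq_sym; case: (eqVneq v w) => // _; by rewrite setUC.
apply/ffunP => -[v w]; rewrite ffunE /=; case: eqVneq => [->|vw].
  by case/symmetricP: sg => ->.
by rewrite edge_colorsE // psiK.
Qed.

Let edge_colors_support g :
  (edge_colors g \in pffun_on 0 (mem K) predT) && [forall e in K, edge_colors g e != 0].
Proof.
apply/andP; split; last by apply/forall_inP => e eK; rewrite ffunE eK phi_neq0.
apply/pffun_onP; split=> //; apply/subsetP => e; rewrite inE ffunE.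
by case: ifP => //; rewrite eqxx.
Qed.

Let edge_colorsK x : x \in pffun_on 0 (mem K) predT -> [forall e in K, x e != 0] ->
  edge_colors (slot_colors x) = x.
Proof.
move=> /pffun_onP[/subsetP supp _] /forall_inP x0.
apply/ffunP => e; rewrite ffunE; case: ifPn => [eK|eNK]; last first.
  by apply/esym/eqP; apply: contraNT eNK => xe; apply: supp; rewrite inE.
have := eK; rewrite inE => /cards2P[v [w [vw eE]]].
wlog lt_vw : v w vw eE / (v < w)%N => [wl|].
  case: (ltngtP v w) => [|gt|/val_inj e']; [exact: wl| |by rewrite e' eqxx in vw].
  by apply: (wl w v) => //; [rewrite eq_sym | rewrite setUC].
by rewrite {1}eE edge_endsE // ffunE /= (negPf vw) -eE phiK ?x0.
Qed.

Let color_term (x : {ffun {set V} -> F}) : F :=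
  (\prod_(i in P) (x (arc_src i) - x (arc_tgt i))) * \prod_(e in K) f (x e).

Let color_sum_symmetric :
  color_sum = \sum_(g : {ffun slot -> V} | symmetric g) color_term (edge_colors g).
Proof.
rewrite /color_sum (bigID (fun x : {ffun {set V} -> F} => [forall e in K, x e != 0])) /=.
rewrite [X in _ + X]big1 ?addr0 => [|x /andP[_]]; last first.
  case/forall_inPn => e eK; rewrite negbK => /eqP xe.
  by rewrite [X in _ * X](bigD1 e) //= /f xe !mul0r mulr0.
rewrite (reindex_onto edge_colors slot_colors) => [|x /andP[]]; last exact: edge_colorsK.
by apply: eq_bigl => g; rewrite edge_colors_support slot_colorsK.
Qed.

Let in_P_ends v w w' : (v, (w, w')) \in P ->
  [/\ arc_src (v, (w, w')) = [set v; w'], arc_tgt (v, (w, w')) = [set v; w],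
      v != w & v != w'].
Proof.
by rewrite in_P => /and3P[lt wv wv']; rewrite /arc_src /= lt ![v == _]eq_sym.
Qed.

Let arc_prod g : symmetric g ->
  \prod_(i in P) (edge_colors g (arc_src i) - edge_colors g (arc_tgt i)) =
  \prod_v sub_row (fun w => g (v, w)) v.
Proof.
move=> sg.
transitivity (\prod_(v : V) \prod_(u : slot | (u.1 != v) && ((u.1 < u.2)%N && (u.2 != v)))
    (phi (g (v, u.2)) - phi (g (v, u.1)))).
  rewrite pair_big_dep; apply: eq_big => [[v [w w']]|[v [w w']] vP].
    by rewrite in_P /=; do 2!case: (_ != _); rewrite ?andbF.
  have [-> -> vw vw'] := in_P_ends vP; by rewrite !edge_colorsE.
by apply: eq_bigr => v _; rewrite /sub_row pair_big_dep.
Qed.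

Let card_color_class g c : symmetric g -> (forall v, injective (fun w => g (v, w))) ->
  c != a0 -> #|[set e in K | edge_colors g e == phi c]| = n./2.
Proof.
move=> sg gI ca; have [g0 gC] := symmetricP sg; set M := [set e in K | _].
have memM v w : ([set v; w] \in M) = (v != w) && (g (v, w) == c).
  rewrite inE edge_in_K; case: (boolP (v == w)) => //= vw.
  by rewrite edge_colorsE // (inj_eq phi_inj).
have ends e v : e \in M -> v \in e -> exists2 w, e = [set v; w] & g (v, w) = c.
  move=> eM; have: e \in K by move: eM; rewrite inE => /andP[].
  rewrite inE => /cards2P[x [y [_ eE]]]; move: eM; rewrite eE in_set2.
  rewrite memM => /andP[_ /eqP gc] /orP[]/eqP->; first by exists y.
  by exists x; [rewrite setUC | rewrite gC].
have pM : partition M [set: V].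
  apply/and3P; split.
  - rewrite eqEsubset subsetT; apply/subsetP => v _; apply/bigcupP.
    have gv : g (v, invF (gI v) c) = c by exact: (f_invF (gI v)).
    exists [set v; invF (gI v) c]; last by rewrite set21.
    rewrite memM gv eqxx andbT; apply: contra_eq_neq gv => <-.
    by rewrite g0 eq_sym.
  - apply/trivIsetP => e e' eM eM'; apply: contraNT; rewrite -setI_eq0.
    case/set0Pn => v; rewrite inE => /andP[ve ve'].
    have [w -> gw] := ends e v eM ve; have [w' -> gw'] := ends e' v eM' ve'.
    by rewrite (gI v w w') // gw gw'.
  - by rewrite inE inE cards0.
have M2 : {in M, forall e : {set V}, #|e| = 2%N}.
  by move=> e; rewrite inE => /andP[]; rewrite inE => /eqP.
have := card_uniform_partition M2 pM; rewrite cardsT card_ord muln2.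
by move=> /(congr1 half); rewrite doubleK => ->.
Qed.

Let color_const : F :=
  (\prod_v ((\prod_(w : V) \prod_(w' : V | (w < w')%N) (phi w' - phi w)) / row_const v)) *
  \prod_(c | c != a0) f (phi c) ^+ n./2.

(** Every color other than [a0] occurs on exactly [n./2] edges, so the product of the values of [f]
    is the same for all proper colorings. *)
Let color_term_proper g : symmetric g -> (forall v, injective (fun w => g (v, w))) ->
  color_term (edge_colors g) = color_const * row_sign F g.
Proof.
move=> sg gI; have [g0 gC] := symmetricP sg.
rewrite /color_term arc_prod // /color_const mulrAC; congr (_ * _).
  rewrite /row_sign -big_split; apply: eq_bigr => v _ /=.
  apply: (mulIf (row_const_neq0 v)); rewrite sub_row_fsgn // [RHS]mulrAC divfK //.
  by rewrite mulrC.
have color_neq e : e \in K -> psi (edge_colors g e) != a0.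
  rewrite inE => /cards2P[v [w [vw ->]]]; rewrite edge_colorsE // psiK.
  by rewrite -(g0 v) (inj_eq (gI v)) eq_sym.
rewrite (partition_big (fun e => psi (edge_colors g e)) (fun c => c != a0)) //=.
apply: eq_bigr => c ca; rewrite -(card_color_class sg gI ca) -prodr_const.
have colorE e : e \in K -> (psi (edge_colors g e) == c) = (edge_colors g e == phi c).
  by move=> eK; rewrite ffunE eK psiK (inj_eq phi_inj).
apply: eq_big => [e|e /andP[eK]]; last by rewrite colorE // => /eqP->.
by rewrite inE; case: (boolP (e \in K)) => //= eK; rewrite colorE.
Qed.

(** A repeated color at [v] annihilates the factor of an arc or, if one of the two slots is
    [(v, v)], puts the color [a0] on an edge, where [f] vanishes. *)
Let color_term_improper g v : symmetric g -> ~ injective (fun w => g (v, w)) ->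
  color_term (edge_colors g) = 0.
Proof.
move=> sg ninj; have [g0 gC] := symmetricP sg.
have f0 w : w != v -> g (v, w) = a0 -> color_term (edge_colors g) = 0.
  move=> wv gw; rewrite /color_term [X in _ * X](bigD1 [set v; w]) /=.
    by rewrite edge_colorsE 1?eq_sym // gw phi_a0 /f subrr mulr0 mul0r mulr0.
  by rewrite edge_in_K eq_sym.
have [/existsP[w /existsP[w' /andP[ww' /eqP gw]]]|no] :=
    boolP [exists w, exists w', (w != w') && (g (v, w) == g (v, w'))]; last first.
  case: ninj => w w' gw; apply/eqP; apply: contraNT no => ww'.
  by apply/existsP; exists w; apply/existsP; exists w'; rewrite ww' gw eqxx.
have [wv|wv] := eqVneq w v.
  by apply: (f0 w'); [rewrite -wv eq_sym | rewrite -gw wv].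
have [wv'|wv'] := eqVneq w' v; first by apply: (f0 w) => //; rewrite gw wv'.
wlog lt : w w' ww' gw wv wv' / (w < w')%N => [wl|].
  case: (ltngtP w w') => [|gt|/val_inj e]; [exact: wl| |by rewrite e eqxx in ww'].
  by apply: (wl w' w) => //; rewrite eq_sym.
have vP : (v, (w, w')) \in P by rewrite in_P lt wv wv'.
have [sE tE vw vw'] := in_P_ends vP.
by rewrite /color_term (bigD1 _ vP) /= sE tE !edge_colorsE // gw subrr !mul0r.
Qed.

Let color_sum_weight : color_sum = color_const * weight F setT [ffun=> a0].
Proof.
rewrite color_sum_symmetric /weight big_distrr /=.
apply: eq_big => [g|g sg]; first by rewrite compatible_symmetric.
have [/forallP gI|/forallPn[v nI]] := boolP [forall v, injectiveb (fun w => g (v, w))].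
  by apply: color_term_proper => // v; apply/injectiveP.
rewrite (@color_term_improper _ v) //; last by move/injectiveP; apply/negP.
rewrite /row_sign (bigD1 v) //= [fsgn F _]fsgn0 ?mul0r ?mulr0 //.
by move/injectiveP; apply/negP.
Qed.

Let color_const_neq0 : color_const != 0.
Proof.
apply: mulf_neq0.
  apply/prodf_neq0 => v _; rewrite mulf_neq0 ?invr_eq0 ?row_const_neq0 //.
  apply/prodf_neq0 => w _; apply/prodf_neq0 => w' ww'.
  by rewrite subr_eq0 (inj_eq phi_inj) -(val_eqE w' w) gtn_eqF.
apply/prodf_neq0 => c ca; rewrite expf_neq0 // mulf_neq0 ?phi_neq0 //.
by rewrite subr_eq0 -phi_a0 (inj_eq phi_inj).
Qed.

Lemma complete_graph_alon_tarsi : (forall a : V, weight F setT [ffun=> a] != 0) ->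
  alon_tarsi F arc_src arc_tgt K (fun=> n.-1).
Proof.
move=> W0; apply: alon_tarsi_of_color_sum.
by rewrite color_sum_weight mulf_neq0 ?color_const_neq0.
Qed.

End InitialPosition.

(** * Comparison of the coloring indices, and the lower bound *)

Section ColoringComparison.
Variable T : finType.
Implicit Types (E U : {set {set T}}).

Lemma painter_wins_list_coloring U (t : {ffun {set T} -> nat}) (L : {set T} -> seq nat) :
  painter_wins U t -> (forall e, e \in U -> uniq (L e) /\ size (L e) = t e) ->
  exists c : {set T} -> nat,
    (forall e, e \in U -> c e \in L e) /\ proper_edge_coloring U c.
Proof.
move=> win; elim: win L => {}U {}t s t_gt0 sM _ IH L Lt.
have [U0|/set0Pn[e0 e0U]] := eqVneq U set0.
  by exists (fun=> 0); split=> [e|e f]; rewrite U0 inE.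
have [k kL] : exists k, k \in L e0.
  have [_] := Lt e0 e0U; have := t_gt0 e0 e0U.
  by case: (L e0) => [|k l]; [move=> + e | exists k; rewrite inE eqxx]; rewrite -?e.
(* The play to consider is that in which Lister goes through the colors one by
   one, marking the edges that have the current color in their list. *)
pose A := [set e in U | k \in L e].
have mA : lister_move U A.
  apply/andP; split; first by apply/subsetP => e; rewrite inE => /andP[].
  by apply/set0Pn; exists e0; rewrite inE e0U.
have /andP[/subsetP BA /trivIsetP trivB] := sM A mA.
have [|c [cL cP]] := IH A mA (fun e => rem k (L e)).
  move=> e; rewrite inE => /andP[_ eU]; have [uL sL] := Lt e eU.
  rewrite rem_uniq // ffunE inE eU /=; split=> //.
  case: (boolP (k \in L e)) => kLe; first by rewrite size_rem // sL subn1.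
  by rewrite rem_id // sL subn0.
have neq_k e : e \in U -> e \notin s A -> c e \in L e /\ c e != k.
  move=> eU eB; have := cL e; rewrite inE eB eU => /(_ isT).
  have [uL _] := Lt e eU.
  by rewrite rem_filter // mem_filter /= => /andP[].
exists (fun e => if e \in s A then k else c e); split=> [e eU|e f eU fU ef nd].
  case: ifPn => [/BA|eB]; first by rewrite inE => /andP[].
  by have [] := neq_k e eU eB.
case: ifPn => eB; case: ifPn => fB.
- by rewrite trivB in nd.
- by have [_ /eqP ck] := neq_k f fU fB; move/esym.
- by have [_ /eqP ck] := neq_k e eU eB.
- by apply: cP; rewrite // inE ?eB ?fB.
Qed.

Lemma edge_paintable_choosable E k : edge_paintable E k -> edge_choosable E k.
Proof.
move=> win L Lk; apply: (painter_wins_list_coloring win) => e /Lk[uL sL].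
by rewrite ffunE.
Qed.

Lemma edge_choosable_colorable E k : edge_choosable E k -> edge_colorable E k.
Proof.
move=> /(_ (fun=> iota 0 k))[|c [cL cP]].
  by move=> e _; rewrite iota_uniq size_iota.
by exists c; split=> // e /cL; rewrite mem_iota.
Qed.

End ColoringComparison.

(** The edges at one vertex need different colors. *)
Lemma complete_graph_colorable_ge n k :
  edge_colorable (complete_graph n) k -> n.-1 <= k.
Proof.
case: n => // n [c [ck cP]] /=.
pose star (i : 'I_n) : {set 'I_n.+1} := [set ord0; lift ord0 i].
have starK i : star i \in complete_graph n.+1 by rewrite inE cards2.
have cI : injective (fun i => Ordinal (ck _ (starK i))).
  move=> i j /(congr1 val) /= cij; apply/eqP; apply: contraTT isT => ij.
  case: (cP _ _ (starK i) (starK j)) => //.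
    apply: contra ij => /eqP/setP/(_ (lift ord0 i)); rewrite in_set2 eqxx orbT.
    rewrite in_set2 => /esym/orP[]/eqP; first by move/(congr1 val).
    by move/lift_inj->.
  by rewrite -setI_eq0; apply/set0Pn; exists ord0; rewrite inE !set21.
by have := leq_card _ cI; rewrite !card_ord.
Qed.

(** * The Legendre symbol and the final evaluation *)

Section SignedCountModP.
Local Open Scope ring_scope.
Variable p : nat.
Hypothesis p_prime : prime p.
Hypothesis p_odd : odd p.
Local Notation n := p.-1.
Local Notation F := 'F_p.

Let n_even : ~~ odd n := pred_prime_even p_prime p_odd.
Let n_gt1 : (1 < n)%N := pred_prime_gt1 p_prime p_odd.

Lemma intF_eq0 (m : int) : (m%:~R == 0 :> F) = (p %| m)%Z.
Proof.
rewrite dvdzE /= -natF_eq0 //; case: m => k; first by [].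
by rewrite NegzE rmorphN oppr_eq0.
Qed.

Lemma intF_eq_mod (a b : int) : a%:~R = b%:~R :> F -> (a = b %[mod p])%Z.
Proof.
by move=> /eqP; rewrite -subr_eq0 -rmorphB intF_eq0 => ?; apply/eqP; rewrite eqz_mod_dvd.
Qed.

Lemma euler_criterionF (y : F) : y != 0 ->
  y ^+ n./2 = if [exists x : F, x ^+ 2 == y] then 1 else -1.
Proof.
move=> y0; have n2 : n = (n./2 * 2)%N by rewrite muln2 even_halfK.
case: ifP => [/existsP[x /eqP xy]|nsq].
  rewrite -xy -exprM mulnC -n2 fermatF //.
  by apply: contraNneq y0 => x0; rewrite -xy x0 expr0n.
have: (y ^+ n./2) ^+ 2 == 1 by rewrite -exprM -n2 fermatF.
rewrite sqrf_eq1 => /orP[/eqP y1|/eqP//]; case/negP: (negbT nsq).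
have n_gt0 : (0 < n)%N by apply: ltnW.
pose rs := enum [pred x : F | x != 0].
have: has n.-primitive_root rs.
  apply: has_prim_root; rewrite ?enum_uniq //.
    by apply/allP => x; rewrite mem_enum => x0; apply/unity_rootP; rewrite fermatF.
  rewrite -cardE (eq_card (B := predC1 0)) // cardC1 card_ord.
  by rewrite Fp_cast.
case/hasP => z _ prim_z.
have [k yE] := prim_rootP prim_z (fermatF p_prime y0).
have: (n./2 * 2 %| n./2 * k)%N.
  by rewrite -n2 (prim_order_dvd prim_z) mulnC exprM -yE y1.
rewrite dvdn_pmul2l ?half_gt0 // => /dvdnP[l kE].
by apply/existsP; exists (z ^+ l); rewrite -exprM -kE yE.
Qed.

Lemma legendreF (a : int) : (legendre a p)%:~R = a%:~R ^+ n./2 :> F.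
Proof.
have p_gt1 := prime_gt1 p_prime.
rewrite /legendre -intF_eq0; case: eqP => [->|/eqP a0].
  by rewrite expr0n gtn_eqF ?half_gt0.
rewrite euler_criterionF //.
suff -> : [exists x : F, x ^+ 2 == a%:~R] =
    [exists x : 'I_p, ((x : nat)%:Z ^+ 2 == a %[mod p])%Z] by case: ifP.
have modE (x : nat) : ((x%:Z ^+ 2 == a %[mod p])%Z) = (x%:R ^+ 2 == a%:~R :> F).
  by rewrite eqz_mod_dvd -intF_eq0 rmorphB rmorphXn subr_eq0.
apply/existsP/existsP => [[x xa]|[x]]; last by rewrite modE; exists (x : nat)%:R.
have lt_x : (x < p)%N by have := ltn_ord x; rewrite [X in (_ < X)%N]Fp_cast.
by exists (Ordinal lt_x); rewrite modE /= natr_Zp.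
Qed.

(** Both evaluations use the constant [kappa] of [labeling_sign]. The first cancels the factor
    [n/2 + 1], and its validity for every [a] gives the nonvanishing needed for Painter; the second
    uses [(n - 1)! = 1] in [F]. *)
Lemma exists_weight_setT : exists kappa : F,
  (forall a : 'I_n, kappa * weight F setT [ffun=> a] = (- 2%:R) ^+ n./2) /\
  kappa * weight F setT [ffun=> Ordinal (ltnW n_gt1)] = (signed_count n)%:~R.
Proof.
have [kappa kappaP] := labeling_sign n_even F; exists kappa; split=> [a|].
  have half_neq0 : n./2.+1%:R != 0 :> F.
    by rewrite small_natF_neq0 //; move: n_gt1 n_even; lia.
  apply: (mulfI half_neq0); rewrite mulrCA -weight_all_free // -skew_sum_weight //.
  by rewrite skew_sum_diag // diag_term.
rewrite weight_setT_signed_count // [X in X * _](_ : _ = 1) ?mul1r //.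
apply: (mulfI (_ : n%:R != 0 :> F)); first by rewrite natF_pred // oppr_eq0 oner_eq0.
rewrite -natrM mulr1 natF_pred // -fact_predF //; congr (_%:R).
by move: n_gt1; case: (n) => [|m] //= _; rewrite factS.
Qed.

End SignedCountModP.

Theorem theorem1p1 (p : nat) (p_prime : prime p) (p_odd : odd p) :
  (signed_count (p - 1) = legendre (- 2) p %[mod p])%Z /\
  is_chromatic_index (complete_graph (p - 1)) (p - 2) /\
  is_list_chromatic_index (complete_graph (p - 1)) (p - 2) /\
  is_paintability_index (complete_graph (p - 1)) (p - 2).
Proof.
rewrite subn1 subn2; have [kappa [weightE countE]] := exists_weight_setT p_prime p_odd.
have two_neq0 : (2%:R != 0 :> 'F_p)%R by apply: two_natF_neq0.
split.
  by apply: (intF_eq_mod p_prime); rewrite legendreF // -countE weightE rmorphN.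
have paint : edge_paintable (complete_graph p.-1) p.-2.
  apply: (alon_tarsi_painter_wins two_neq0 (@arc_adjacent p)) => //.
  have [|alpha lt_alpha AT] := complete_graph_alon_tarsi p_prime p_odd.
    move=> a; have : (kappa * weight 'F_p setT [ffun=> a] != 0)%R.
      by rewrite weightE expf_neq0 // oppr_eq0.
    by rewrite mulf_eq0 negb_or => /andP[].
  by exists alpha => // e eK; rewrite ffunE lt_alpha.
have choose := edge_paintable_choosable paint.
split; [|split]; split=> //.
- exact: edge_choosable_colorable.
- exact: complete_graph_colorable_ge.
- by move=> j /edge_choosable_colorable; apply: complete_graph_colorable_ge.
- move=> j /edge_paintable_choosable/edge_choosable_colorable.
  exact: complete_graph_colorable_ge.
Qed.
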